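(* Let $A>B>0$, let $\Omega=\{(x,y)\in\mathbb{R}^2 : x^2/A^2+y^2/B^2<1\}$, and let $f$ be sufficiently smooth on $\overline{\Omega}$ (that is, $f\in C^N(\overline\Omega)$ with $N$ large enough). Assume the compatibility condition $$\frac{\partial^{p_1+p_2} f}{\partial x^{p_1}\partial y^{p_2}}=0\quad\text{at }(\pm A,0)\quad\text{for all integers }p_1,p_2\ge 0\text{ with }0\le 2p_1+p_2\le 2 .$$ For $\varepsilon>0$ let $u^\varepsilon$ be the solution of $$-\varepsilon\Delta u^\varepsilon-\frac{\partial u^\varepsilon}{\partial y}=f\ \text{ in }\Omega,\qquad u^\varepsilon=0\ \text{ on }\partial\Omega ,$$ let $u^0$ be the solution of the limit problem $$-\frac{\partial u^0}{\partial y}=f\ \text{ in }\Omega,\qquad u^0=0\ \text{ on }\Gamma_+=\{(x,y): x^2/A^2+y^2/B^2=1,\ y>0\},$$ and let $\bar\varphi^0$ be the (cut-off) corrector defined in the context. Then there is a constant $\kappa>0$ independent of $\varepsilon$ such that, for all sufficiently small $\varepsilon>0$, $$|u^\varepsilon-u^0-\bar\varphi^0|_{L^2(\Omega)}+\sqrt{\varepsilon}\,|u^\varepsilon-u^0-\bar\varphi^0|_{H^1(\Omega)}\le \kappa\sqrt{\varepsilon}.$$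
   Context: Elliptic coordinates: let $a>0$ and $R>0$ be determined by $a\cosh R=A$, $a\sinh R=B$, and set $$x=a\cosh(R-\eta)\cos\tau,\qquad y=a\sinh(R-\eta)\sin\tau,\qquad 0\le\eta<R,\ \tau\in[0,2\pi].$$ The boundary $\partial\Omega$ corresponds to $\eta=0$. The limit solution is explicitly $u^0(x,y)=\int_y^{C_u(x)} f(x,s)\,ds$ with $C_u(x)=B\sqrt{1-x^2/A^2}$; it is extended to the lower boundary by the same formula. Corrector: with $B_x(\tau)=a\cosh R\cos\tau$ and $B_y(\tau)=a\sinh R\sin\tau$, the corrector is the function on $\Omega$ given in the coordinates $(\eta,\tau)$ by $$\bar\varphi^0=-u^0(B_x(\tau),B_y(\tau))\exp\!\left(\frac{A\sin\tau}{\varepsilon}\,\eta\right)\chi_{[\pi,2\pi]}(\tau)\,\delta(\eta),$$ where $\chi_{[\pi,2\pi]}$ is the characteristic function of $[\pi,2\pi]$ and $\delta$ is a fixed smooth cut-off function (independent of $\varepsilon$) with $\delta(\eta)=1$ for $\eta\in[0,R/2]$ and $\delta(\eta)=0$ for $\eta\in[3R/4,R]$. Without the factor $\delta(\eta)$, and with $\bar\eta=\eta/\varepsilon$, this is the decaying solution of $-\partial_{\bar\eta}^2\varphi^0+a\cosh R\,\sin\tau\,\partial_{\bar\eta}\varphi^0=0$ for $\bar\eta>0$, $\pi<\tau<2\pi$, with value $-u^0(B_x(\tau),B_y(\tau))$ at $\bar\eta=0$. *)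

(* Defs.v *)
From HB Require Import structures.
From mathcomp Require Import all_boot all_order all_algebra.
From mathcomp Require Import all_classical all_reals all_analysis.

Set Implicit Arguments.
Unset Strict Implicit.
Unset Printing Implicit Defensive.

Import Order.TTheory GRing.Theory Num.Theory.
Import numFieldNormedType.Exports.

Local Open Scope classical_set_scope.
Local Open Scope ring_scope.

Section calculus.
Context {R : realType}.
Implicit Types (u g phi : R * R -> R) (U K : set (R * R)).

Definition coshR (x : R) : R := (expR x + expR (- x)) / 2.
Definition sinhR (x : R) : R := (expR x - expR (- x)) / 2.

Definition ex : R * R := (1, 0).
Definition ey : R * R := (0, 1).

Definition laplacian u (z : R * R) : R :=
  'D_ex ('D_ex u) z + 'D_ey ('D_ey u) z.

(* u is of class C^N on the open set U, with all its partial derivatives of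
   order at most N extending continuously to K, where U `<=` K `<=` closure U.
   For p + q <= N, D p q is the (unique) continuous extension to K of
   d^(p+q) u / dx^p dy^q; the values of D p q for p + q > N are irrelevant.
   - K = U gives C^N(U);
   - K = closure U gives C^N(closure U), and D p q z at a boundary point z is
     the boundary value of the partial derivative. *)
Definition partials (N : nat) U K u (D : nat -> nat -> R * R -> R) : Prop :=
  [/\ forall z, K z -> D 0%N 0%N z = u z,
      forall p q, (p + q <= N)%N -> {within K, continuous (D p q)} &
      forall p q z, (p + q < N)%N -> U z ->
        is_derive z ex (D p q) (D p.+1 q z) /\
        is_derive z ey (D p q) (D p q.+1 z)].

Definition Cn (N : nat) U u : Prop := exists D, partials N U U u D.

Definition test_function U phi : Prop :=
  (forall N, Cn N setT phi) /\
  exists K, [/\ compact K, K `<=` U & forall z, ~ K z -> phi z = 0].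

End calculus.

Section sobolev.
Context {R : realType}.

Local Notation plane := (measurableTypeR R * measurableTypeR R)%type.

Definition lebesgue2 : {measure set plane -> \bar R} :=
  (@lebesgue_measure R \x @lebesgue_measure R)%E.

Implicit Types (u g : R * R -> R) (U : set (R * R)).

(* \_ is the extension by zero outside U. *)
Definition L2norm U u : \bar R :=
  Lnorm lebesgue2 2%:E (((EFin \o u) \_ U) : plane -> \bar R).

Definition L2 U u : Prop :=
  measurable_fun (U : set plane) (u : plane -> R) /\ (L2norm U u < +oo)%E.

Definition weak_derivative U (v : R * R) u g : Prop :=
  forall phi, test_function U phi ->
    (\int[lebesgue2]_(z in U) (u z * 'D_v phi z) =
     - \int[lebesgue2]_(z in U) (g z * phi z))%R.

(* The full H^1(U) norm. Weak derivatives are unique almost everywhere, so the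
   set below has at most one element; it is empty, and the norm is +oo, when u
   is not in H^1(U). *)
Definition H1norm U u : \bar R :=
  ereal_inf [set t : \bar R | exists g1 g2 : R * R -> R,
    [/\ L2 U u, L2 U g1 /\ L2 U g2,
        weak_derivative U ex u g1, weak_derivative U ey u g2 &
        t = sqrte (L2norm U u ^+ 2 + L2norm U g1 ^+ 2 + L2norm U g2 ^+ 2)%E]].

End sobolev.

Section ellipse.
Context {R : realType}.
Implicit Types (A B a rho eps : R) (f u : R * R -> R).

Definition ellipse A B : set (R * R) :=
  [set z | z.1 ^+ 2 / A ^+ 2 + z.2 ^+ 2 / B ^+ 2 < 1].

Definition ellipse_bd A B : set (R * R) :=
  [set z | z.1 ^+ 2 / A ^+ 2 + z.2 ^+ 2 / B ^+ 2 = 1].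

Definition Gamma_plus A B : set (R * R) :=
  ellipse_bd A B `&` [set z | 0 < z.2].

Definition Cu A B (x : R) : R := B * Num.sqrt (1 - x ^+ 2 / A ^+ 2).

(* Classical solution: C^2 inside, continuous up to the boundary. *)
Definition solution A B eps f u : Prop :=
  [/\ Cn 2 (ellipse A B) u,
      {within closure (ellipse A B), continuous u},
      forall z, ellipse A B z -> - eps * laplacian u z - 'D_ey u z = f z &
      forall z, ellipse_bd A B z -> u z = 0].

(* The first three clauses are the limit problem. The last one gives the values
   of u0 on the lower boundary, end points (A, 0) and (-A, 0) included, where
   the limit problem prescribes none but which enter the corrector: they are
   those of the integral formula satisfied by u0 inside the ellipse. *)
Definition limit_solution A B f (u0 : R * R -> R) : Prop :=
  [/\ {within ellipse A B `|` Gamma_plus A B, continuous u0},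
      forall z, ellipse A B z -> is_derive z ey u0 (- f z),
      forall z, Gamma_plus A B z -> u0 z = 0 &
      forall z, ellipse_bd A B z -> z.2 <= 0 ->
        u0 z = \int[lebesgue_measure]_(s in `[z.2, Cu A B z.1]) f (z.1, s)].

Definition elliptic a (r tau : R) : R * R :=
  (a * coshR r * cos tau, a * sinhR r * sin tau).

(* delta is a function on [0, rho]; its values elsewhere are irrelevant. It is
   smooth up to the end points because it is constant near them. *)
Definition cutoff rho (delta : R -> R) : Prop :=
  [/\ forall n x, 0 < x < rho -> derivable (derive1n n delta) x 1,
      forall x, 0 <= x <= rho / 2 -> delta x = 1 &
      forall x, 3 * rho / 4 <= x <= rho -> delta x = 0].

(* phi is the function on the ellipse given by the formula below in the
   coordinates (eta, tau), where z = elliptic a (rho - eta) tau. The value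
   eta = rho, where delta vanishes, accounts for the segment between the foci.
   The formula is compatible with elliptic a r 0 = elliptic a r (2 * pi)
   because u0 (A, 0) = 0. *)
Definition corrector A a rho eps (u0 : R * R -> R)
    (delta : R -> R) (phi : R * R -> R) : Prop :=
  forall eta tau, 0 <= eta <= rho -> 0 <= tau <= 2 * pi ->
    phi (elliptic a (rho - eta) tau) =
      - u0 (elliptic a rho tau) * expR (A * sin tau / eps * eta)
        * \1_(`[pi, 2 * pi]) tau * delta eta.

End ellipse.

(* Main.v *)
Require Import Defs.
From HB Require Import structures.
From mathcomp Require Import all_boot all_order all_algebra.
From mathcomp Require Import ring lra.
From mathcomp Require Import all_classical all_reals all_analysis.
From mathcomp Require Import measurable_realfun.
Import Order.TTheory GRing.Theory Num.Theory.
Import numFieldNormedType.Exports.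
Local Open Scope classical_set_scope.
Local Open Scope ring_scope.
Set Implicit Arguments.
Unset Strict Implicit.
Unset Printing Implicit Defensive.

(**
The remainder w = ueps - u0 - phi vanishes on the boundary, and a weighted
energy estimate bounds it.  Three difficulties shape the proof.

No second derivatives of u0 and phi.  The limit solution is only as smooth in
x as the chord integrals of f, and phi contains u0.  The estimate is therefore
made in divergence form.  Write r and tau for the elliptic coordinates,
q = cos tau and s = - sin tau, and let N = A s grad r.  In the lower half of
the ellipse s grad r is grad q turned by a right angle, because r and tau are
conjugate harmonic functions, so N has divergence zero.  The exponential in phi
is chosen so that eps grad phi equals phi N up to eps times a small field V2.
Hence the flux m = eps grad ueps - phi N is eps (grad w + b) with
b = grad u0 + V2, and the equation gives div m = - w_y - G with
G = phi_y + N . grad phi.  Since N . grad r + r_y is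
s (A - a cosh r) |grad r|^2, which vanishes on the boundary, G is as small as
V2 is (ell_conjugate, lay_conjugate, lay_error).

No control of the derivatives of ueps near the boundary.  The solution is only
continuous up to the boundary, so one cannot test the equation with w.  It is
tested with exp(y) F'(w), where F is a C^2 function close to the half square
that vanishes near 0: this has compact support in the ellipse, and the weight
exp(y) turns the transport term into a positive term of order zero
(truncated_energy).  Fatou's lemma removes the truncation and yields
int w^2 / 2 + eps |grad w|^2 <= const int (2 G^2 + eps |b|^2), without
any regularity of w at the boundary beyond continuity (energy_estimate).  The
same truncations show that grad w, set to zero where w vanishes, is the weak
gradient of w (weak_derivative_supp_grad).

The characteristic points (A, 0) and (- A, 0), where the layer degenerates.
Because f vanishes there, |f| <= K C with C(x) the half length of the vertical
chord at x (data_le_Cu); so u0 is C^1 with bounded gradient, and its trace on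
the lower boundary is of order C^2, that is of order s^2 (chord_total_C1).
With H the coordinate distance to the boundary, G and V2 are then at most
const s exp(- A s H / eps) (1 + s H / eps), and the square of this is at
most const c^2 / (1 + (c^2 t / eps)^2), c = C(x), with t the vertical distance
to the lower boundary (layer_bound).  The latter is the t-derivative of
eps atan(c^2 t / eps), so its integral over the ellipse is of order eps
uniformly in the width of the layer (layer_integral).  Therefore the integral of
2 G^2 + eps |b|^2 is of order eps, which is the theorem.
*)

(** * Functions of class C^1 on an open subset of the plane *)

Section continuity_at_a_point.
Context {R : realType} {T : topologicalType}.
Implicit Types (f g : T -> R) (z : T).

Lemma continuous_at_pair f g z :
  {for z, continuous f} -> {for z, continuous g} ->
  {for z, continuous (fun x => (f x, g x) : R * R)}.
Proof. by move=> cf cg; have H := cvg_pair cf cg; exact: H. Qed.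

Lemma near_gt_at f z c : {for z, continuous f} -> c < f z ->
  \forall x \near z, c < f x.
Proof. by move=> cf; exact: cvgr_gt. Qed.

Lemma near_lt_at f z c : {for z, continuous f} -> f z < c ->
  \forall x \near z, f x < c.
Proof. by move=> cf; exact: cvgr_lt. Qed.

Lemma near_eq_continuous_at f g z : (\forall x \near z, f x = g x) ->
  {for z, continuous f} -> {for z, continuous g}.
Proof.
move=> fg cf; rewrite /prop_for /continuous_at -(nbhs_singleton fg).
by apply: cvg_trans cf; exact: near_eq_cvg.
Qed.

End continuity_at_a_point.

Section plane_calculus.
Context {R : realType}.
Implicit Types (h u : R * R -> R) (z : R * R) (U : set (R * R)).

Lemma is_derive_exE h z d :
  is_derive z ex h d <-> is_derive z.1 (1 : R) (fun t => h (t, z.2)) d.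
Proof.
have E : (fun k : R => k^-1 *: ((h \o shift z) (k *: ex) - h z)) =
   (fun k : R => k^-1 *: (((fun t => h (t, z.2)) \o shift z.1) (k *: (1 : R))
      - h (z.1, z.2))).
  apply/funext => k; case: z => x y /=; congr (_ *: (h _ - _)).
  by rewrite /ex; congr pair; rewrite /= ?scaler0 ?add0r.
by split=> -[dh <-]; split; move: dh; rewrite /derivable /derive ?E.
Qed.

Lemma is_derive_eyE h z d :
  is_derive z ey h d <-> is_derive z.2 (1 : R) (fun t => h (z.1, t)) d.
Proof.
have E : (fun k : R => k^-1 *: ((h \o shift z) (k *: ey) - h z)) =
   (fun k : R => k^-1 *: (((fun t => h (z.1, t)) \o shift z.2) (k *: (1 : R))
      - h (z.1, z.2))).
  apply/funext => k; case: z => x y /=; congr (_ *: (h _ - _)).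
  by rewrite /ey; congr pair; rewrite /= ?scaler0 ?add0r.
by split=> -[dh <-]; split; move: dh; rewrite /derivable /derive ?E.
Qed.

Lemma continuous_vertical (x : R) : continuous (fun s : R => (x, s)).
Proof.
move=> s; change {for s, continuous (fun s : R => (x, s))}.
by apply: continuous_at_pair; [move=> ?; exact: cvg_cst|exact: cvg_id].
Qed.

(** The partial derivatives are named instead of chosen, so that the predicate restricts to
    smaller sets and passes through algebraic operations without any uniqueness argument. *)
Definition C1on U h h1 h2 := forall z, U z ->
  [/\ is_derive z ex h (h1 z), is_derive z ey h (h2 z),
      {for z, continuous h}, {for z, continuous h1} & {for z, continuous h2}].

Lemma C1on_cst U c : C1on U (fun=> c) (fun=> 0) (fun=> 0).
Proof.
by move=> z _; split; try exact: is_derive_cst; move=> ?; exact: cvg_cst.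
Qed.

Lemma C1on_D U f f1 f2 g g1 g2 : C1on U f f1 f2 -> C1on U g g1 g2 ->
  C1on U (fun z => f z + g z) (fun z => f1 z + g1 z) (fun z => f2 z + g2 z).
Proof.
move=> Hf Hg z Uz; have [a1 a2 a3 a4 a5] := Hf z Uz.
have [b1 b2 b3 b4 b5] := Hg z Uz.
by split; [exact: is_deriveD|exact: is_deriveD|exact: cvgD..].
Qed.

Lemma C1on_N U f f1 f2 : C1on U f f1 f2 ->
  C1on U (fun z => - f z) (fun z => - f1 z) (fun z => - f2 z).
Proof.
move=> Hf z Uz; have [a1 a2 a3 a4 a5] := Hf z Uz.
by split; [exact: is_deriveN|exact: is_deriveN|exact: cvgN..].
Qed.

Lemma C1on_M U f f1 f2 g g1 g2 : C1on U f f1 f2 -> C1on U g g1 g2 ->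
  C1on U (fun z => f z * g z) (fun z => f1 z * g z + f z * g1 z)
         (fun z => f2 z * g z + f z * g2 z).
Proof.
move=> Hf Hg z Uz; have [a1 a2 a3 a4 a5] := Hf z Uz.
have [b1 b2 b3 b4 b5] := Hg z Uz; split.
- have /is_derive_eq := is_deriveM a1 b1; apply.
  by rewrite /GRing.scale /= addrC [g z * _]mulrC.
- have /is_derive_eq := is_deriveM a2 b2; apply.
  by rewrite /GRing.scale /= addrC [g z * _]mulrC.
- exact: cvgM.
- by apply: cvgD; apply: cvgM.
- by apply: cvgD; apply: cvgM.
Qed.

Lemma C1on_comp U h h1 h2 (g g' : R -> R) : C1on U h h1 h2 ->
  (forall z, U z -> is_derive (h z) 1 g (g' (h z)) /\ {for h z, continuous g'}) ->
  C1on U (fun z => g (h z)) (fun z => g' (h z) * h1 z)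
    (fun z => g' (h z) * h2 z).
Proof.
move=> Hh Hg z Uz; have [a1 a2 a3 a4 a5] := Hh z Uz.
have [dg cg'] := Hg z Uz.
have cg : {for h z, continuous g}.
  by apply: differentiable_continuous; apply/derivable1_diffP; case: dg.
split.
- apply/is_derive_exE.
  apply: (@is_derive1_comp _ g (fun t => h (t, z.2))).
    by rewrite -surjective_pairing.
  by move/is_derive_exE: a1.
- apply/is_derive_eyE.
  apply: (@is_derive1_comp _ g (fun t => h (z.1, t))).
    by rewrite -surjective_pairing.
  by move/is_derive_eyE: a2.
- exact: continuous_comp.
- by apply: cvgM => //; apply: continuous_comp.
- by apply: cvgM => //; apply: continuous_comp.
Qed.

Lemma C1on_fst U : C1on U (fun z => z.1) (fun=> 1) (fun=> 0).
Proof.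
move=> z _; split.
- by apply/is_derive_exE; exact: is_derive_id.
- by apply/is_derive_eyE; exact: is_derive_cst.
- exact: cvg_fst.
- by move=> ?; exact: cvg_cst.
- by move=> ?; exact: cvg_cst.
Qed.

Lemma C1on_snd U : C1on U (fun z => z.2) (fun=> 0) (fun=> 1).
Proof.
move=> z _; split.
- by apply/is_derive_exE; exact: is_derive_cst.
- by apply/is_derive_eyE; exact: is_derive_id.
- exact: cvg_snd.
- by move=> ?; exact: cvg_cst.
- by move=> ?; exact: cvg_cst.
Qed.

Lemma C1on_eq U f f1 f2 g g1 g2 : open U -> C1on U f f1 f2 ->
  (forall z, U z -> f z = g z) -> (forall z, U z -> f1 z = g1 z) ->
  (forall z, U z -> f2 z = g2 z) -> C1on U g g1 g2.
Proof.
move=> oU Hf e0 e1 e2 z Uz; have [a1 a2 a3 a4 a5] := Hf z Uz.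
have nU : \forall x \near z, U x by exact: open_nbhs_nbhs.
have E (k l : R * R -> R) : (forall z, U z -> k z = l z) ->
    {for z, continuous k} -> {for z, continuous l}.
  move=> kl ck; rewrite /prop_for /continuous_at -kl //.
  apply: cvg_trans ck; apply: near_eq_cvg.
  by near=> x; apply: kl; near: x.
rewrite -e1 // -e2 //; split.
- apply: (@near_eq_is_derive _ _ _ f) => //; by near=> x; apply: e0; near: x.
- apply: (@near_eq_is_derive _ _ _ f) => //; by near=> x; apply: e0; near: x.
- exact: E a3.
- exact: E a4.
- exact: E a5.
Unshelve. all: by end_near. Qed.

End plane_calculus.

(** * Integrals of derivatives over the plane *)

Section plane_measure.
Context {R : realType}.
Local Notation plane := (measurableTypeR R * measurableTypeR R)%type.
Implicit Types (h u : R * R -> R) (z : R * R) (U : set (R * R)).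

(** Rational rectangles contained in U form a countable cover of it. *)
Lemma open_measurable_plane U : open U -> measurable (U : set plane).
Proof.
move=> oU.
pose B (q : (rat * rat) * (rat * rat)) : set plane :=
  (`]ratr q.1.1, ratr q.1.2[ `*` `]ratr q.2.1, ratr q.2.2[)%classic.
pose I := [set q | B q `<=` U].
have -> : (U : set plane) = \bigcup_(q in I) B q.
  apply/seteqP; split => [[x y] Uxy|z [q Iq]]; last exact: Iq.
  have [[V W] /= [nV nW] VW] : nbhs (x, y) U by exact: open_nbhs_nbhs.
  have [e /= e0 eV] := (nbhs_ballP _ _).1 nV.
  have [d /= d0 dW] := (nbhs_ballP _ _).1 nW.
  have /rat_in_itvoo[q1 q1P] : x - e < x by rewrite ltrBlDr ltrDl.
  have /rat_in_itvoo[q2 q2P] : x < x + e by rewrite ltrDl.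
  have /rat_in_itvoo[q3 q3P] : y - d < y by rewrite ltrBlDr ltrDl.
  have /rat_in_itvoo[q4 q4P] : y < y + d by rewrite ltrDl.
  exists ((q1, q2), (q3, q4)); last first.
    by split; rewrite /= in_itv/= ?(itvP q1P) ?(itvP q2P) ?(itvP q3P) ?(itvP q4P).
  move=> [s t] [/= ]; rewrite !in_itv/= => /andP[s1 s2] /andP[t1 t2].
  apply: VW; split => /=.
    apply: eV; rewrite /ball/= ltr_distlC; apply/andP; split.
      by rewrite (lt_trans _ s1)// (itvP q1P).
    by rewrite (lt_trans s2)// (itvP q2P).
  apply: dW; rewrite /ball/= ltr_distlC; apply/andP; split.
    by rewrite (lt_trans _ t1)// (itvP q3P).
  by rewrite (lt_trans t2)// (itvP q4P).
rewrite bigcup_mkcond; apply: countable_bigcupT_measurable => // q.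
by case: ifPn => // _; apply: measurableX; exact: measurable_itv.
Qed.

Lemma continuous_on_measurable U h : open U ->
  (forall z, U z -> {for z, continuous h}) ->
  measurable_fun (U : set plane) (h : plane -> R).
Proof.
move=> oU ch; apply: (measurability _ (measurable_realfun.RGenOpens.measurableE R)).
move=> _ [_ [a [b ->] <-]].
apply: open_measurable_plane; rewrite openE => z [Uz /= hz].
have nU : \forall x \near z, U x by exact: open_nbhs_nbhs.
have nab : nbhs (h z) (`]a, b[%classic : set R).
  by apply: open_nbhs_nbhs; split => //; exact: interval_open.
have nh : \forall x \near z, `]a, b[%classic (h x) := ch z Uz _ nab.
rewrite /interior; near=> x; split; first by near: x.
by rewrite /=; near: x.
Unshelve. all: by end_near. Qed.

Lemma continuous_measurable_plane h : continuous h ->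
  measurable_fun setT (h : plane -> R).
Proof.
move=> ch; apply: (@continuous_on_measurable setT) => [|z _]; last exact: ch.
exact: openT.
Qed.

Definition supp_in (M : R) h := forall z, (M < `|z.1|) || (M < `|z.2|) -> h z = 0.

Definition box (M : R) : set plane := (`[- M, M] `*` `[- M, M])%classic.

Lemma boxP M z : box M z <-> (`|z.1| <= M /\ `|z.2| <= M).
Proof. by rewrite /box /= !in_itv /= !ler_norml; split. Qed.

Lemma measurable_box M : measurable (box M).
Proof. by apply: measurableX; exact: measurable_itv. Qed.

Lemma compact_box M : compact (box M : set (R * R)).
Proof. by apply: compact_setX; exact: segment_compact. Qed.

Lemma box_lty M : (@lebesgue2 R (box M) < +oo)%E.
Proof.
rewrite /lebesgue2 /= product_measure1E//.
by rewrite /= !lebesgue_measure_itv /=; case: ifP => // _; rewrite -?EFinB ?mule0 -?EFinM ?ltry.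
Qed.

Lemma supp_inP M h z : supp_in M h -> ~ box M z -> h z = 0.
Proof.
move=> hM bz; apply: hM; apply: contra_notT bz.
by rewrite negb_or -!leNgt => /andP[? ?]; apply/boxP.
Qed.

Lemma continuous_bounded_on (K : set (R * R)) h :
  compact K -> {within K, continuous h} ->
  exists M, 0 < M /\ forall z, K z -> `|h z| <= M.
Proof.
move=> cK ch.
have := compact_bounded (continuous_compact ch cK).
move=> [M [Mr /(_ (`|M| + 1)) HM]].
exists (`|M| + 1); split; first by rewrite ltr_wpDl.
move=> z Kz; apply: HM; first by rewrite (le_lt_trans (ler_norm _))// ltrDl.
by exists z.
Qed.

Lemma continuous_box_integrable M h : continuous h ->
  lebesgue2.-integrable (box M) (EFin \o (h : plane -> R)).
Proof.
move=> ch; have mh := continuous_measurable_plane ch.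
have [K [K0 HK]] : exists K : R, 0 < K /\ forall z, box M z -> `|h z| <= K.
  apply: continuous_bounded_on; first exact: compact_box.
  exact: continuous_subspaceT.
apply: measurable_bounded_integrable.
- exact: measurable_box.
- exact: box_lty.
- exact: measurable_funS mh.
- exists K; split; first exact: num_real.
  by move=> L KL z /HK /le_trans; apply; exact: ltW.
Qed.

Lemma supp_integrable M h : supp_in M h -> continuous h ->
  lebesgue2.-integrable setT (EFin \o (h : plane -> R)).
Proof.
move=> hM ch.
have -> : EFin \o (h : plane -> R) = (EFin \o h) \_ (box M).
  apply/funext => z; rewrite patchE; case: ifPn => // /negP bz /=.
  by rewrite (supp_inP hM) // => /mem_set.
exact/(integrable_mkcond _ (measurable_box M))/continuous_box_integrable.
Qed.

Lemma line_integral_derive0 (M : R) (g g' : R -> R) :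
  (forall x : R, is_derive x (1 : R) g (g' x)) -> continuous g' ->
  (forall x, M < `|x| -> g x = 0) -> (forall x, M < `|x| -> g' x = 0) ->
  (\int[lebesgue_measure]_x (g' x)%:E = 0)%E.
Proof.
move=> dg cg' gM g'M.
pose L := `|M| + 1.
have ML : M < L by rewrite (le_lt_trans (ler_norm _))// ltrDl.
have L0 : 0 < L by rewrite ltr_wpDl.
have -> : (fun x => (g' x)%:E) = (EFin \o g') \_ `[- L, L].
  apply/funext => x; rewrite patchE; case: ifPn => //=.
  rewrite notin_setE /= in_itv /= -ler_norml => /negP; rewrite -ltNge => xL.
  by rewrite g'M // (lt_trans ML).
rewrite -integral_mkcond (@continuous_FTC2 _ g' g).
- by rewrite !gM ?subee // ?normrN ger0_norm // ltW.
- by rewrite gtrN.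
- exact: continuous_subspaceT.
- have dgx x : derivable g x 1 by case: (dg x).
  have cg : continuous g.
    by move=> x; apply: differentiable_continuous; apply/derivable1_diffP.
  by split => //; [apply: cvg_at_right_filter|apply: cvg_at_left_filter]; exact: cg.
- by move=> x _; rewrite derive1E; case: (dg x).
Qed.

Lemma supp_in_derive M h h1 (v : R * R) : supp_in M h ->
  (forall z, is_derive z v h (h1 z)) -> supp_in M h1.
Proof.
move=> hM dh z Hz.
have cn : continuous (fun z : R * R => `|z.1|).
  by move=> w; apply: continuous_comp; [exact: cvg_fst|exact: norm_continuous].
have cn2 : continuous (fun z : R * R => `|z.2|).
  by move=> w; apply: continuous_comp; [exact: cvg_snd|exact: norm_continuous].
have nz : \forall w \near z, (M < `|w.1|) || (M < `|w.2|).
  case/orP : Hz => Hz.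
    by apply: filterS (near_gt_at (cn z) Hz) => w /= ->.
  by apply: filterS (near_gt_at (cn2 z) Hz) => w /= ->; rewrite orbT.
have D0 : is_derive z v h 0.
  apply: (near_eq_is_derive _ (is_derive_cst (0 : R) z v)).
  by near=> w; rewrite [RHS]hM //; near: w.
by have [_ <-] := dh z; have [_ ->] := D0.
Unshelve. all: by end_near. Qed.

(** Integrating along lines first, this is the fundamental theorem of calculus. It is the
    only form of the divergence theorem in the proof: boundary terms never occur, since every
    field is cut off before it is integrated. *)
Lemma integral_dx0 M h h1 : supp_in M h ->
  (forall z, is_derive z ex h (h1 z)) -> continuous h1 ->
  (\int[lebesgue2]_z (h1 z)%:E = 0)%E.
Proof.
move=> hM dh ch1; have h1M := supp_in_derive hM dh.
have ih1 := supp_integrable h1M ch1.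
rewrite /lebesgue2 -(integral21_prod_meas1 ih1).
apply: integral0_eq => y _ /=.
apply: (@line_integral_derive0 M (fun x => h (x, y))).
- by move=> x; have /is_derive_exE := dh (x, y).
- move=> x; apply: (@continuous_comp _ _ _ (fun x => (x, y)) h1); last exact: ch1.
  by apply: continuous_at_pair; [exact: cvg_id|exact: cvg_cst].
- by move=> x Mx; rewrite hM //= Mx.
- by move=> x Mx; rewrite h1M //= Mx.
Qed.

Lemma integral_dy0 M h h2 : supp_in M h ->
  (forall z, is_derive z ey h (h2 z)) -> continuous h2 ->
  (\int[lebesgue2]_z (h2 z)%:E = 0)%E.
Proof.
move=> hM dh ch2; have h2M := supp_in_derive hM dh.
have ih2 := supp_integrable h2M ch2.
rewrite /lebesgue2 -(integral12_prod_meas1 ih2).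
apply: integral0_eq => x _ /=.
apply: (@line_integral_derive0 M (fun y => h (x, y))).
- by move=> y; have /is_derive_eyE := dh (x, y).
- move=> y; apply: (@continuous_comp _ _ _ (fun y => (x, y)) h2); last exact: ch2.
  exact: continuous_vertical.
- by move=> y My; rewrite hM //= My orbT.
- by move=> y My; rewrite h2M //= My orbT.
Qed.

End plane_measure.

(** * A truncation of the square *)

Section truncated_square.
Context {R : realType}.
Implicit Types (k t : R) (g : R -> R).

Lemma derive1_lim g t d : is_derive t (1 : R) g d <->
  (fun h : R => h^-1 * (g (t + h) - g t)) @ 0^' --> d.
Proof.
have E : (fun h : R => h^-1 *: ((g \o shift t) (h *: (1 : R)) - g t)) =
         (fun h : R => h^-1 * (g (t + h) - g t)).
  apply/funext => h.
  have -> : h *: (1 : R) = h by exact: mulr1.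
  by rewrite /shift /= [h + t]addrC.
split=> [[dg <-]|dg].
  by move: dg; rewrite /derivable /derive E => /cvg_ex [l dl]; rewrite (cvg_lim _ dl).
apply: DeriveDef; last by rewrite /derive E; exact: cvg_lim.
by rewrite /derivable E; apply/cvg_ex; exists d.
Qed.

Lemma continuous_max_cst k t : {for t, continuous (fun s => Num.max s k)}.
Proof.
have -> : (fun s : R => Num.max s k) = fun s => (s + k + `|s - k|) / 2.
  by apply/funext => s; rewrite maxr_absE.
apply: cvgM; last exact: cvg_cst.
apply: cvgD; first by apply: cvgD => //; exact: cvg_cst.
apply: (@continuous_comp _ _ _ (fun s : R => s - k) Num.norm).
  by apply: cvgB => //; exact: cvg_cst.
exact: norm_continuous.
Qed.

(** Precomposing with the maximum freezes g below k; the junction is smooth because g' vanishes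
    there. *)
Lemma is_derive_max g g' k :
  (forall t, k <= t -> is_derive t (1 : R) g (g' t)) -> g' k = 0 ->
  forall t, is_derive t (1 : R) (fun s => g (Num.max s k)) (g' (Num.max t k)).
Proof.
move=> dg gk t; have [tk|kt|tk] := ltgtP t k.
- have := is_derive_cst (g k) t (1 : R); rewrite gk.
  apply: near_eq_is_derive; near=> s; rewrite max_r //.
  by rewrite ltW //; near: s; apply: (near_lt_at (f := id)).
- have := dg t (ltW kt).
  apply: near_eq_is_derive; near=> s; rewrite max_l //.
  by rewrite ltW //; near: s; apply: (near_gt_at (f := id)).
- subst t; have /derive1_lim := dg k (lexx k); rewrite gk => dk.
  apply/derive1_lim; move/cvgrPdist_le: dk => dk.
  apply/cvgrPdist_le => e e0; have := dk e e0; apply: filterS => h.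
  rewrite maxxx; have [h0|h0] := leP h 0.
    by move=> _; rewrite max_r ?gerDl // subrr mulr0 subr0 normr0 ltW.
  by rewrite max_l // lerDl ltW.
Unshelve. all: by end_near. Qed.

(** (t - k)^3 / (2 t) and its first two derivatives for t >= k. The third power makes all three
    vanish at t = k, hence the extension by zero below k is of class C^2. *)
Definition F0 k t : R := let m := Num.max t k in (m - k) ^+ 3 / (2 * m).
Definition F1 k t : R :=
  let m := Num.max t k in (m - k) ^+ 2 * (2 * m + k) / (2 * m ^+ 2).
Definition F2 k t : R := let m := Num.max t k in 1 - k ^+ 3 / m ^+ 3.

Lemma is_derive_F0 k t : 0 < k -> is_derive t (1 : R) (F0 k) (F1 k t).
Proof.
move=> k0; apply: (@is_derive_max (fun m => (m - k) ^+ 3 / (2 * m))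
  (fun m => (m - k) ^+ 2 * (2 * m + k) / (2 * m ^+ 2))) => [s ks|].
  have s0 : s != 0 by rewrite gt_eqF // (lt_le_trans k0).
  have d0 : is_derive s (1 : R) (fun m : R => m) (1 : R) by exact: is_derive_id.
  have s20 : 2 * s != 0 by rewrite mulf_neq0.
  apply: is_derive_eq.
  rewrite /GRing.scale /=; field; lra.
by rewrite subrr expr0n /= !mul0r.
Qed.

Lemma is_derive_F1 k t : 0 < k -> is_derive t (1 : R) (F1 k) (F2 k t).
Proof.
move=> k0; apply: (@is_derive_max
  (fun m => (m - k) ^+ 2 * (2 * m + k) / (2 * m ^+ 2))
  (fun m => 1 - k ^+ 3 / m ^+ 3)) => [s ks|].
  have s0 : s != 0 by rewrite gt_eqF // (lt_le_trans k0).
  have s20 : 2 * s ^+ 2 != 0 by rewrite mulf_neq0 // expf_neq0.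
  apply: is_derive_eq.
  rewrite /GRing.scale /=; field; lra.
by rewrite divff ?subrr // expf_neq0 // gt_eqF.
Qed.

Lemma continuous_F2 k : 0 < k -> continuous (F2 k).
Proof.
move=> k0 t; have m0 : Num.max t k != 0.
  by rewrite gt_eqF // lt_max k0 orbT.
apply: cvgB; first exact: cvg_cst.
apply: cvgM; first exact: cvg_cst.
apply: (@continuous_comp _ _ _ (fun s => Num.max s k) (fun m => (m ^+ 3)^-1)).
  exact: continuous_max_cst.
apply: cvgV; first by rewrite expf_neq0.
exact: exprn_continuous.
Qed.

Lemma F_below k t : 0 < k -> t <= k -> [/\ F0 k t = 0, F1 k t = 0 & F2 k t = 0].
Proof.
move=> k0 tk; rewrite /F0 /F1 /F2 max_r // !subrr !expr0n /= !mul0r.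
by rewrite divff ?subrr // expf_neq0 // gt_eqF.
Qed.

(** An even function of class C^2 which is zero for |t| <= k and tends to t^2 / 2 as k tends to
    0; trunc1 and trunc2 are its derivatives. *)
Definition trunc0 k t := F0 k t + F0 k (- t).
Definition trunc1 k t := F1 k t - F1 k (- t).
Definition trunc2 k t := F2 k t + F2 k (- t).

Lemma is_derive_trunc0 k t : 0 < k ->
  is_derive t (1 : R) (trunc0 k) (trunc1 k t).
Proof.
move=> k0; have dN : is_derive t (1 : R) (fun s : R => - s) (- 1).
  exact: is_deriveNid.
have d1 := is_derive_F0 t k0; have d2 := is_derive_F0 (- t) k0.
have d3 := is_derive1_comp (f := F0 k) d2 dN.
have := is_deriveD d1 d3; rewrite /trunc1 mulrN1; exact.
Qed.

Lemma is_derive_trunc1 k t : 0 < k ->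
  is_derive t (1 : R) (trunc1 k) (trunc2 k t).
Proof.
move=> k0; have dN : is_derive t (1 : R) (fun s : R => - s) (- 1).
  exact: is_deriveNid.
have d1 := is_derive_F1 t k0; have d2 := is_derive_F1 (- t) k0.
have d3 := is_derive1_comp (f := F1 k) d2 dN.
have := is_deriveB d1 d3; rewrite /trunc2 mulrN1 opprK; exact.
Qed.

Lemma continuous_trunc2 k : 0 < k -> continuous (trunc2 k).
Proof.
move=> k0 t; apply: cvgD; first exact: continuous_F2.
apply: (@continuous_comp _ _ _ (fun s : R => - s) (F2 k)).
  exact: oppr_continuous.
exact: continuous_F2.
Qed.

Lemma truncN k t : [/\ trunc0 k (- t) = trunc0 k t,
  trunc1 k (- t) = - trunc1 k t & trunc2 k (- t) = trunc2 k t].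
Proof. by rewrite /trunc0 /trunc1 /trunc2 opprK; split; lra. Qed.

Lemma trunc_small k t : 0 < k -> `|t| <= k ->
  [/\ trunc0 k t = 0, trunc1 k t = 0 & trunc2 k t = 0].
Proof.
move=> k0; rewrite ler_norml => /andP[t1 t2].
have [a0 a1 a2] := F_below k0 t2.
have [|b0 b1 b2] := @F_below k (- t) k0; first by rewrite lerNl.
by rewrite /trunc0 /trunc1 /trunc2 a0 a1 a2 b0 b1 b2; split; lra.
Qed.

Lemma trunc_large k t : 0 < k -> k <= t ->
  [/\ trunc0 k t = (t - k) ^+ 3 / (2 * t),
      trunc1 k t = (t - k) ^+ 2 * (2 * t + k) / (2 * t ^+ 2) &
      trunc2 k t = 1 - (k / t) ^+ 3].
Proof.
move=> k0 kt.
have [|b0 b1 b2] := @F_below k (- t) k0; first lra.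
rewrite /trunc0 /trunc1 /trunc2 b0 b1 b2 /F0 /F1 /F2 max_l //.
by rewrite expr_div_n; split; lra.
Qed.

(** The inequality F'^2 <= 2 F, which holds for the half square, survives the truncation; the
    energy estimate absorbs F' through it. *)
Lemma trunc_bounds k t : 0 < k ->
  [/\ 0 <= trunc0 k t, 0 <= trunc2 k t <= 1, trunc1 k t ^+ 2 <= 2 * trunc0 k t,
      `|trunc1 k t - t| <= 2 * k & `|trunc0 k t - t ^+ 2 / 2| <= 2 * k * `|t|].
Proof.
move=> k0; wlog t0 : t / 0 <= t.
  move=> H; have [/H //|t0] := leP 0 t.
  have [|h0 h2 h1 h3 h4] := H (- t); first lra.
  have [e0 e1 e2] := truncN k t.
  rewrite e0 e1 e2 sqrrN normrN -opprD normrN in h0 h1 h2 h3 h4.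
  rewrite sqrrN in h4.
  by split.
have [tk|kt] := leP t k.
  have [|e0 e1 e2] := @trunc_small k t k0; first by rewrite ger0_norm.
  rewrite e0 e1 e2; split; rewrite ?sub0r ?normrN; try lra.
    by rewrite ger0_norm //; lra.
  by rewrite ger0_norm ?divr_ge0 ?sqr_ge0 // ger0_norm //; nra.
have t0' : 0 < t by lra.
have tn0 : t != 0 by rewrite gt_eqF.
have [e0 e1 e2] := trunc_large k0 (ltW kt).
set q := k / t.
have kE : k = q * t by rewrite /q; field.
have q0 : 0 < q by rewrite divr_gt0.
have q1 : q < 1 by rewrite ltr_pdivrMr // mul1r.
have E0 : trunc0 k t = t ^+ 2 * ((1 - q) ^+ 3 / 2) by rewrite e0 kE; field.
have E1 : trunc1 k t = t * ((1 - q) ^+ 2 * (2 + q) / 2) by rewrite e1 kE; field.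
have q3 : 0 <= q ^+ 3 by rewrite exprn_ge0 // ltW.
have q2q : q ^+ 2 <= q by rewrite expr2 ger_pMr // ltW.
have q3q : q ^+ 3 <= q by rewrite exprS ger_pMr //; lra.
have q2 := sqr_ge0 q.
have p0 : 0 <= 1 - q by lra.
split.
- by rewrite E0 mulr_ge0 ?sqr_ge0 // divr_ge0 // exprn_ge0 //; lra.
- by rewrite e2 -/q; apply/andP; split; lra.
- rewrite E0 E1.
  have -> : (t * ((1 - q) ^+ 2 * (2 + q) / 2)) ^+ 2 =
     t ^+ 2 * (1 - q) ^+ 3 * (((1 - q) * (2 + q) ^+ 2) / 4) by field.
  have -> : 2 * (t ^+ 2 * ((1 - q) ^+ 3 / 2)) = t ^+ 2 * (1 - q) ^+ 3 * 1 by field.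
  rewrite ler_wpM2l ?mulr_ge0 ?sqr_ge0 ?exprn_ge0 //.
  have -> : (1 - q) * (2 + q) ^+ 2 = 4 - 3 * q ^+ 2 - q ^+ 3 by ring.
  lra.
- rewrite E1 kE.
  have -> : t * ((1 - q) ^+ 2 * (2 + q) / 2) - t = t * (q ^+ 3 / 2 - 3 / 2 * q).
    by field.
  rewrite normrM (ger0_norm (ltW t0')) (_ : 2 * (q * t) = t * (2 * q)); last by ring.
  rewrite ler_wpM2l ?(ltW t0') // ler_norml; apply/andP; split; lra.
- rewrite E0 (ger0_norm (ltW t0')) kE.
  have -> : t ^+ 2 * ((1 - q) ^+ 3 / 2) - t ^+ 2 / 2 =
     t ^+ 2 * ((- 3 * q + 3 * q ^+ 2 - q ^+ 3) / 2) by field.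
  rewrite normrM ger0_norm ?sqr_ge0 //.
  rewrite (_ : 2 * (q * t) * t = t ^+ 2 * (2 * q)); last by ring.
  rewrite ler_wpM2l ?sqr_ge0 // ler_norml; apply/andP; split; lra.
Qed.

End truncated_square.

(** * The energy inequality for truncated functions *)

Section energy.
Context {R : realType}.
Local Notation plane := (measurableTypeR R * measurableTypeR R)%type.
Implicit Types (h w r : R * R -> R) (z : R * R) (U : set (R * R)).

(** Where |w| < k the product is zero. Since w is continuous and vanishes off U, this includes a
    neighbourhood of every point outside U, so nothing has to be known about the derivatives of
    w and h near the boundary of U. *)
Lemma C1onT_cut U w w1 w2 h h1 h2 (g g' : R -> R) (k : R) : 0 < k -> open U ->
  continuous w -> (forall z, ~ U z -> w z = 0) ->
  C1on U w w1 w2 -> C1on U h h1 h2 ->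
  (forall t, is_derive t (1 : R) g (g' t)) -> continuous g' ->
  (forall t, `|t| <= k -> g t = 0 /\ g' t = 0) ->
  C1on setT (fun z => g (w z) * h z)
    (fun z => g' (w z) * w1 z * h z + g (w z) * h1 z)
    (fun z => g' (w z) * w2 z * h z + g (w z) * h2 z).
Proof.
move=> k0 oU cw wU Cw Ch dg cg gk z _.
have [Uz|nUz] := pselect (U z).
  have Cg := C1on_comp Cw (fun z _ => conj (dg (w z)) (cg (w z))).
  exact: C1on_M Cg Ch z Uz.
pose Q := [set z | `|w z| < k].
have cnw : continuous (fun z => `|w z|).
  by move=> x; apply: continuous_comp; [exact: cw|exact: norm_continuous].
have oQ : open Q.
  by rewrite openE => x Qx; exact: near_lt_at (cnw x) Qx.
have Qz : Q z by rewrite /Q /= (wU _ nUz) normr0.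
suff C0 : C1on Q (fun z => g (w z) * h z)
    (fun z => g' (w z) * w1 z * h z + g (w z) * h1 z)
    (fun z => g' (w z) * w2 z * h z + g (w z) * h2 z) by exact: C0.
by apply: (C1on_eq oQ (@C1on_cst R Q 0)) => x /ltW /gk [e1 e2];
  rewrite e1 ?e2 !mul0r // addr0.
Qed.

Lemma continuousT_cut U w h (g : R -> R) (k : R) : 0 < k -> open U ->
  continuous w -> (forall z, ~ U z -> w z = 0) ->
  (forall z, U z -> {for z, continuous h}) -> continuous g ->
  (forall t, `|t| <= k -> g t = 0) -> continuous (fun z => g (w z) * h z).
Proof.
move=> k0 oU cw wU ch cg gk z.
have [Uz|nUz] := pselect (U z).
  by apply: cvgM; [apply: continuous_comp; [exact: cw|exact: cg]|exact: ch].
have cnw : {for z, continuous (fun z => `|w z|)}.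
  by apply: continuous_comp; [exact: cw|exact: norm_continuous].
apply: (@near_eq_continuous_at _ _ (fun=> 0)); last by move=> ?; exact: cvg_cst.
have wz : `|w z| < k by rewrite (wU _ nUz) normr0.
by apply: filterS (near_lt_at cnw wz) => x /ltW /gk ->; rewrite mul0r.
Qed.

(** Young's inequality. The terms F and eps F'' |grad w|^2 are paired with F'^2 <= 2 F and
    0 <= F'' <= 1; for eps <= 1/8 half of them is left over. *)
Lemma energy_pointwise (F0 F1 F2 w1 w2 b1 b2 G eps r : R) :
  0 < eps -> eps <= 8^-1 -> 0 <= F0 -> 0 <= F2 <= 1 -> F1 ^+ 2 <= 2 * F0 ->
  2 * G ^+ 2 + eps * (b1 ^+ 2 + b2 ^+ 2) <= r ->
  (F0 + eps * (F2 * (w1 ^+ 2 + w2 ^+ 2))) / 2 <=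
  F2 * (w1 * (eps * (w1 + b1)) + w2 * (eps * (w2 + b2)))
   + F1 * (- w2 - G + eps * (w2 + b2)) + (1 - eps) * (F1 * w2 + F0) + r.
Proof.
move=> e0 e8 F00 /andP[F20 F21] F1F0 Hr; rewrite -subr_ge0.
have -> : F2 * (w1 * (eps * (w1 + b1)) + w2 * (eps * (w2 + b2)))
   + F1 * (- w2 - G + eps * (w2 + b2)) + (1 - eps) * (F1 * w2 + F0) + r
   - (F0 + eps * (F2 * (w1 ^+ 2 + w2 ^+ 2))) / 2 =
   eps * F2 * ((w1 + b1) ^+ 2 + (w2 + b2) ^+ 2) / 2
   + eps * (1 - F2) * (b1 ^+ 2 + b2 ^+ 2) / 2
   + 2 * (F1 / 4 - G) ^+ 2 + (2 * F0 - F1 ^+ 2) / 8 + eps * (F1 + b2) ^+ 2 / 2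
   + (r - (2 * G ^+ 2 + eps * (b1 ^+ 2 + b2 ^+ 2)))
   + eps * b1 ^+ 2 / 2
   + eps * (2 * F0 - F1 ^+ 2) / 2 + (4^-1 - 2 * eps) * F0 by field.
have s1 := sqr_ge0 (w1 + b1); have s2 := sqr_ge0 (w2 + b2).
have s3 := sqr_ge0 b1; have s4 := sqr_ge0 b2.
have s5 := sqr_ge0 (F1 + b2); have s6 := sqr_ge0 (F1 / 4 - G).
have F1' : 0 <= 1 - F2 by lra.
have e0' := ltW e0.
have d0 : 0 <= 2 * F0 - F1 ^+ 2 by lra.
have e48 : 0 <= 4^-1 - 2 * eps by lra.
have p1 : 0 <= eps * F2 * ((w1 + b1) ^+ 2 + (w2 + b2) ^+ 2).
  by rewrite !mulr_ge0 // addr_ge0.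
have p2 : 0 <= eps * (1 - F2) * (b1 ^+ 2 + b2 ^+ 2).
  by rewrite !mulr_ge0 // addr_ge0.
have p3 : 0 <= eps * (F1 + b2) ^+ 2 by rewrite mulr_ge0.
have p4 : 0 <= eps * b1 ^+ 2 by rewrite mulr_ge0.
have p5 : 0 <= eps * (2 * F0 - F1 ^+ 2) by rewrite mulr_ge0.
have p6 : 0 <= (4^-1 - 2 * eps) * F0 by rewrite mulr_ge0.
lra.
Qed.

Lemma C1onT_integral M h h1 h2 : C1on setT h h1 h2 -> supp_in M h ->
  [/\ lebesgue2.-integrable setT (EFin \o (h1 : plane -> R)),
      (\int[lebesgue2]_z (h1 z)%:E = 0)%E,
      lebesgue2.-integrable setT (EFin \o (h2 : plane -> R)) &
      (\int[lebesgue2]_z (h2 z)%:E = 0)%E].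
Proof.
move=> Ch hM.
have d1 z : is_derive z ex h (h1 z) by have [] := Ch z I.
have d2 z : is_derive z ey h (h2 z) by have [] := Ch z I.
have c1 : continuous h1 by move=> z; have [] := Ch z I.
have c2 : continuous h2 by move=> z; have [] := Ch z I.
split.
- exact: supp_integrable (supp_in_derive hM d1) c1.
- exact: integral_dx0 hM d1 c1.
- exact: supp_integrable (supp_in_derive hM d2) c2.
- exact: integral_dy0 hM d2 c2.
Qed.

Lemma integral_lin (D : set plane) (f g : R * R -> R) (c : R) : measurable D ->
  lebesgue2.-integrable D (EFin \o (f : plane -> R)) ->
  lebesgue2.-integrable D (EFin \o (g : plane -> R)) ->
  lebesgue2.-integrable D (EFin \o ((fun z => f z + c * g z) : plane -> R)) /\
  (\int[lebesgue2]_(z in D) (f z + c * g z)%:E =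
   \int[lebesgue2]_(z in D) (f z)%:E + c%:E * \int[lebesgue2]_(z in D) (g z)%:E)%E.
Proof.
move=> mD intf intg.
have icg := integrableZl mD c intg.
have H : EFin \o ((fun z => f z + c * g z) : plane -> R) =
  (EFin \o (f : plane -> R)) \+ (fun z => c%:E * (EFin \o (g : plane -> R)) z)%E.
  by apply/funext => z; rewrite /= EFinD EFinM.
split; first by rewrite H; exact: integrableD.
rewrite -(integralZl mD intg) -(integralD mD intf icg).
by [].
Qed.

(** The integrals of div (exp(y) F'(w) m) and of (1 - eps) d/dy (exp(y) F(w)) are zero, and the
    pointwise inequality bounds their sum from below. The y-derivative of the weight supplies the
    term F, that is the L^2 norm, without loss of a power of eps. *)
Lemma truncated_energy U (M eps k : R) w w1 w2 m1 m1x m1y m2 m2x m2y b1 b2 G r :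
  open U -> supp_in M w -> (forall z, ~ U z -> w z = 0) -> continuous w ->
  C1on U w w1 w2 -> C1on U m1 m1x m1y -> C1on U m2 m2x m2y ->
  0 < eps -> eps <= 8^-1 -> 0 < k ->
  (forall z, U z -> m1x z + m2y z = - w2 z - G z) ->
  (forall z, U z -> m1 z = eps * (w1 z + b1 z)) ->
  (forall z, U z -> m2 z = eps * (w2 z + b2 z)) ->
  (forall z, U z -> 2 * G z ^+ 2 + eps * (b1 z ^+ 2 + b2 z ^+ 2) <= r z) ->
  (forall z, 0 <= r z) -> lebesgue2.-integrable (box M) (EFin \o (r : plane -> R)) ->
  let P z := trunc0 k (w z) +
       eps * (trunc2 k (w z) * (w1 z ^+ 2 + w2 z ^+ 2)) in
  lebesgue2.-integrable setT (EFin \o (P : plane -> R)) /\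
  (\int[lebesgue2]_z (P z)%:E
   <= (2 * expR M ^+ 2)%:E * \int[lebesgue2]_(z in box M) (r z)%:E)%E.
Proof.
move=> oU wM wU cw Cw Cm1 Cm2 e0 e8 k0 Hdiv Hm1 Hm2 Hr r0 ir P.
have Cexp V : C1on V (fun z : R * R => expR z.2) (fun z => expR z.2 * 0)
    (fun z => expR z.2 * 1).
  apply: C1on_comp; first exact: C1on_snd.
  by move=> z _; split; [exact: is_derive_expR|exact: continuous_expR].
have small1 t : `|t| <= k -> trunc1 k t = 0 /\ trunc2 k t = 0.
  by move=> /(trunc_small k0) [].
have small0 t : `|t| <= k -> trunc0 k t = 0 /\ trunc1 k t = 0.
  by move=> /(trunc_small k0) [].
have d1 t : is_derive t (1 : R) (trunc1 k) (trunc2 k t) by exact: is_derive_trunc1.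
have d0 t : is_derive t (1 : R) (trunc0 k) (trunc1 k t) by exact: is_derive_trunc0.
have c2 := continuous_trunc2 k0.
have c1 : continuous (trunc1 k).
  by move=> t; apply: differentiable_continuous; apply/derivable1_diffP; case: (d1 t).
(* the two components of exp(y) F'(w) m, and exp(y) F(w) *)
have CZ1 := C1onT_cut k0 oU cw wU Cw (C1on_M (Cexp U) Cm1) d1 c2 small1.
have CZ2 := C1onT_cut k0 oU cw wU Cw (C1on_M (Cexp U) Cm2) d1 c2 small1.
have CY := C1onT_cut k0 oU cw wU Cw (Cexp U) d0 c1 small0.
have suppw (g : R -> R) h : g 0 = 0 -> supp_in M (fun z => g (w z) * h z).
  by move=> g0 z /wM ->; rewrite g0 mul0r.
have k00 : `|0 : R| <= k by rewrite normr0 ltW.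
have [t00 t10] := small0 0 k00; have [_ t20] := small1 0 k00.
have sZ1 := suppw (trunc1 k) (fun z => expR z.2 * m1 z) t10.
have sZ2 := suppw (trunc1 k) (fun z => expR z.2 * m2 z) t10.
have sY := suppw (trunc0 k) (fun z => expR z.2) t00.
have [iZ1 IZ1 _ _] := C1onT_integral CZ1 sZ1.
have [_ _ iZ2 IZ2] := C1onT_integral CZ2 sZ2.
have [_ _ iY IY] := C1onT_integral CY sY.
set Z1x := (fun z => _) in iZ1.
set Z2y := (fun z => _) in iZ2.
set Yy := (fun z => _) in iY.
pose T z := Z1x z + 1 * Z2y z + (1 - eps) * Yy z.
have P0 z : 0 <= P z.
  have [p0 /andP[p2 _] _ _ _] := trunc_bounds (w z) k0.
  by rewrite addr_ge0 // !mulr_ge0 ?(ltW e0) // addr_ge0 ?sqr_ge0.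
have [iZ IZ] := integral_lin 1 measurableT iZ1 iZ2.
have [iT IT] := integral_lin (1 - eps) measurableT iZ iY.
rewrite {}IZ IZ1 IZ2 IY !mule0 !adde0 in IT.
pose r' := (r : plane -> R) \_ (box M).
have r'E : (EFin \o (r : plane -> R)) \_ (box M) = EFin \o r'.
  by apply/funext => z; rewrite /r' /= !patchE; case: ifP.
have ir' : lebesgue2.-integrable setT (EFin \o r').
  by rewrite -r'E; move/(integrable_mkcond _ (measurable_box M)) : ir.
have [iTr ITr] := integral_lin (expR M) measurableT iT ir'.
rewrite {}IT add0e -[X in (_ * X)%E]/(\int[lebesgue2]_z (EFin \o r') z)%E in ITr.
rewrite -r'E -integral_mkcond in ITr.
have cP : continuous P.
  move=> z; apply: cvgD.
    apply: continuous_comp; first exact: cw.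
    by apply: differentiable_continuous; apply/derivable1_diffP; case: (d0 (w z)).
  apply: cvgM; first exact: cvg_cst.
  apply: (@continuousT_cut U w (fun z => w1 z ^+ 2 + w2 z ^+ 2) (trunc2 k) k) => //.
    move=> x Ux; have [_ _ _ a1 a2] := Cw x Ux.
    by apply: cvgD; apply: cvgM.
  by move=> t /small1 [].
have mP : measurable_fun setT (P : plane -> R).
  exact: continuous_measurable_plane.
have c0 : 0 < 2 * expR M by rewrite mulr_gt0 // expR_gt0.
(* on the support of w the weight lies between exp(- M) and exp(M) *)
have PT z : (2 * expR M)^-1 * P z <= T z + expR M * r' z.
  have r'0 : 0 <= expR M * r' z.
    by rewrite mulr_ge0 ?expR_ge0 // /r' patchE; case: ifP.
  have [wk|kw] := leP `|w z| k.
    have [a0 a1 a2] := trunc_small k0 wk.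
    rewrite /P /T /Z1x /Z2y /Yy a0 a1 a2; lra.
  have wz : w z != 0 by rewrite -normr_gt0 (lt_trans k0).
  have Uz : U z by apply: contrapT => /wU /eqP; rewrite (negbTE wz).
  have Bz : box M z.
    by apply: contrapT => /(supp_inP wM) /eqP; rewrite (negbTE wz).
  have [p0 p2 p1 _ _] := trunc_bounds (w z) k0.
  have := energy_pointwise (w1 z) (w2 z) e0 e8 p0 p2 p1 (Hr z Uz).
  rewrite -Hm1 // -Hm2 // => HP.
  have [_] := (boxP M z).1 Bz; rewrite ler_norml => /andP[y1 y2].
  have rE : r' z = r z by rewrite /r' patchE mem_set.
  have m1xE : m1x z = - w2 z - G z - m2y z by rewrite -Hdiv //; ring.
  have TE : T z = expR z.2 *
     (trunc2 k (w z) * (w1 z * m1 z + w2 z * m2 z)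
      + trunc1 k (w z) * (- w2 z - G z + m2 z)
      + (1 - eps) * (trunc1 k (w z) * w2 z + trunc0 k (w z))).
    by rewrite /T /Z1x /Z2y /Yy m1xE; ring.
  have ePr : expR z.2 * (P z / 2) <= T z + expR z.2 * r z.
    by rewrite TE -mulrDr ler_wpM2l // expR_ge0.
  have eM : expR z.2 * r z <= expR M * r z by rewrite ler_wpM2r // ler_expR.
  rewrite rE; apply: le_trans (le_trans ePr _); last by rewrite lerD2l.
  have -> : (2 * expR M)^-1 * P z = expR (- M) * (P z / 2).
    by rewrite expRN invfM; ring.
  by rewrite ler_wpM2r ?divr_ge0 ?P0 // ler_expR.
have iP : lebesgue2.-integrable setT (EFin \o (P : plane -> R)).
  apply: (@supp_integrable _ M) => // z /wM wz.
  by rewrite /P wz t00 t20 !(mul0r, mulr0, addr0).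
split=> //.
have icP := integrableZl measurableT (2 * expR M)^-1 iP.
have : (\int[lebesgue2]_z ((2 * expR M)^-1%:E * (P z)%:E) <=
    (expR M)%:E * \int[lebesgue2]_(z in box M) (r z)%:E)%E.
  rewrite -ITr; apply: le_integral => // z _.
  by rewrite -EFinM lee_fin.
rewrite ge0_integralZl_EFin ?invr_ge0 ?(ltW c0) //; last 2 first.
  by move=> z _; rewrite lee_fin.
  exact: measurable_int iP.
move=> H; have := lee_wpmul2l (ltW c0 : (0 <= (2 * expR M)%:E)%E) H.
rewrite muleA -EFinM mulfV ?gt_eqF // mul1e muleA -EFinM.
by rewrite (_ : 2 * expR M * expR M = 2 * expR M ^+ 2) //; ring.
Qed.

End energy.

(** * Removing the truncation *)

Section limit.
Context {R : realType}.
Local Notation plane := (measurableTypeR R * measurableTypeR R)%type.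
Implicit Types (h w r : R * R -> R) (z : R * R) (U : set (R * R)).

Lemma fatou_bound d (T : measurableType d) (mu : {measure set T -> \bar R})
    (D : set T) (h : nat -> T -> R) (g : T -> R) (C : \bar R) :
  measurable D -> (forall n, measurable_fun D (h n)) ->
  (forall n (z : T), D z -> 0 <= h n z) ->
  (forall z : T, D z -> h ^~ z @ \oo --> g z) ->
  (forall n, (\int[mu]_(z in D) (h n z)%:E <= C)%E) ->
  (\int[mu]_(z in D) (g z)%:E <= C)%E.
Proof.
move=> mD mh h0 hg hC.
have -> : (\int[mu]_(z in D) (g z)%:E =
    \int[mu]_(z in D) limn_einf (fun n => (h n z)%:E))%E.
  apply: eq_integral => z /set_mem Dz.
  have /cvg_limn_einf_sup[-> _ //] : (fun n => (h n z)%:E) @ \oo --> (g z)%:E.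
  by apply: cvg_EFin; [exact: nearW|exact: hg].
apply: le_trans (fatou mu mD _ _) _.
- by move=> n; exact/measurable_EFinP.
- by move=> n z Dz; rewrite lee_fin h0.
- rewrite limn_einf_lim; apply: lime_le; first exact: is_cvg_einfs.
  by apply: nearW => n; apply: le_trans (hC n); apply: ereal_inf_lbound; exists n => /=.
Qed.

Lemma cvg_harmonic_bound (u : nat -> R) (l C : R) :
  (forall n, `|u n - l| <= C * n.+1%:R^-1) -> u @ \oo --> l.
Proof.
move=> Hu; apply/cvgrPdist_le => e e0.
have [C0|C0] := leP C 0.
  apply: nearW => n; rewrite distrC (le_trans (Hu n)) // (le_trans _ (ltW e0)) //.
  by rewrite mulr_le0_ge0 // invr_ge0.
have eC : 0 < e / C by rewrite divr_gt0.
near=> n; rewrite distrC (le_trans (Hu n)) // -ler_pdivlMl // mulrC ltW //.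
by near: n; exact: (near_infty_natSinv_lt (PosNum eC)).
Unshelve. all: by end_near. Qed.

Lemma trunc2_near1 (k t : R) : 0 < k -> t != 0 :> R -> `|trunc2 k t - 1| <= k / `|t|.
Proof.
move=> k0; wlog t0 : t / 0 < t.
  move=> H tn0; have [/H /(_ tn0) //|t0] := ltP 0 t.
  have [_ _ <-] := truncN k t; rewrite -[`|t|]normrN; apply: H.
    by rewrite oppr_gt0 lt_neqAle tn0.
  by rewrite oppr_eq0.
move=> _; rewrite (gtr0_norm t0).
have [tk|kt] := leP t k.
  have [|_ _ ->] := @trunc_small _ k t k0; first by rewrite gtr0_norm.
  by rewrite sub0r normrN normr1 ler_pdivlMr // mul1r.
have [_ _ ->] := trunc_large k0 (ltW kt).
have q0 : 0 <= k / t by rewrite divr_ge0 // ltW.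
have q1 : k / t <= 1 by rewrite ler_pdivrMr // mul1r ltW.
rewrite addrC addKr normrN ger0_norm ?exprn_ge0 //.
rewrite -[leRHS]expr1; exact: ler_wiXn2l.
Qed.

(** The limit of the derivatives of the truncations of w when h is a derivative of w. Being zero
    where w is zero, it is a weak derivative of w even though h may behave badly near the
    boundary. *)
Definition supp_grad w h := fun z => if w z == 0 then 0 else h z : R.

Lemma cvg_trunc0 (t : R) : (fun n => trunc0 n.+1%:R^-1 t) @ \oo --> (t ^+ 2 / 2 : R).
Proof.
apply: (@cvg_harmonic_bound _ _ (2 * `|t|)) => n.
have n0 : 0 < n.+1%:R^-1 :> R by rewrite invr_gt0.
by have [_ _ _ _] := trunc_bounds t n0; rewrite [in leRHS]mulrAC.
Qed.

Lemma cvg_trunc1 (t : R) : (fun n => trunc1 n.+1%:R^-1 t) @ \oo --> t.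
Proof.
apply: (@cvg_harmonic_bound _ _ 2) => n.
have n0 : 0 < n.+1%:R^-1 :> R by rewrite invr_gt0.
by have [] := trunc_bounds t n0.
Qed.

Lemma cvg_trunc2 w h z :
  (fun n => trunc2 n.+1%:R^-1 (w z) * h z) @ \oo --> supp_grad w h z.
Proof.
rewrite /supp_grad; case: eqP => [w0|/eqP w0].
  apply: (@cvg_harmonic_bound _ _ 0) => n; rewrite w0 mul0r.
  have n0 : 0 < n.+1%:R^-1 :> R by rewrite invr_gt0.
  have [|_ _ ->] := @trunc_small _ n.+1%:R^-1 0 n0; first by rewrite normr0 ltW.
  by rewrite mul0r subrr normr0.
apply: (@cvg_harmonic_bound _ _ (`|h z| / `|w z|)) => n.
have n0 : 0 < n.+1%:R^-1 :> R by rewrite invr_gt0.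
have := trunc2_near1 n0 w0.
rewrite (_ : trunc2 _ _ * _ - _ = h z * (trunc2 n.+1%:R^-1 (w z) - 1)); last by ring.
rewrite normrM (mulrAC `|h z|) -(mulrA `|h z|); exact: ler_wpM2l.
Qed.

Lemma measurable_supp_grad U w h : open U -> continuous w ->
  (forall z, U z -> {for z, continuous h}) ->
  measurable_fun (U : set plane) (supp_grad w h : plane -> R).
Proof.
move=> oU cw ch.
apply: (@measurable_fun_cvg _ _ _ _ (fun n z => trunc2 n.+1%:R^-1 (w z) * h z)).
- move=> n; apply: continuous_on_measurable => // z Uz.
  apply: cvgM; last exact: ch.
  apply: continuous_comp; first exact: cw.
  by apply: continuous_trunc2; rewrite invr_gt0.
- by move=> z _; exact: cvg_trunc2.
Qed.

(** Fatou's lemma applied to the truncated inequality along the levels 1 / (n + 1). *)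
Lemma energy_estimate U (M eps : R) w w1 w2 m1 m1x m1y m2 m2x m2y b1 b2 G r :
  open U -> supp_in M w -> (forall z, ~ U z -> w z = 0) -> continuous w ->
  C1on U w w1 w2 -> C1on U m1 m1x m1y -> C1on U m2 m2x m2y ->
  0 < eps -> eps <= 8^-1 ->
  (forall z, U z -> m1x z + m2y z = - w2 z - G z) ->
  (forall z, U z -> m1 z = eps * (w1 z + b1 z)) ->
  (forall z, U z -> m2 z = eps * (w2 z + b2 z)) ->
  (forall z, U z -> 2 * G z ^+ 2 + eps * (b1 z ^+ 2 + b2 z ^+ 2) <= r z) ->
  (forall z, 0 <= r z) -> lebesgue2.-integrable (box M) (EFin \o (r : plane -> R)) ->
  (\int[lebesgue2]_(z in U) (w z ^+ 2 / 2 +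
       eps * (supp_grad w w1 z ^+ 2 + supp_grad w w2 z ^+ 2))%:E
   <= (2 * expR M ^+ 2)%:E * \int[lebesgue2]_(z in box M) (r z)%:E)%E.
Proof.
move=> oU wM wU cw Cw Cm1 Cm2 e0 e8 Hdiv Hm1 Hm2 Hr r0 ir.
pose h n z := trunc0 n.+1%:R^-1 (w z) +
  eps * (trunc2 n.+1%:R^-1 (w z) * (w1 z ^+ 2 + w2 z ^+ 2)).
have mU : measurable (U : set plane) by exact: open_measurable_plane.
have n0 n : 0 < n.+1%:R^-1 :> R by rewrite invr_gt0.
have h0 n z : 0 <= h n z.
  have [p0 /andP[p2 _] _ _ _] := trunc_bounds (w z) (n0 n).
  by rewrite addr_ge0 // !mulr_ge0 ?(ltW e0) // addr_ge0 ?sqr_ge0.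
have mh n : measurable_fun (U : set plane) (h n).
  apply: continuous_on_measurable => // z Uz; have [_ _ _ a1 a2] := Cw z Uz.
  apply: cvgD.
    apply: continuous_comp; first exact: cw.
    apply: differentiable_continuous; apply/derivable1_diffP.
    by case: (is_derive_trunc0 (w z) (n0 n)).
  apply: cvgM; first exact: cvg_cst.
  apply: cvgM; last by apply: cvgD; apply: cvgM.
  by apply: continuous_comp; [exact: cw|exact: continuous_trunc2].
apply: (@fatou_bound _ plane lebesgue2 U h) => //.
- move=> z Uz; rewrite /h.
  rewrite (_ : w z ^+ 2 / 2 + eps * (supp_grad w w1 z ^+ 2 + supp_grad w w2 z ^+ 2) =
    w z ^+ 2 / 2 + eps * (supp_grad w (fun z => w1 z ^+ 2 + w2 z ^+ 2) z)); last first.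
    by rewrite /supp_grad; case: ifP => // _; rewrite expr0n /= addr0.
  apply: cvgD; first exact: cvg_trunc0.
  apply: cvgM; first exact: cvg_cst.
  exact: (@cvg_trunc2 w (fun z => w1 z ^+ 2 + w2 z ^+ 2) z).
- move=> n.
  have [iP HP] := truncated_energy oU wM wU cw Cw Cm1 Cm2 e0 e8 (n0 n)
    Hdiv Hm1 Hm2 Hr r0 ir.
  apply: le_trans HP; apply: ge0_subset_integral => //.
    exact: measurable_int iP.
  by move=> z _; rewrite lee_fin h0.
Qed.

(** Dominated convergence: phi and its derivative are supported in a compact part of U, on which
    w' is continuous. *)
Lemma weak_derivative_cut U (M : R) w w' phi phi' (v : R * R) :
  open U -> U `<=` (box M : set (R * R)) -> continuous w ->
  (forall z, ~ U z -> w z = 0) ->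
  (forall z, U z -> {for z, continuous w'}) ->
  (forall z, is_derive z v phi (phi' z)) ->
  continuous phi -> continuous phi' ->
  (exists K, [/\ compact K, K `<=` U & forall z, ~ K z -> phi z = 0]) ->
  (forall k, 0 < k -> (\int[lebesgue2]_z (trunc2 k (w z) * w' z * phi z +
     trunc1 k (w z) * phi' z)%:E = 0)%E) ->
  \int[lebesgue2]_(z in U) (w z * phi' z) =
    - \int[lebesgue2]_(z in U) (supp_grad w w' z * phi z).
Proof.
move=> oU UM cw wU cw' dphi cphi cphi' [K [cK KU phiK]] HI.
have mU : measurable (U : set plane) by exact: open_measurable_plane.
have clK : closed K by apply: compact_closed => //; exact: Rhausdorff.
have oK : open (~` K) by exact: closed_openC.
have phi'K z : ~ K z -> phi' z = 0.
  move=> nKz; have D0 : is_derive z v phi 0.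
    apply: (near_eq_is_derive _ (is_derive_cst (0 : R) z v)).
    have : \forall x \near z, (~` K) x by exact: open_nbhs_nbhs.
    by apply: filterS => x /phiK ->.
  by have [_ <-] := dphi z; have [_ ->] := D0.
have nUK z : ~ U z -> ~ K z by move=> nUz /KU.
have out z : (M < `|z.1|) || (M < `|z.2|) -> ~ U z.
  move=> Hz /UM /boxP [b1 b2]; case/orP : Hz; rewrite ltNge ?b1 ?b2 //.
pose H z := w' z * phi z.
have cH : continuous H.
  move=> z; have [Uz|nUz] := pselect (U z).
    by apply: cvgM; [exact: cw'|exact: cphi].
  apply: (@near_eq_continuous_at _ _ (fun=> 0)); last by move=> ?; exact: cvg_cst.
  have : \forall x \near z, (~` K) x by apply: open_nbhs_nbhs; split => //; exact: nUK.
  by apply: filterS => x /phiK; rewrite /H => ->; rewrite mulr0.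
pose wp z := w z * phi' z.
have cwp : continuous wp by move=> z; apply: cvgM; [exact: cw|exact: cphi'].
have swp : supp_in M wp by move=> z /out/nUK/phi'K; rewrite /wp => ->; rewrite mulr0.
have iwp := supp_integrable swp cwp.
pose G z := `|H z| + (`|w z| + 2) * `|phi' z|.
have cG : continuous G.
  move=> z; apply: cvgD.
    by apply: continuous_comp; [exact: cH|exact: norm_continuous].
  apply: cvgM.
    apply: cvgD; last exact: cvg_cst.
    by apply: continuous_comp; [exact: cw|exact: norm_continuous].
  by apply: continuous_comp; [exact: cphi'|exact: norm_continuous].
have sG : supp_in M G.
  move=> z /out/nUK nK; rewrite /G /H phiK // phi'K //.
  by rewrite !mulr0 !normr0 mulr0 addr0.
have iG := supp_integrable sG cG.
have n0 n : 0 < n.+1%:R^-1 :> R by rewrite invr_gt0.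
pose fn n z := trunc2 n.+1%:R^-1 (w z) * w' z * phi z + trunc1 n.+1%:R^-1 (w z) * phi' z.
pose f z := supp_grad w w' z * phi z + w z * phi' z.
have fnE n z : fn n z = trunc2 n.+1%:R^-1 (w z) * H z + trunc1 n.+1%:R^-1 (w z) * phi' z.
  by rewrite /fn /H mulrA.
have ct2 n : continuous (trunc2 n.+1%:R^-1 : R -> R) by apply: continuous_trunc2.
have ct1 n : continuous (trunc1 n.+1%:R^-1 : R -> R).
  move=> t; apply: differentiable_continuous; apply/derivable1_diffP.
  by case: (is_derive_trunc1 t (n0 n)).
have mfnR n : measurable_fun setT (fn n : plane -> R).
  apply: continuous_measurable_plane.
  rewrite (_ : fn n = fun z => trunc2 n.+1%:R^-1 (w z) * H z + trunc1 n.+1%:R^-1 (w z) * phi' z); last exact/funext.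
  move=> z; apply: cvgD; apply: cvgM.
  - by apply: continuous_comp; [exact: cw|exact: ct2].
  - exact: cH.
  - by apply: continuous_comp; [exact: cw|exact: ct1].
  - exact: cphi'.
have mfn n : measurable_fun setT (EFin \o (fn n : plane -> R)).
  by apply/measurable_EFinP; exact: mfnR.
have fnf z : fn ^~ z @ \oo --> f z.
  apply: cvgD; apply: cvgM.
  - exact: cvg_trunc2.
  - exact: cvg_cst.
  - exact: cvg_trunc1.
  - exact: cvg_cst.
have mf : measurable_fun setT (EFin \o (f : plane -> R)).
  apply/measurable_EFinP; apply: (@measurable_fun_cvg _ _ _ _ fn) => [n|z _]; last exact: fnf.
  exact: mfnR.
have fnG n z : `|fn n z| <= G z.
  have [_ /andP[q0 q1] _ t1 _] := trunc_bounds (w z) (n0 n).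
  rewrite fnE (le_trans (ler_normD _ _)) // lerD // normrM.
    by rewrite (ger0_norm q0) -[leRHS]mul1r ler_wpM2r.
  rewrite ler_wpM2r // -[X in `|X|](subrK (w z)) addrC.
  rewrite (le_trans (ler_normD _ _)) // lerD2l (le_trans t1) //.
  by rewrite ger_pMr // invf_le1 // ler1n.
have [iF _ cvI] : [/\ lebesgue2.-integrable setT (EFin \o (f : plane -> R)),
   [sequence \int[lebesgue2]_z `|(EFin \o fn n) z - (EFin \o f) z|]_n%E @ \oo --> 0%E &
   [sequence \int[lebesgue2]_z (EFin \o fn n) z]_n%E @ \oo --> (\int[lebesgue2]_z (EFin \o f) z)%E].
  apply: (@dominated_convergence _ plane _ lebesgue2 setT measurableT
    (fun n => EFin \o fn n) (EFin \o f) (EFin \o G)) => //.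
  - by apply: aeW => z _; apply: cvg_EFin; [exact: nearW|exact: fnf].
  - by apply: aeW => z n _; rewrite /= lee_fin.
have If : (\int[lebesgue2]_z (f z)%:E = 0)%E.
  rewrite -(cvg_lim _ cvI) //; apply: lim_near_cst => //.
  by apply: nearW => n; exact: HI.
pose gp z := supp_grad w w' z * phi z.
have [igp Igp] := integral_lin (- 1) measurableT iF iwp.
have gpE : (fun z => f z + - 1 * wp z) = gp by apply/funext => z; rewrite /f /wp /gp; ring.
have IE h : (forall z, ~ U z -> h z = 0) -> \int[lebesgue2]_(z in U) h z = \int[lebesgue2]_z h z.
  move=> hU; rewrite Rintegral_mkcond; apply: eq_Rintegral => z _; rewrite patchE.
  by case: ifPn => // /negP nz; rewrite hU // => /mem_set.
rewrite !IE; last 2 first.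
  by move=> z nUz; rewrite phiK ?mulr0 //; exact: nUK.
  by move=> z nUz; rewrite phi'K ?mulr0 //; exact: nUK.
have e : (\int[lebesgue2]_z (gp z)%:E = (- 1)%:E * \int[lebesgue2]_z (wp z)%:E)%E.
  by rewrite -gpE Igp If add0e.
have fwp := integrable_fin_num measurableT iwp.
change (fine (\int[lebesgue2]_z (wp z)%:E)%E = - fine (\int[lebesgue2]_z (gp z)%:E)%E).
by rewrite e -[X in (_ * X)%E](fineK fwp) -EFinM /= mulN1r opprK.
Qed.

Lemma within_open_continuous_at (K U : set (R * R)) h : open U -> U `<=` K ->
  {within K, continuous h} -> forall z, U z -> {for z, continuous h}.
Proof.
move=> oU UK /(continuous_subspaceW UK); rewrite continuous_open_subspace //.
by move=> ch z Uz; apply: ch; rewrite inE.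
Qed.

Lemma partials_C1on N U K u D p q : partials N U K u D -> open U -> U `<=` K ->
  (p + q < N)%N -> C1on U (D p q) (D p.+1 q) (D p q.+1).
Proof.
move=> [_ Hc Hd] oU UK pqN z Uz; have [d1 d2] := Hd _ _ _ pqN Uz.
split=> //; apply: (within_open_continuous_at oU UK) => //; apply: Hc.
- exact: ltnW.
- by rewrite addSn.
- by rewrite addnS.
Qed.

(** The truncations of w are of class C^1 on the whole plane, so they can be integrated by parts
    against a test function. *)
Lemma weak_derivative_supp_grad U (M : R) w w1 w2 :
  open U -> U `<=` (box M : set (R * R)) -> continuous w ->
  (forall z, ~ U z -> w z = 0) -> C1on U w w1 w2 ->
  weak_derivative U ex w (supp_grad w w1) /\
  weak_derivative U ey w (supp_grad w w2).
Proof.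
move=> oU UM cw wU Cw.
suff H phi : test_function U phi ->
   \int[lebesgue2]_(z in U) (w z * 'D_ex phi z) =
      - (\int[lebesgue2]_(z in U) (supp_grad w w1 z * phi z)) /\
   \int[lebesgue2]_(z in U) (w z * 'D_ey phi z) =
      - \int[lebesgue2]_(z in U) (supp_grad w w2 z * phi z).
  by split=> phi /H [].
move=> [/(_ 1%N) [D HD] HK].
have phiE : phi = D 0 0 by apply/funext => z; have [-> //] := HD; exact: I.
have Cphi := @partials_C1on _ _ _ _ _ 0 0 HD (@openT _) (fun _ H => H) isT.
rewrite -phiE in Cphi.
have d1 z : is_derive z ex phi (D 1 0 z)%N by have [] := Cphi z I.
have d2 z : is_derive z ey phi (D 0 1 z)%N by have [] := Cphi z I.
have c0 : continuous phi by move=> z; have [] := Cphi z I.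
have c1 : continuous (D 1 0)%N by move=> z; have [] := Cphi z I.
have c2 : continuous (D 0 1)%N by move=> z; have [] := Cphi z I.
have D1 z : 'D_ex phi z = D 1%N 0%N z by have [_] := d1 z.
have D2 z : 'D_ey phi z = D 0%N 1%N z by have [_] := d2 z.
have suppw (g : R -> R) h : g 0 = 0 -> supp_in M (fun z => g (w z) * h z).
  move=> g0 z Hz; rewrite wU ?g0 ?mul0r // => /UM /boxP [b1 b2].
  by case/orP : Hz; rewrite ltNge ?b1 ?b2.
have HI k : 0 < k ->
    (\int[lebesgue2]_z (trunc2 k (w z) * w1 z * phi z + trunc1 k (w z) * D 1%N 0%N z)%:E = 0)%E /\
    (\int[lebesgue2]_z (trunc2 k (w z) * w2 z * phi z + trunc1 k (w z) * D 0%N 1%N z)%:E = 0)%E.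
  move=> k0.
  have small1 t : `|t| <= k -> trunc1 k t = 0 /\ trunc2 k t = 0.
    by move=> /(trunc_small k0) [].
  have [|t10 _] := small1 0; first by rewrite normr0 ltW.
  have dt t : is_derive t (1 : R) (trunc1 k) (trunc2 k t) by exact: is_derive_trunc1.
  have CU : C1on U phi (D 1%N 0%N) (D 0%N 1%N) by move=> z _; exact: Cphi.
  have CZ := C1onT_cut k0 oU cw wU Cw CU dt (continuous_trunc2 k0) small1.
  by have [_ ? _ ?] := C1onT_integral CZ (suppw (trunc1 k) phi t10).
split.
  under [in LHS]eq_Rintegral => z _ do rewrite D1.
  apply: (weak_derivative_cut oU UM cw wU _ d1) => //.
    by move=> z /Cw [].
  by move=> k /HI [].
under [in LHS]eq_Rintegral => z _ do rewrite D2.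
apply: (weak_derivative_cut oU UM cw wU _ d2) => //.
  by move=> z /Cw [].
by move=> k /HI [].
Qed.

End limit.

(** * From the energy to the norms *)

Section norms.
Context {R : realType}.
Local Notation plane := (measurableTypeR R * measurableTypeR R)%type.
Implicit Types (h w u v : R * R -> R) (z : R * R) (U : set (R * R)).

Lemma L2norm_le U u (c : R) : measurable (U : set plane) -> 0 <= c ->
  (\int[lebesgue2]_(z in U) (u z ^+ 2)%:E <= c%:E)%E ->
  (L2norm U u <= (Num.sqrt c)%:E)%E.
Proof.
move=> mU c0 Hc; rewrite /L2norm unlock /=.
have -> : (\int[lebesgue2]_x (`|((EFin \o u) \_ U) x| `^ 2) =
  \int[lebesgue2]_(z in U) (u z ^+ 2)%:E)%E.
  rewrite [RHS]integral_mkcond; apply: eq_integral => z _; rewrite !patchE.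
  case: ifP => _ /=; last by rewrite normr0 powR0.
  by rewrite -(real_normK (num_real (u z))) powR_mulrn.
rewrite -powR12_sqrt // -poweR_EFin.
by apply: gt0_ler_poweR => //; rewrite ?in_itv /= ?leey ?andbT ?lee_fin // integral_ge0 // => z _; rewrite lee_fin sqr_ge0.
Qed.

Lemma eq_L2norm U u v : (forall z, U z -> u z = v z) -> L2norm U u = L2norm U v.
Proof.
move=> uv; rewrite /L2norm; congr Lnorm; apply/funext => z.
by rewrite !patchE; case: ifPn => // /set_mem Uz; rewrite /= uv.
Qed.

Lemma eq_L2 U u v : (forall z, U z -> u z = v z) -> L2 U u -> L2 U v.
Proof.
move=> uv [mu fu]; split; last by rewrite -(eq_L2norm uv).
by apply: eq_measurable_fun mu => z; rewrite inE => Uz; exact: uv.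
Qed.

Lemma eq_weak_derivative U u v g (d : R * R) : (forall z, U z -> u z = v z) ->
  weak_derivative U d u g -> weak_derivative U d v g.
Proof.
move=> uv H phi /H <-; apply: eq_Rintegral => z; rewrite inE => Uz.
by rewrite uv.
Qed.

(** The H^1 norm is an infimum over pairs of weak derivatives: one pair with small energy is
    enough. *)
Lemma norms_of_energy U (M eps C : R) u w w1 w2 :
  open U -> U `<=` (box M : set (R * R)) -> continuous w ->
  (forall z, ~ U z -> w z = 0) -> C1on U w w1 w2 ->
  (forall z, U z -> w z = u z) -> 0 < eps -> eps <= 1 -> 0 <= C ->
  (\int[lebesgue2]_(z in U) (w z ^+ 2 / 2 +
       eps * (supp_grad w w1 z ^+ 2 + supp_grad w w2 z ^+ 2))%:E
   <= (C * eps)%:E)%E ->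
  (L2norm U u + (Num.sqrt eps)%:E * H1norm U u
     <= ((Num.sqrt (2 * C) + Num.sqrt (4 * C)) * Num.sqrt eps)%:E)%E.
Proof.
move=> oU UM cw wU Cw wu e0 e1 C0 HE.
have mU : measurable (U : set plane) by exact: open_measurable_plane.
set g1 := supp_grad w w1 in HE *; set g2 := supp_grad w w2 in HE *.
have mw : measurable_fun (U : set plane) (w : plane -> R).
  by apply: continuous_on_measurable => // z _; exact: cw.
have mg1 : measurable_fun (U : set plane) (g1 : plane -> R).
  by apply: measurable_supp_grad => // z /Cw [].
have mg2 : measurable_fun (U : set plane) (g2 : plane -> R).
  by apply: measurable_supp_grad => // z /Cw [].
have part (h : R * R -> R) (c : R) : measurable_fun (U : set plane) (h : plane -> R) ->
    0 < c -> (forall z, c * h z ^+ 2 <= w z ^+ 2 / 2 + eps * (g1 z ^+ 2 + g2 z ^+ 2)) ->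
    (\int[lebesgue2]_(z in U) (h z ^+ 2)%:E <= (C * eps / c)%:E)%E.
  move=> mh c0 Hh.
  have mh2 : measurable_fun (U : set plane) ((fun z => (h z ^+ 2)) : plane -> R).
    exact: measurable_funX.
  have : (\int[lebesgue2]_(z in U) (c%:E * (h z ^+ 2)%:E) <= (C * eps)%:E)%E.
    apply: le_trans HE; apply: ge0_le_integral => //.
    - by move=> z _; rewrite -EFinM lee_fin mulr_ge0 ?sqr_ge0 ?ltW.
    - by apply/measurable_funeM/measurable_EFinP.
    - apply/measurable_EFinP; apply: measurable_funD.
        by apply: measurable_funM => //; exact: measurable_funX.
      by apply: measurable_funM => //; apply: measurable_funD; exact: measurable_funX.
    - by move=> z _; rewrite -EFinM lee_fin.
  rewrite ge0_integralZl_EFin ?(ltW c0) //; last 2 first.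
    by move=> z _; rewrite lee_fin sqr_ge0.
    exact/measurable_EFinP.
  by rewrite -lee_pdivlMl // => /le_trans; apply; rewrite -EFinM lee_fin mulrC.
have Iw := part w 2^-1 mw; have I1 := part g1 eps mg1 e0; have I2 := part g2 eps mg2 e0.
have s0 z : 0 <= eps * g1 z ^+ 2 by rewrite mulr_ge0 ?sqr_ge0 ?ltW.
have s1 z : 0 <= eps * g2 z ^+ 2 by rewrite mulr_ge0 ?sqr_ge0 ?ltW.
have Nw : (L2norm U w <= (Num.sqrt (2 * C * eps))%:E)%E.
  apply: L2norm_le => //; first by rewrite !mulr_ge0 ?(ltW e0).
  rewrite (_ : 2 * C * eps = C * eps / 2^-1); last by field.
  by apply: Iw => // z; have := s0 z; have := s1 z; lra.
have N1 : (L2norm U g1 <= (Num.sqrt C)%:E)%E.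
  apply: L2norm_le => //.
  rewrite (_ : C = C * eps / eps); last by rewrite mulfK ?gt_eqF.
  by apply: I1 => // z; have := sqr_ge0 (w z); have := s1 z; lra.
have N2 : (L2norm U g2 <= (Num.sqrt C)%:E)%E.
  apply: L2norm_le => //.
  rewrite (_ : C = C * eps / eps); last by rewrite mulfK ?gt_eqF.
  by apply: I2 => // z; have := sqr_ge0 (w z); have := s0 z; lra.
have Lw : L2 U w by split => //; apply: le_lt_trans Nw _; exact: ltry.
have Lu : L2 U u by exact: eq_L2 Lw.
have Lg1 : L2 U g1 by split => //; apply: le_lt_trans N1 _; exact: ltry.
have Lg2 : L2 U g2 by split => //; apply: le_lt_trans N2 _; exact: ltry.
have [W1 W2] := weak_derivative_supp_grad oU UM cw wU Cw.
have L0 h : (0 <= L2norm U h)%E by exact: Lnorm_ge0.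
have sq2 (a : \bar R) (c : R) : (0 <= a)%E -> 0 <= c -> (a <= (Num.sqrt c)%:E)%E -> (a ^+ 2 <= c%:E)%E.
  move=> a0 c0 ac; rewrite -[in leRHS](sqr_sqrtr c0) expe2 expr2 EFinM.
  exact: lee_pmul.
have NH : (H1norm U u <= (Num.sqrt (4 * C))%:E)%E.
  rewrite /H1norm.
  apply: le_trans (_ : sqrte (L2norm U u ^+ 2 + L2norm U g1 ^+ 2 + L2norm U g2 ^+ 2)%E <= _)%E.
    apply: ereal_inf_lbound; exists g1, g2; split => //.
      exact: eq_weak_derivative W1.
    exact: eq_weak_derivative W2.
  have -> : (Num.sqrt (4 * C))%:E = sqrte (4 * C)%:E by [].
  rewrite lee_sqrt ?lee_fin ?mulr_ge0 //.
  have -> : 4 * C = 2 * C + C + C by ring.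
  rewrite !EFinD; apply: leeD; last by exact: sq2.
  apply: leeD; last by exact: sq2.
  rewrite -(eq_L2norm wu); apply: sq2 => //; first by rewrite mulr_ge0.
  apply: le_trans Nw _; rewrite lee_fin ler_sqrt ?mulr_ge0 //.
  by rewrite -[leRHS]mulr1 ler_wpM2l ?mulr_ge0.
rewrite mulrDl EFinD; apply: leeD.
  by rewrite -(eq_L2norm wu) -sqrtrM ?mulr_ge0.
by rewrite mulrC EFinM; apply: lee_wpmul2l => //; rewrite lee_fin sqrtr_ge0.
Qed.

End norms.

(** * Derivatives along curves, integrals with a parameter *)

Section parameter_integrals.
Context {R : realType}.
Implicit Types (h : R * R -> R) (z : R * R) (U : set (R * R)).

Lemma ball_planeP z U : nbhs z U <->
  exists2 d : R, 0 < d & forall x, `|x.1 - z.1| < d -> `|x.2 - z.2| < d -> U x.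
Proof.
split=> [/nbhs_ballP [d /= d0 dU]|[d d0 dU]].
  by exists d => // x x1 x2; apply: dU; split; rewrite /ball /= distrC.
apply/nbhs_ballP; exists d => //= x [x1 x2]; apply: dU; rewrite distrC //.
Qed.

(** The chain rule along a graph. Continuity of the first partial derivative gives it without
    total differentiability: the increment in x is treated by the mean value theorem. *)
Lemma is_derive_along U h h1 h2 (g : R -> R) (x g' : R) :
  open U -> C1on U h h1 h2 -> U (x, g x) -> is_derive x (1 : R) g g' ->
  is_derive x (1 : R) (fun s => h (s, g s)) (h1 (x, g x) + h2 (x, g x) * g').
Proof.
move=> oU Ch Ux dg; have [d1 d2 ch ch1 ch2] := Ch _ Ux.
have cg : {for x, continuous g}.
  by apply: differentiable_continuous; apply/derivable1_diffP; case: dg.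
have dv : is_derive x (1 : R) (fun s => h (x, g s)) (h2 (x, g x) * g').
  by apply: (@is_derive1_comp _ (fun t => h (x, t)) g); move/is_derive_eyE: d2.
apply/derive1_lim.
have -> : (fun k : R => k^-1 * (h (x + k, g (x + k)) - h (x, g x))) =
  (fun k => k^-1 * (h (x + k, g (x + k)) - h (x, g (x + k)))
          + k^-1 * (h (x, g (x + k)) - h (x, g x))).
  by apply/funext => k; ring.
apply: cvgD; last by move/derive1_lim : dv.
have nU : nbhs (x, g x) U by exact: open_nbhs_nbhs.
have [d d0 dU] := (ball_planeP _ _).1 nU.
apply/cvgrPdist_le => e e0.
have /ball_planeP [d' d'0 dh1] : nbhs (x, g x) [set w | `|h1 (x, g x) - h1 w| <= e].
  by move/cvgrPdist_le : ch1; apply.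
pose m := Num.min d d'.
have m0 : 0 < m by rewrite lt_min d0.
have /nbhs_ballP [r /= r0 gr] : nbhs x [set s | `|g x - g s| < m].
  by move/cvgrPdist_lt : cg; apply.
near=> k.
have k0 : k != 0 by near: k; exact: nbhs_dnbhs_neq.
have km : `|k| < m by near: k; apply: dnbhs0_lt.
have gk : `|g (x + k) - g x| < m.
  rewrite distrC; apply: gr; rewrite /ball /= opprD addrA subrr add0r normrN.
  by near: k; apply: dnbhs0_lt.
have inU s : `|s - x| <= `|k| -> U (s, g (x + k)).
  move=> sk; apply: dU => /=.
    by rewrite (le_lt_trans sk) // (lt_le_trans km) // ge_min lexx.
  by rewrite (lt_le_trans gk) // ge_min lexx.
have nearh1 s : `|s - x| <= `|k| -> `|h1 (x, g x) - h1 (s, g (x + k))| <= e.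
  move=> sk; apply: dh1 => /=.
    by rewrite (le_lt_trans sk) // (lt_le_trans km) // ge_min lexx orbT.
  by rewrite (lt_le_trans gk) // ge_min lexx orbT.
have dF s : `|s - x| <= `|k| ->
    is_derive s (1 : R) (fun s => h (s, g (x + k))) (h1 (s, g (x + k))).
  by move=> /inU /Ch [/is_derive_exE].
have cF a b : (forall s, a <= s <= b -> `|s - x| <= `|k|) ->
    {within `[a, b], continuous (fun s => h (s, g (x + k)))}.
  move=> H; apply: derivable_within_continuous => s; rewrite in_itv /= => /H /dF [] //.
have [kpos|kneg|k00] := ltgtP k 0; last by rewrite k00 eqxx in k0.
- have xk : x + k < x by rewrite gtrDl.
  have Hs s : x + k <= s <= x -> `|s - x| <= `|k|.
    by move=> /andP[s1 s2]; rewrite (ltr0_norm kpos) ler_norml; apply/andP; split; lra.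
  have [c] := MVT xk (fun s Hs' => dF s (Hs s (subset_itv_oo_cc Hs'))) (cF _ _ Hs).
  move=> /subset_itv_oo_cc /Hs cx E.
  have -> : h (x + k, g (x + k)) - h (x, g (x + k)) = k * h1 (c, g (x + k)) by lra.
  by rewrite mulrA mulVf // mul1r nearh1.
- have xk : x < x + k by rewrite ltrDl.
  have Hs s : x <= s <= x + k -> `|s - x| <= `|k|.
    by move=> /andP[s1 s2]; rewrite (gtr0_norm kneg) ler_norml; apply/andP; split; lra.
  have [c] := MVT xk (fun s Hs' => dF s (Hs s (subset_itv_oo_cc Hs'))) (cF _ _ Hs).
  move=> /subset_itv_oo_cc /Hs cx E.
  have -> : h (x + k, g (x + k)) - h (x, g (x + k)) = k * h1 (c, g (x + k)) by lra.
  by rewrite mulrA mulVf // mul1r nearh1.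
Unshelve. all: by end_near. Qed.

Lemma unit_itv_measure : @lebesgue_measure R `]0%R, 1%R[%classic = 1%:E.
Proof. by rewrite lebesgue_measure_itv /= lte_fin ltr01 -EFinB subr0. Qed.

Lemma unit_itv_lty : (@lebesgue_measure R `]0%R, 1%R[%classic < +oo)%E.
Proof. by rewrite unit_itv_measure ltry. Qed.

(** Dominated convergence along sequences; a failure of continuity would be witnessed by one. *)
Lemma continuous_parameter_integral (z : R * R) (k : R * R -> R -> R) (M : R) :
  (\forall x \near z, measurable_fun (`]0, 1[%classic : set (measurableTypeR R)) (k x)
     /\ forall t, 0 < t < 1 -> `|k x t| <= M) ->
  (forall t, 0 < t < 1 -> {for z, continuous (k ^~ t)}) ->
  {for z, continuous (fun x => \int[lebesgue_measure]_(t in `]0, 1[) k x t)}.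
Proof.
move=> nk ck; apply/cvgrPdist_lt => e e0; apply: contrapT => nnear.
pose P x := measurable_fun (`]0, 1[%classic : set (measurableTypeR R)) (k x)
     /\ forall t, 0 < t < 1 -> `|k x t| <= M.
pose F x := \int[lebesgue_measure]_(t in `]0, 1[) k x t.
(* points closer than 1 / (n + 1) to z at which the integral is off by e *)
have Hn (n : nat) : exists x : R * R, [/\ P x, `|x.1 - z.1| <= 1 * n.+1%:R^-1,
    `|x.2 - z.2| <= 1 * n.+1%:R^-1 & e <= `|F z - F x|].
  apply: contrapT => nex; apply: nnear.
  have : \forall x \near z, `|x.1 - z.1| < n.+1%:R^-1 /\ `|x.2 - z.2| < n.+1%:R^-1.
    by apply/ball_planeP; exists n.+1%:R^-1; rewrite ?invr_gt0.
  apply: filterS2 nk => x Px [x1 x2]; rewrite ltNge; apply/negP => ex.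
  by apply: nex; exists x; split => //; rewrite mul1r ltW.
have [u Hu] := choice Hn.
have u1 : (fun n => (u n).1) @ \oo --> z.1.
  by apply: (@cvg_harmonic_bound _ _ _ 1) => n; have [] := Hu n.
have u2 : (fun n => (u n).2) @ \oo --> z.2.
  by apply: (@cvg_harmonic_bound _ _ _ 1) => n; have [] := Hu n.
have uz : (fun n => ((u n).1, (u n).2)) @ \oo --> z.
  by have H := cvg_pair u1 u2; exact: H.
have uE : (fun n => ((u n).1, (u n).2)) = u.
  by apply/funext => n; rewrite -surjective_pairing.
rewrite {}uE in uz.
have Pz : P z by exact: nbhs_singleton nk.
have M0 : 0 <= M.
  have [_ /(_ 2^-1)] := Pz; rewrite invr_gt0 ltr0n invf_lt1 // ltr1n => /(_ isT).
  exact: le_trans.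
have mI : measurable (`]0, 1[%classic : set (measurableTypeR R)) by exact: measurable_itv.
have cv : (\int[lebesgue_measure]_(t in `]0%R, 1%R[) (k (u n) t)%:E)%E @[n --> \oo] -->
    (\int[lebesgue_measure]_(t in `]0%R, 1%R[) (k z t)%:E)%E.
  apply: (@dominated_cvg _ _ _ lebesgue_measure _ mI _ _ (EFin \o cst M)) => //.
  - by move=> n; apply/measurable_EFinP; have [[]] := Hu n.
  - move=> t; rewrite /= in_itv /= => t01; apply: cvg_EFin; first exact: nearW.
    by have := ck t t01; move=> /(cvg_comp _ _ uz).
  - apply: measurable_bounded_integrable => //.
      exact: unit_itv_lty.
    exists M; split; first exact: num_real.
    by move=> L ML t _ /=; rewrite ger0_norm // ltW.
  - move=> n t; rewrite /= in_itv /= => t01; rewrite lee_fin.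
    by have [[_ H] _ _ _] := Hu n; exact: H.
have iz : lebesgue_measure.-integrable `]0, 1[ (EFin \o (k z : measurableTypeR R -> R)).
  have [mz bz] := Pz.
  apply: measurable_bounded_integrable => //.
    exact: unit_itv_lty.
  exists M; split; first exact: num_real.
  by move=> L ML t /=; rewrite in_itv /= => /bz /le_trans; apply; rewrite ltW.
have cvF : F (u n) @[n --> \oo] --> F z.
  by apply: fine_cvg; rewrite fineK //; exact: integrable_fin_num.
have [N _ /(_ N (leqnn N))] : \forall n \near \oo, `|F z - F (u n)| < e.
  by move/cvgrPdist_lt : cvF; apply.
by have [_ _ _] := Hu N; rewrite leNgt => /negP H /H.
Qed.

End parameter_integrals.

(** * Vertical chords of the ellipse and integrals along them *)

Section ellipse_chords.
Context {R : realType} {A B : R} (A0 : 0 < A) (B0 : 0 < B).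
Implicit Types (h : R * R -> R) (z : R * R).
Local Notation E := (ellipse A B).
Local Notation C := (Cu A B).

Lemma ellipse_bounds z : E z -> `|z.1| < A /\ `|z.2| < B.
Proof.
have a2 : 0 < A ^+ 2 by rewrite exprn_gt0.
have b2 : 0 < B ^+ 2 by rewrite exprn_gt0.
rewrite /ellipse /= => Ez.
have q1 : 0 <= z.1 ^+ 2 / A ^+ 2 by rewrite divr_ge0 ?sqr_ge0.
have q2 : 0 <= z.2 ^+ 2 / B ^+ 2 by rewrite divr_ge0 ?sqr_ge0.
split; rewrite -ltr_sqr ?nnegrE ?(ltW A0) ?(ltW B0) // real_normK ?num_real //.
  by rewrite -[ltRHS]mul1r -ltr_pdivrMr //; lra.
by rewrite -[ltRHS]mul1r -ltr_pdivrMr //; lra.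
Qed.

Lemma Cu_ge0 x : 0 <= C x.
Proof. by rewrite mulr_ge0 ?sqrtr_ge0 // ltW. Qed.

Lemma Cu_sqr x : `|x| <= A -> C x ^+ 2 = B ^+ 2 * (1 - x ^+ 2 / A ^+ 2).
Proof.
move=> xA; rewrite exprMn sqr_sqrtr // subr_ge0 ler_pdivrMr ?exprn_gt0 //.
by rewrite mul1r -(real_normK (num_real x)) ler_sqr ?nnegrE // ltW.
Qed.

Lemma Cu_gt0 x : `|x| < A -> 0 < C x.
Proof.
move=> xA; rewrite mulr_gt0 // sqrtr_gt0 subr_gt0 ltr_pdivrMr ?exprn_gt0 //.
by rewrite mul1r -(real_normK (num_real x)) ltr_sqr ?nnegrE // ltW.
Qed.

Lemma Cu_leB x : C x <= B.
Proof.
rewrite -[leRHS]mulr1 ler_wpM2l ?(ltW B0) // -[leRHS]sqrtr1 ler_wsqrtr //.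
by rewrite gerBl divr_ge0 ?sqr_ge0.
Qed.

Lemma ellipseE z : E z <-> `|z.1| < A /\ `|z.2| < C z.1.
Proof.
have b2 : 0 < B ^+ 2 by rewrite exprn_gt0.
have H : `|z.1| < A -> (`|z.2| < C z.1 <-> E z).
  move=> zA; rewrite -ltr_sqr ?nnegrE ?Cu_ge0 // real_normK ?num_real //.
  rewrite Cu_sqr ?(ltW zA) // mulrC -ltr_pdivrMr // /ellipse /=; split; lra.
by split=> [Ez|[z1 /(H z1)]] //; have [z1 _] := ellipse_bounds Ez; split => //; apply/H.
Qed.

(** The chord from z to the upper boundary, parametrized over the fixed interval [0, 1] so that
    integrals along it can be differentiated in x under the integral sign. *)
Definition upward z t := (z.1, z.2 + t * (C z.1 - z.2)).

Lemma upward_in z t : E z -> 0 <= t < 1 -> E (upward z t).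
Proof.
move=> /ellipseE [z1 z2] /andP[t0 t1]; apply/ellipseE; split => //=.
move: z2; rewrite !ltr_norml => /andP[z2 z3].
have d0 : 0 < C z.1 - z.2 by lra.
have td0 : 0 <= t * (C z.1 - z.2) by rewrite mulr_ge0 // ltW.
have td1 : t * (C z.1 - z.2) < 1 * (C z.1 - z.2) by rewrite ltr_pM2r.
by apply/andP; split; lra.
Qed.

Lemma continuous_sqr_fst z : {for z, continuous (fun z : R * R => z.1 ^+ 2)}.
Proof.
apply: (@continuous_comp _ _ _ (fun z : R * R => z.1) (fun x => x ^+ 2)).
  exact: cvg_fst.
exact: exprn_continuous.
Qed.

Lemma continuous_sqr_snd z : {for z, continuous (fun z : R * R => z.2 ^+ 2)}.
Proof.
apply: (@continuous_comp _ _ _ (fun z : R * R => z.2) (fun x => x ^+ 2)).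
  exact: cvg_snd.
exact: exprn_continuous.
Qed.

Lemma continuous_gauge :
  continuous (fun z : R * R => z.1 ^+ 2 / A ^+ 2 + z.2 ^+ 2 / B ^+ 2).
Proof.
move=> z; apply: cvgD; apply: cvgM; try exact: cvg_cst.
  exact: continuous_sqr_fst.
exact: continuous_sqr_snd.
Qed.

Lemma open_ellipse : open E.
Proof.
rewrite openE => z Ez; exact: near_lt_at (@continuous_gauge z) Ez.
Qed.

Definition dCu x := - (B ^+ 2 * x) / (A ^+ 2 * C x).

Lemma continuous_Cu : continuous C.
Proof.
move=> x; apply: cvgM; first exact: cvg_cst.
apply: (@continuous_comp _ _ _ (fun x : R => 1 - x ^+ 2 / A ^+ 2) Num.sqrt).
  apply: cvgB; first exact: cvg_cst.
  by apply: cvgM; [exact: exprn_continuous|exact: cvg_cst].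
exact: sqrt_continuous.
Qed.

Lemma is_derive_Cu x : `|x| < A -> is_derive x (1 : R) C (dCu x).
Proof.
move=> xA; have Cx := Cu_gt0 xA.
have p0 : 0 < 1 - x ^+ 2 / A ^+ 2.
  by move: Cx; rewrite /Cu pmulr_rgt0 // sqrtr_gt0.
have s0 : Num.sqrt (1 - x ^+ 2 / A ^+ 2) != 0 by rewrite gt_eqF // sqrtr_gt0.
have a0 : A != 0 by rewrite gt_eqF.
have b0 : B != 0 by rewrite gt_eqF.
have d1 : is_derive x (1 : R) (fun y : R => 1 - y ^+ 2 / A ^+ 2) (- (2 * x / A ^+ 2)).
  apply: is_derive_eq; rewrite /GRing.scale /=; field; lra.
have d2 := is_derive1_comp (g := fun y : R => 1 - y ^+ 2 / A ^+ 2) (is_derive1_sqrt p0) d1.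
have d3 := is_deriveZ B d2.
have /is_derive_eq := d3; apply.
rewrite /dCu /Cu /GRing.scale /=; field.
by rewrite s0 a0 b0.
Qed.

Lemma continuous_dCu x : `|x| < A -> {for x, continuous dCu}.
Proof.
move=> xA; apply: cvgM.
  by apply: cvgN; apply: cvgM => //; exact: cvg_cst.
apply: (@continuous_comp _ _ _ (fun x => A ^+ 2 * C x) GRing.inv).
  by apply: cvgM; [exact: cvg_cst|exact: continuous_Cu].
by apply: inv_continuous; rewrite mulf_neq0 // gt_eqF ?exprn_gt0 ?Cu_gt0.
Qed.

(** C' blows up at both ends, but C^2 is a polynomial in x. *)
Lemma Cu_dCu_le x : `|x| < A -> `|C x * dCu x| <= B ^+ 2 / A.
Proof.
move=> xA; have Cx := Cu_gt0 xA.
have -> : C x * dCu x = - (B ^+ 2 / A ^+ 2 * x).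
  by rewrite /dCu; field; rewrite !gt_eqF.
rewrite normrN normrM ger0_norm ?divr_ge0 ?sqr_ge0 //.
have -> : B ^+ 2 / A = B ^+ 2 / A ^+ 2 * A by field; rewrite gt_eqF.
by rewrite ler_wpM2l ?divr_ge0 ?sqr_ge0 // ltW.
Qed.

Lemma upward_measurable h z : E z ->
  (forall w, E w -> {for w, continuous h}) ->
  measurable_fun (`]0, 1[%classic : set (measurableTypeR R))
    (fun t => h (upward z t)).
Proof.
move=> Ez ch; apply: open_continuous_measurable_fun; first exact: interval_open.
move=> t; rewrite inE /= in_itv /= => /andP[t0 t1].
apply: (@continuous_comp _ _ _ (upward z) h).
  apply: continuous_at_pair; first by move=> ?; exact: cvg_cst.
  apply: cvgD; first exact: cvg_cst.
  by apply: cvgM => //; exact: cvg_cst.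
by apply: ch; apply: upward_in => //; rewrite (ltW t0).
Qed.

Lemma continuous_upward t z : {for z, continuous (fun z => upward z t)}.
Proof.
have cC : {for z, continuous (fun z : R * R => C z.1)}.
  by apply: (@continuous_comp _ _ _ (fun z : R * R => z.1) C);
    [exact: cvg_fst|exact: continuous_Cu].
apply: continuous_at_pair; first exact: cvg_fst.
apply: cvgD; first exact: cvg_snd.
apply: cvgM; first exact: cvg_cst.
by apply: cvgB => //; exact: cvg_snd.
Qed.

Definition upmean (k : R * R -> R -> R) z :=
  \int[lebesgue_measure]_(t in `]0, 1[) k z t.

Lemma upmean_le (k : R * R -> R -> R) (M : R) z : 0 <= M ->
  measurable_fun (`]0, 1[%classic : set (measurableTypeR R)) (k z) ->
  (forall t, 0 < t < 1 -> `|k z t| <= M) ->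
  lebesgue_measure.-integrable `]0, 1[ (EFin \o (k z : measurableTypeR R -> R)) /\
  `|upmean k z| <= M.
Proof.
move=> M0 mk kM.
have mI : measurable (`]0, 1[%classic : set (measurableTypeR R)) by exact: measurable_itv.
have ik : lebesgue_measure.-integrable `]0, 1[ (EFin \o (k z : measurableTypeR R -> R)).
  apply: measurable_bounded_integrable => //; first exact: unit_itv_lty.
  exists M; split; first exact: num_real.
  by move=> L ML t /=; rewrite in_itv /= => /kM /le_trans; apply; exact: ltW.
split=> //.
have icst : lebesgue_measure.-integrable `]0, 1[ (EFin \o (cst M : measurableTypeR R -> R)).
  apply: measurable_bounded_integrable => //; first exact: unit_itv_lty.
  exists M; split; first exact: num_real.
  by move=> L ML t /= _; rewrite ger0_norm // ltW.
have ikn : lebesgue_measure.-integrable `]0, 1[ (EFin \o ((fun t => `|k z t|) : measurableTypeR R -> R)).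
  exact: integrable_norm ik.
apply: le_trans (le_normr_Rintegral _ ik) _ => //.
apply: le_trans (le_Rintegral mI ikn icst _) _.
  by move=> t; rewrite /= in_itv /= => /kM.
have -> : \int[lebesgue_measure]_(x in `]0, 1[) cst M x =
    M * fine (@lebesgue_measure R `]0%R, 1%R[%classic) by exact: Rintegral_cst.
by rewrite unit_itv_measure /= mulr1.
Qed.

Lemma continuous_upmean (k : R * R -> R -> R) (M : R) z : E z ->
  (forall x, E x -> measurable_fun (`]0, 1[%classic : set (measurableTypeR R)) (k x)) ->
  (\forall x \near z, E x -> forall t, 0 < t < 1 -> `|k x t| <= M) ->
  (forall t, 0 < t < 1 -> {for z, continuous (k ^~ t)}) ->
  {for z, continuous (upmean k)}.
Proof.
move=> Ez mk kM ck; apply: (@continuous_parameter_integral _ z k M) => //.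
have nE : nbhs z E by apply: open_nbhs_nbhs; split => //; exact: open_ellipse.
by near=> x; split; [apply: mk; near: x|move=> t; apply: (near kM x) => //; near: x].
Unshelve. all: by end_near. Qed.

Section primitive.
Context {D0 D1 D2 : R * R -> R} {M K : R}.
Context (M0 : 0 <= M) (K0 : 0 <= K) (CD : C1on E D0 D1 D2).
Context (D0M : forall z, E z -> `|D0 z| <= K * C z.1).
Context (D1M : forall z, E z -> `|D1 z| <= M).
Context (D2M : forall z, E z -> `|D2 z| <= M).

(** The integral of D0 over the chord from z to the upper boundary, rescaled to [0, 1]. *)
Definition prim z := (C z.1 - z.2) * upmean (fun z t => D0 (upward z t)) z.

Definition dprim_integrand z t :=
  D1 (upward z t) + D2 (upward z t) * (t * dCu z.1).

(** The derivative of prim in x, by the product rule and differentiation under the integral sign. *)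
Definition dprim z := dCu z.1 * upmean (fun z t => D0 (upward z t)) z +
  (C z.1 - z.2) * upmean dprim_integrand z.

(** Data of size C on a chord of length at most 2 C. *)
Lemma prim_le z : E z -> `|prim z| <= 2 * K * C z.1 ^+ 2.
Proof.
move=> Ez; have [z1 z2] := (ellipseE z).1 Ez.
have C0 := Cu_gt0 z1.
have [] := @upmean_le (fun z t => D0 (upward z t)) (K * C z.1) z.
- by rewrite mulr_ge0 // ltW.
- by apply: upward_measurable => // w /CD [].
- by move=> t /andP[t0 t1]; apply: D0M; apply: upward_in => //; rewrite (ltW t0).
move=> _ H; rewrite normrM.
have -> : 2 * K * C z.1 ^+ 2 = (2 * C z.1) * (K * C z.1) by ring.
apply: ler_pM => //.
move: z2; rewrite ltr_norml => /andP[? ?].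
by rewrite ger0_norm; lra.
Qed.

Lemma dprim_integrand_measurable z : E z ->
  measurable_fun (`]0, 1[%classic : set (measurableTypeR R)) (dprim_integrand z).
Proof.
move=> Ez; apply: measurable_funD.
  by apply: upward_measurable => // w /CD [].
apply: measurable_funM.
  by apply: upward_measurable => // w /CD [].
by apply: measurable_funM => //; exact: measurable_id.
Qed.

Lemma dprim_integrand_le z t : E z -> 0 < t < 1 ->
  `|dprim_integrand z t| <= M + M * `|dCu z.1|.
Proof.
move=> Ez /andP[t0 t1].
have Eu : E (upward z t) by apply: upward_in => //; rewrite ltW.
rewrite (le_trans (ler_normD _ _)) // lerD ?D1M // normrM ler_pM ?D2M //.
by rewrite normrM ler_piMl // ger0_norm ltW.
Qed.

(** The unbounded slope of C only occurs multiplied by the mean of the data or by the chord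
    length; both are of order C, and C times C' is bounded. *)
Lemma dprim_le z : E z ->
  `|dprim z| <= (K + 2 * M) * (B ^+ 2 / A) + 2 * B * M.
Proof.
move=> Ez; have [z1 z2] := (ellipseE z).1 Ez.
have C0 := Cu_gt0 z1; have CB := Cu_leB z.1; have Cd := Cu_dCu_le z1.
have [] := @upmean_le (fun z t => D0 (upward z t)) (K * C z.1) z.
- by rewrite mulr_ge0 // ltW.
- by apply: upward_measurable => // w /CD [].
- by move=> t /andP[t0 t1]; apply: D0M; apply: upward_in => //; rewrite (ltW t0).
move=> _ H1.
have [] := @upmean_le dprim_integrand (M + M * `|dCu z.1|) z.
- by rewrite addr_ge0 // mulr_ge0.
- exact: dprim_integrand_measurable.
- by move=> t; exact: dprim_integrand_le.
move=> _ H2; rewrite normrM (gtr0_norm C0) in Cd.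
have d0 := normr_ge0 (dCu z.1).
rewrite /dprim (le_trans (ler_normD _ _)) // (normrM (dCu _)) (normrM (C _ - _)).
have Cz : `|C z.1 - z.2| <= 2 * C z.1.
  by move: z2; rewrite ltr_norml => /andP[? ?]; rewrite ger0_norm; lra.
have S1 : `|dCu z.1| * `|upmean (fun z t => D0 (upward z t)) z| <= K * (B ^+ 2 / A).
  apply: le_trans (ler_wpM2l d0 H1) _.
  by rewrite mulrCA ler_wpM2l // mulrC.
have S2 : `|C z.1 - z.2| * `|upmean dprim_integrand z| <= 2 * M * (B ^+ 2 / A) + 2 * B * M.
  apply: le_trans (ler_pM _ _ Cz H2) _ => //.
  have T1 : M * C z.1 <= M * B by rewrite ler_wpM2l.
  have T2 : M * (C z.1 * `|dCu z.1|) <= M * (B ^+ 2 / A) by rewrite ler_wpM2l.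
  lra.
lra.
Qed.

Lemma prim_C1 z : E z ->
  is_derive z ex prim (dprim z) /\ {for z, continuous dprim}.
Proof.
move=> Ez; have [z1 z2] := (ellipseE z).1 Ez.
have nE : nbhs z E by apply: open_nbhs_nbhs; split => //; exact: open_ellipse.
have cfst : {for z, continuous (fun z : R * R => z.1)} by exact: cvg_fst.
have cC : {for z, continuous (fun z : R * R => C z.1)}.
  by apply: (@continuous_comp _ _ _ (fun z : R * R => z.1) C) => //; exact: continuous_Cu.
have cdC : {for z, continuous (fun z : R * R => dCu z.1)}.
  by apply: (@continuous_comp _ _ _ (fun z : R * R => z.1) dCu) => //; exact: continuous_dCu.
pose L := `|dCu z.1| + 1.
have nL : \forall x \near z, `|dCu x.1| < L.
  apply: (@near_lt_at _ _ (fun x : R * R => `|dCu x.1|)).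
    by apply: (@continuous_comp _ _ _ (fun z : R * R => dCu z.1)) => //; exact: norm_continuous.
  by rewrite ltrDl.
have cup h t : 0 < t < 1 -> (forall w, E w -> {for w, continuous h}) ->
    {for z, continuous (fun x => h (upward x t))}.
  move=> /andP[t0 t1] ch; apply: (@continuous_comp _ _ _ (fun x => upward x t) h).
    exact: continuous_upward.
  by apply: ch; apply: upward_in => //; rewrite ltW.
have c0 : {for z, continuous (upmean (fun z t => D0 (upward z t)))}.
  apply: (@continuous_upmean _ (K * B)) => //.
  - by move=> x Ex; apply: upward_measurable => // w /CD [].
  - apply: filterS nE => x Ex _ t /andP[t0 t1].
    have Eu : E (upward x t) by apply: upward_in => //; rewrite ltW.
    by rewrite (le_trans (D0M Eu)) // ler_wpM2l // Cu_leB.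
  - by move=> t t01; apply: cup => // w /CD [].
have c1 : {for z, continuous (upmean dprim_integrand)}.
  apply: (@continuous_upmean _ (M + M * L)) => //.
  - by move=> x Ex; exact: dprim_integrand_measurable.
  - apply: filterS nL => x xL Ex t t01; rewrite (le_trans (dprim_integrand_le Ex t01)) //.
    by rewrite lerD2l ler_wpM2l // ltW.
  - move=> t t01; apply: cvgD; first by apply: cup => // w /CD [].
    apply: cvgM; first by apply: cup => // w /CD [].
    by apply: cvgM => //; exact: cvg_cst.
split; last first.
  apply: cvgD; apply: cvgM => //; apply: cvgB => //; exact: cvg_snd.
have [d d0 dE] : exists2 d : R, 0 < d & forall x, `|x - z.1| < d -> E (x, z.2) /\ `|dCu x| < L.
  have : nbhs z (E `&` [set x | `|dCu x.1| < L]) by exact: filterI.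
  move=> /ball_planeP [d d0 dE]; exists d => // x xz; apply: dE => //=.
  by rewrite subrr normr0.
have Iz : `]z.1 - d, z.1 + d[%classic z.1.
  by rewrite /= in_itv /=; apply/andP; split; lra.
have inI x : `]z.1 - d, z.1 + d[%classic x -> E (x, z.2) /\ `|dCu x| < L.
  by rewrite /= in_itv /= => /andP[x1 x2]; apply: dE; rewrite ltr_norml; apply/andP; split; lra.
have dD0 x t : E (x, z.2) -> 0 < t < 1 ->
   is_derive x (1 : R) (fun s => D0 (upward (s, z.2) t)) (dprim_integrand (x, z.2) t).
  move=> Ex /andP[t0 t1]; have [x1 _] := (ellipseE _).1 Ex.
  have dg : is_derive x (1 : R) (fun s => z.2 + t * (C s - z.2)) (t * dCu x).
    have dC := is_derive_Cu x1.
    by apply: is_derive_eq; rewrite /GRing.scale /=; ring.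
  apply: (is_derive_along open_ellipse CD _ dg).
  by apply: (@upward_in (x, z.2)) => //; rewrite ltW.
have mI : measurable (`]0, 1[%classic : set (measurableTypeR R)) by exact: measurable_itv.
have intf x : `]z.1 - d, z.1 + d[%classic x ->
    lebesgue_measure.-integrable `]0, 1[ (EFin \o ((fun t => D0 (upward (x, z.2) t)) : measurableTypeR R -> R)).
  move=> /inI [Ex _].
  have [] // := @upmean_le (fun z t => D0 (upward z t)) (K * B) (x, z.2).
  - by rewrite mulr_ge0 // ltW.
  - by apply: upward_measurable => // w /CD [].
  - move=> t /andP[t0 t1].
    have Eu : E (upward (x, z.2) t) by apply: upward_in => //; rewrite ltW.
    by rewrite (le_trans (D0M Eu)) // ler_wpM2l // Cu_leB.
have partial1E x t : E (x, z.2) -> 0 < t < 1 ->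
   partial1of2 (fun x t => D0 (upward (x, z.2) t)) x t = dprim_integrand (x, z.2) t.
  by move=> Ex t01; rewrite partial1of2E; have [_ ->] := dD0 x t Ex t01.
have Hder : forall x y : R, `]z.1 - d, z.1 + d[%classic x -> `]0, 1[%classic y ->
    derivable ((fun x t => D0 (upward (x, z.2) t)) ^~ y) x 1.
  by move=> x t /inI [Ex _]; rewrite /= in_itv /= => t01; case: (dD0 x t Ex t01).
have iM : lebesgue_measure.-integrable `]0, 1[ (EFin \o (cst (M + M * L) : measurableTypeR R -> R)).
  apply: measurable_bounded_integrable => //; first exact: unit_itv_lty.
  exists `|M + M * L|; split; first exact: num_real.
  by move=> N MN t /= _; rewrite ltW.
have L0 : 0 <= L by rewrite addr_ge0.
have Hub : forall x y : R, `]z.1 - d, z.1 + d[%classic x -> `]0, 1[%classic y ->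
   `|partial1of2 (fun x t => D0 (upward (x, z.2) t)) x y| <= cst (M + M * L) y.
  move=> x t /inI [Ex xL]; rewrite /= in_itv /= => t01; rewrite partial1E //.
  by rewrite (le_trans (dprim_integrand_le Ex t01)) // lerD2l ler_wpM2l // ltW.
have ML0 (y : R) : 0 <= cst (M + M * L) y by rewrite addr_ge0 // mulr_ge0.
have dF := derivable_under_integral mI Iz intf Hder ML0 iM Hub.
have eF := differentiation_under_integral mI Iz intf Hder ML0 iM Hub.
have dup : is_derive z.1 (1 : R) (fun s => upmean (fun z t => D0 (upward z t)) (s, z.2))
    (upmean dprim_integrand z).
  apply: DeriveDef; first exact: dF.
  rewrite -derive1E; apply: etrans eF _; apply: eq_Rintegral => t.
  rewrite inE /= in_itv /= => t01; rewrite partial1E -?surjective_pairing //.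
have dC := is_derive_Cu z1.
apply/is_derive_exE; rewrite /prim /=.
have dsub : is_derive z.1 (1 : R) (fun s => C s - z.2) (dCu z.1).
  by apply: is_derive_eq; rewrite subr0.
have /is_derive_eq := is_deriveM dsub dup; apply.
by rewrite /dprim /GRing.scale /= -surjective_pairing addrC mulrC.
Qed.

End primitive.
End ellipse_chords.

(** * The data and the limit solution inside the ellipse *)

Section segment_primitive.
Context {R : realType}.

Lemma segment_primitive (k : R -> R) (b c : R) : b < c ->
  {within `[b, c], continuous k} ->
  exists F : R -> R, [/\ {within `[b, c], continuous F},
    forall s : R, b < s < c -> is_derive s (1 : R) F (k s),
    F b = 0 & F c = \int[lebesgue_measure]_(s in `[b, c]) k s].
Proof.
move=> bc ck.
have ik : lebesgue_measure.-integrable `[b, c] (EFin \o k).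
  by apply: continuous_compact_integrable => //; exact: segment_compact.
exists (fun s : R => \int[lebesgue_measure]_(t in [set` `[b, s]]) k t); split=> //.
- by apply: parameterized_integral_continuous => //; exact: ltW.
- have [cki _ _] := (continuous_within_itvP k bc).1 ck.
  move=> s /andP[s1 s2]; have [|d1 d2] := continuous_FTC1_closed s2 ik s1 _.
    by apply: cki; rewrite in_itv /= s1.
  by apply: DeriveDef; [exact: d1|rewrite -derive1E].
- by rewrite set_itv1 Rintegral_set1.
Qed.

End segment_primitive.

Section closed_ellipse.
Context {R : realType}.
Implicit Types (h : R * R -> R) (z : R * R).

Lemma within_comp_path (T : topologicalType) (K : set T) (h : T -> R) (a b : R)
    (p : R -> T) :
  {within K, continuous h} -> (forall t, a <= t <= b -> K (p t)) ->
  continuous p -> {within `[a, b], continuous (fun t => h (p t))}.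
Proof.
move=> /subspace_continuousP ch pK cp; apply/subspace_continuousP => t.
rewrite /= in_itv /= => tab.
apply: cvg_trans (ch _ (pK _ tab)).
have H : p s @[s --> within `[a, b] (nbhs t)] --> within K (nbhs (p t)).
  move=> V nV.
  have nt : \forall s \near t, K (p s) -> V (p s) by exact: (cp t _ nV).
  change (\forall s \near t, `[a, b]%classic s -> V (p s)).
  by apply: filterS nt => s Vs; rewrite /= in_itv /= => /pK; exact: Vs.
by move=> V; apply: H.
Qed.

Lemma FTC_open01 (g g' : R -> R) : {within `[0, 1], continuous g} ->
  (forall t : R, 0 < t < 1 -> is_derive t (1 : R) g (g' t)) ->
  {within `[0, 1], continuous g'} ->
  \int[lebesgue_measure]_(t in `]0, 1[) g' t = g 1 - g 0.
Proof.
move=> cg dg cg'.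
have mg' : measurable_fun (`[0, 1]%classic : set (measurableTypeR R)) g'.
  exact: subspace_continuous_measurable_fun.
have [c0 c1 c2] := (continuous_within_itvP g (@ltr01 R)).1 cg.
have H := @continuous_FTC2 R g' g 0 1 ltr01 cg'.
rewrite /Rintegral -(@integral_itv_bndoo _ 0 1 (EFin \o g') true false).
  rewrite H //.
  - split=> // t; rewrite in_itv /= => t01; by case: (dg t t01).
  - by move=> t; rewrite in_itv /= => t01; rewrite derive1E; case: (dg t t01).
apply/measurable_EFinP; apply: measurable_funS mg' => //.
exact: subset_itv_oo_cc.
Qed.

Lemma lipschitz_segment (g g' : R -> R) (a b M : R) : a <= b ->
  (forall t, a < t < b -> is_derive t (1 : R) g (g' t) /\ `|g' t| <= M) ->
  {within `[a, b], continuous g} -> `|g b - g a| <= M * (b - a).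
Proof.
rewrite le_eqVlt => /predU1P[<- _ _|ab dg cg]; first by rewrite !subrr normr0 mulr0.
have [|c] := @MVT _ g g' a b ab _ cg.
  by move=> t; rewrite in_itv /= => /dg [].
rewrite in_itv /= => /dg [_ Hc] ->; rewrite normrM.
have ba : 0 <= b - a by lra.
by rewrite (ger0_norm ba) ler_wpM2r.
Qed.

Context {A B : R} (A0 : 0 < A) (B0 : 0 < B).
Local Notation E := (ellipse A B).
Local Notation C := (Cu A B).

(** A boundary point is the limit of its multiples by factors t < 1. *)
Lemma closure_ellipse z : z.1 ^+ 2 / A ^+ 2 + z.2 ^+ 2 / B ^+ 2 <= 1 -> closure E z.
Proof.
move=> zK V /ball_planeP [d d0 dV].
pose n := 1 + `|z.1| + `|z.2|.
have n1 : 0 <= `|z.1| by []. have n2 : 0 <= `|z.2| by [].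
have n0 : 0 < n by rewrite /n; lra.
pose e := Num.min 2^-1 (d / (2 * n)).
have e0 : 0 < e by rewrite lt_min invr_gt0 ltr0n divr_gt0 // mulr_gt0.
have e1 : e <= 2^-1 by rewrite ge_min lexx.
have e2 : e <= d / (2 * n) by rewrite ge_min lexx orbT.
have en : e * n < d.
  rewrite (le_lt_trans (ler_wpM2r (ltW n0) e2)) //.
  rewrite (_ : d / (2 * n) * n = d / 2); first lra.
  by field; rewrite gt_eqF.
exists ((1 - e) * z.1, (1 - e) * z.2); split.
  rewrite /ellipse /=.
  rewrite [ltLHS](_ : _ = (1 - e) ^+ 2 * (z.1 ^+ 2 / A ^+ 2 + z.2 ^+ 2 / B ^+ 2)); last by ring.
  apply: (@le_lt_trans _ _ ((1 - e) ^+ 2)).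
    by rewrite -[leRHS]mulr1 ler_wpM2l ?sqr_ge0.
  by rewrite expr_lt1 //; lra.
have de (x : R) : `|x| <= n -> `|(1 - e) * x - x| < d.
  move=> xn; rewrite (_ : _ - x = - (e * x)); last by ring.
  rewrite normrN normrM (gtr0_norm e0) (le_lt_trans _ en) //.
  by rewrite ler_wpM2l // ltW.
by apply: dV; apply: de; rewrite /n; lra.
Qed.

Lemma sub_closure_ellipse : E `<=` closure E.
Proof. exact: subset_closure. Qed.

Context (BA : B <= A).

Lemma ellipse_box : E `<=` (box A : set (R * R)).
Proof.
move=> z /(ellipse_bounds A0 B0) [z1 z2]; apply/boxP; split; first exact: ltW.
by rewrite (le_trans (ltW z2)).
Qed.

Lemma compact_closure_ellipse : compact (closure E).
Proof.
apply: (subclosed_compact _ (@compact_box R A)); first exact: closed_closure.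
have cb : closed (box A : set (R * R)).
  by apply: compact_closed; [exact: norm_hausdorff|exact: compact_box].
rewrite ((closure_id _).1 cb); apply: closureS; exact: ellipse_box.
Qed.

Lemma chord_closure x s : `|x| <= A -> `|s| <= C x -> closure E (x, s).
Proof.
move=> xA sC; apply: closure_ellipse => /=.
have b2 : 0 < B ^+ 2 by rewrite exprn_gt0.
have : s ^+ 2 <= C x ^+ 2.
  by rewrite -(real_normK (num_real s)) ler_sqr ?nnegrE ?Cu_ge0.
rewrite (Cu_sqr A0 xA) mulrC -ler_pdivrMr //; lra.
Qed.

Section data.
Context {N : nat} {f : R * R -> R} {D : nat -> nat -> R * R -> R}.
Context (N0 : (0 < N)%N) (fD : partials N E (closure E) f D).
Context (fA : D 0%N 0%N (A, 0) = 0) (fNA : D 0%N 0%N (- A, 0) = 0).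

Lemma partials_bounded p q : (p + q <= N)%N ->
  exists M, 0 < M /\ forall z, closure E z -> `|D p q z| <= M.
Proof.
move=> pq; apply: continuous_bounded_on; first exact: compact_closure_ellipse.
by have [_ + _] := fD; apply.
Qed.

Lemma data_C1 : C1on E (D 0%N 0%N) (D 1%N 0%N) (D 0%N 1%N).
Proof.
apply: (partials_C1on (p := 0%N) (q := 0%N) fD) => //.
  exact: open_ellipse.
exact: sub_closure_ellipse.
Qed.

(** The data are Lipschitz and vanish at (A, 0) and (- A, 0), so |f(x, y)| is at most a multiple
    of (A - |x|) + |y|, and both terms are dominated by C(x). *)
Lemma data_le_Cu : exists M K : R, [/\ 0 <= M, 0 <= K,
  forall z, E z -> `|D 0%N 0%N z| <= K * C z.1,
  forall z, E z -> `|D 1%N 0%N z| <= M &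
  forall z, E z -> `|D 0%N 1%N z| <= M].
Proof.
have [M1 [M10 HM1]] := @partials_bounded 1 0 N0.
have [M2 [M20 HM2]] := @partials_bounded 0 1 N0.
pose M := M1 + M2; have M0 : 0 <= M by rewrite /M; lra.
have cD : {within closure E, continuous (D 0%N 0%N)} by have [_ + _] := fD; apply.
have b1 z : E z -> `|D 1%N 0%N z| <= M.
  by move=> /sub_closure_ellipse /HM1 /le_trans; apply; rewrite /M; lra.
have b2 z : E z -> `|D 0%N 1%N z| <= M.
  by move=> /sub_closure_ellipse /HM2 /le_trans; apply; rewrite /M; lra.
exists M, (M * (1 + A / B)); split => //.
  by rewrite mulr_ge0 // addr_ge0 // divr_ge0 ?ltW.
(* the vertical increment is controlled by the bound on the y-derivative ... *)
have vert x s : `|x| < A -> `|s| < C x -> `|D 0%N 0%N (x, s) - D 0%N 0%N (x, 0)| <= M * `|s|.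
  move=> xA sC.
  have inE t : `|t| <= `|s| -> E (x, t).
    by move=> ts; apply/(ellipseE A0 B0); split => //=; exact: le_lt_trans sC.
  have dt t : `|t| <= `|s| -> is_derive t (1 : R) (fun t => D 0%N 0%N (x, t)) (D 0%N 1%N (x, t)) /\ `|D 0%N 1%N (x, t)| <= M.
    by move=> /inE Et; split; [have [_ /is_derive_eyE] := data_C1 Et|exact: b2].
  have ct (a b : R) : (forall t, a <= t <= b -> `|t| <= `|s|) ->
      {within `[a, b], continuous (fun t => D 0%N 0%N (x, t))}.
    move=> H; apply: derivable_within_continuous => t; rewrite in_itv /= => /H /dt [[] //].
  have [s0|s0] := leP 0 s.
    have H t : 0 <= t <= s -> `|t| <= `|s|.
      by move=> /andP[t0 t1]; rewrite !ger0_norm.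
    rewrite (_ : M * `|s| = M * (s - 0)); last by rewrite subr0 ger0_norm.
    apply: (lipschitz_segment (g' := fun t => D 0%N 1%N (x, t))) s0 _ (ct _ _ H).
    by move=> t /andP[t0 t1]; apply: dt; apply: H; rewrite !ltW.
  have H t : s <= t <= 0 -> `|t| <= `|s|.
    by move=> /andP[t0 t1]; rewrite !ler0_norm ?lerN2 // ltW.
  rewrite distrC (_ : M * `|s| = M * (0 - s)); last by rewrite sub0r ltr0_norm.
  apply: (lipschitz_segment (g' := fun t => D 0%N 1%N (x, t))) (ltW s0) _ (ct _ _ H).
  by move=> t /andP[t0 t1]; apply: dt; apply: H; rewrite !ltW.
have inE0 t : - A < t < A -> E (t, 0).
  move=> tA; have tA' : `|t| < A by rewrite ltr_norml.
  by apply/(ellipseE A0 B0); split => //=; rewrite normr0 Cu_gt0.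
have dt t : - A < t < A -> is_derive t (1 : R) (fun t => D 0%N 0%N (t, 0)) (D 1%N 0%N (t, 0)) /\ `|D 1%N 0%N (t, 0)| <= M.
  by move=> /inE0 Et; split; [have [/is_derive_exE] := data_C1 Et|exact: b1].
have ct (a b : R) : - A <= a -> b <= A ->
    {within `[a, b], continuous (fun t => D 0%N 0%N (t, 0))}.
  move=> aA bA; apply: (within_comp_path cD (p := fun t => (t, 0))).
    move=> t /andP[t1 t2]; apply: chord_closure; last by rewrite normr0 Cu_ge0.
    by rewrite ler_norml; apply/andP; split; lra.
  by move=> t; apply: continuous_at_pair => //; exact: cvg_cst.
(* ... and on the axis f is integrated from the nearer end point, where it is zero *)
have horiz x : `|x| < A -> `|D 0%N 0%N (x, 0)| <= M * (A - `|x|).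
  move=> xA; move: (xA); rewrite ltr_norml => /andP[x1 x2].
  have [x0|x0] := leP 0 x.
    have : `|D 0%N 0%N (A, 0) - D 0%N 0%N (x, 0)| <= M * (A - x).
      apply: (@lipschitz_segment (fun t => D 0%N 0%N (t, 0)) (fun t => D 1%N 0%N (t, 0))); first exact: ltW.
        by move=> t /andP[t1 t2]; apply: dt; apply/andP; split; lra.
      by apply: ct => //; lra.
    by rewrite fA sub0r normrN (ger0_norm x0).
  have : `|D 0%N 0%N (x, 0) - D 0%N 0%N (- A, 0)| <= M * (x - - A).
    apply: (@lipschitz_segment (fun t => D 0%N 0%N (t, 0)) (fun t => D 1%N 0%N (t, 0))); first exact: ltW.
      by move=> t /andP[t1 t2]; apply: dt; apply/andP; split; lra.
    by apply: ct => //; lra.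
  by rewrite fNA subr0 opprK (ltr0_norm x0) opprK addrC.
move=> [x s] /(ellipseE A0 B0) [/= xA sC].
have V := vert x s xA sC; have H := horiz x xA.
have C0 := Cu_gt0 A0 B0 xA; have CB : C x <= B := Cu_leB B0 x.
(* C is at least of the order of the square root of A - |x| *)
have AC : A - `|x| <= A / B * C x.
  have Cs : C x ^+ 2 * A ^+ 2 = B ^+ 2 * ((A - `|x|) * (A + `|x|)).
    rewrite (Cu_sqr A0 (ltW xA)) -subr_sqr real_normK ?num_real //.
    by field; rewrite gt_eqF.
  have nx : 0 <= `|x| by [].
  have ax : 0 <= A - `|x| by lra.
  have T1 : B ^+ 2 * ((A - `|x|) * A) <= C x ^+ 2 * A ^+ 2.
    by rewrite Cs ler_wpM2l ?sqr_ge0 // ler_wpM2l //; lra.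
  have T2 : C x ^+ 2 * A ^+ 2 <= (C x * B) * A ^+ 2.
    by rewrite ler_wpM2r ?sqr_ge0 // expr2 ler_wpM2l // ltW.
  have T3 : (A - `|x|) * (B ^+ 2 * A) <= (A / B * C x) * (B ^+ 2 * A).
    rewrite (_ : A / B * C x * _ = C x * B * A ^+ 2); last by field; rewrite gt_eqF.
    by rewrite (_ : _ * (B ^+ 2 * A) = B ^+ 2 * ((A - `|x|) * A)); [lra|ring].
  by rewrite ler_pM2r // mulr_gt0 // exprn_gt0 in T3.
have T4 : M * (A - `|x|) <= M * (A / B * C x) by rewrite ler_wpM2l.
have T5 : M * `|s| <= M * C x by rewrite ler_wpM2l // ltW.
have := ler_normD (D 0%N 0%N (x, s) - D 0%N 0%N (x, 0)) (D 0%N 0%N (x, 0)).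
rewrite subrK; lra.
Qed.

(** The fundamental theorem on the chord from z up to the boundary, where u0 vanishes. *)
Lemma limit_solution_prim u0 z : limit_solution A B f u0 -> E z ->
  u0 z = prim (A := A) (B := B) (D0 := D 0%N 0%N) z.
Proof.
move=> [cu0 du0 u0G _] Ez; have [z1 z2] := (ellipseE A0 B0 z).1 Ez.
have C0 := Cu_gt0 A0 B0 z1.
move: (z2); rewrite ltr_norml => /andP[z3 z4].
have cD : {within closure E, continuous (D 0%N 0%N)} by have [_ + _] := fD; apply.
have fD0 w : closure E w -> D 0%N 0%N w = f w by have [+ _ _] := fD; apply.
have Eup t : 0 <= t < 1 -> E (upward (A := A) (B := B) z t) by exact: upward_in.
have top : upward (A := A) (B := B) z 1 = (z.1, C z.1).
  by rewrite /upward mul1r addrCA subrr addr0.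
have Gtop : Gamma_plus A B (upward (A := A) (B := B) z 1).
  rewrite top; split => //; rewrite /ellipse_bd /= (Cu_sqr A0 (ltW z1)).
  by field; rewrite !gt_eqF.
have cup : continuous (fun t : R => upward (A := A) (B := B) z t).
  move=> t; change {for t, continuous (fun t : R => (z.1, z.2 + t * (C z.1 - z.2)))}.
  apply: continuous_at_pair; first by move=> ?; exact: cvg_cst.
  apply: cvgD; first exact: cvg_cst.
  by apply: cvgM => //; exact: cvg_cst.
have cg : {within `[0, 1], continuous (fun t => u0 (upward (A := A) (B := B) z t))}.
  apply: (within_comp_path cu0) cup => t /andP[t0]; rewrite le_eqVlt.
  by move=> /predU1P[->|t1]; [right|left; apply: Eup; rewrite t0].
have dg (t : R) : 0 < t < 1 -> is_derive t (1 : R) (fun t => u0 (upward (A := A) (B := B) z t))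
    (- (C z.1 - z.2) * D 0%N 0%N (upward (A := A) (B := B) z t)).
  move=> /andP[t0 t1]; have Eu : E (upward (A := A) (B := B) z t) by apply: Eup; rewrite ltW.
  have /is_derive_eyE /= d1 := du0 _ Eu.
  have d2 : is_derive t (1 : R) (fun t => z.2 + t * (C z.1 - z.2)) (C z.1 - z.2).
    by apply: is_derive_eq; rewrite /GRing.scale /=; ring.
  have d3 := is_derive1_comp (f := fun y => u0 (z.1, y)) (g := fun t => z.2 + t * (C z.1 - z.2)) d1 d2.
  rewrite fD0; last exact: sub_closure_ellipse.
  by have /is_derive_eq := d3; apply; rewrite mulrC mulrN mulNr.
have upK t : 0 <= t <= 1 -> closure E (upward (A := A) (B := B) z t).
  move=> /andP[t0]; rewrite le_eqVlt => /predU1P[->|t1].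
    by rewrite top; apply: chord_closure; [exact: ltW|rewrite ger0_norm // ltW].
  by apply: sub_closure_ellipse; apply: Eup; rewrite t0.
have cDu : {within `[0, 1], continuous (fun t => D 0%N 0%N (upward (A := A) (B := B) z t))}.
  exact: (within_comp_path cD).
have cg' : {within `[0, 1], continuous (fun t => - (C z.1 - z.2) * D 0%N 0%N (upward (A := A) (B := B) z t))}.
  by move=> t; apply: cvgM; [exact: cvg_cst|exact: cDu].
have := FTC_open01 cg dg cg'.
rewrite (u0G _ Gtop) sub0r.
have -> : upward (A := A) (B := B) z 0 = z by rewrite /upward mul0r addr0 -surjective_pairing.
rewrite RintegralZl //.
  by rewrite mulNr => /eqP; rewrite eqr_opp => /eqP <-.
have iDu : lebesgue_measure.-integrable `[0, 1]
    (EFin \o ((fun t => D 0%N 0%N (upward (A := A) (B := B) z t)) : R -> R^o)).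
  by apply: continuous_compact_integrable => //; exact: segment_compact.
by apply: integrableS iDu => //; exact: subset_itv_oo_cc.
Qed.

Lemma limit_solution_C1 u0 : limit_solution A B f u0 ->
  C1on E u0 (dprim (A := A) (B := B) (D0 := D 0%N 0%N) (D1 := D 1%N 0%N) (D2 := D 0%N 1%N))
    (fun z => - f z).
Proof.
move=> Lu z Ez; have [M [K [M0 K0 b0 b1 b2]]] := data_le_Cu.
have [d1 c1] := prim_C1 A0 B0 M0 K0 data_C1 b0 b1 b2 Ez.
have oE : open E := @open_ellipse R A B.
have nE : nbhs z E by exact: open_nbhs_nbhs.
have [cu0 du0 _ _] := Lu.
split.
- apply: near_eq_is_derive d1; apply: filterS nE => w Ew.
  by rewrite (limit_solution_prim Lu).
- exact: du0.
- by apply: (within_open_continuous_at oE) cu0 _ Ez => w; left.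
- exact: c1.
- apply: cvgN; have [_ _ cD _ _] := data_C1 Ez.
  apply: near_eq_continuous_at cD; apply: filterS nE => w Ew.
  by have [+ _ _] := fD; apply; exact: sub_closure_ellipse.
Qed.

End data.

Lemma C1on_reflect h h1 h2 : C1on E h h1 h2 ->
  C1on E (fun z => h (z.1, - z.2)) (fun z => h1 (z.1, - z.2))
    (fun z => - h2 (z.1, - z.2)).
Proof.
move=> Ch z Ez.
have Er : E (z.1, - z.2).
  by move: Ez; rewrite /ellipse /= sqrrN.
have [a1 a2 a3 a4 a5] := Ch _ Er.
have cr : {for z, continuous (fun z : R * R => (z.1, - z.2))}.
  by apply: continuous_at_pair; [exact: cvg_fst|apply: cvgN; exact: cvg_snd].
have comp k : {for (z.1, - z.2), continuous k} ->
    {for z, continuous (fun z : R * R => k (z.1, - z.2) : R)}.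
  by move=> ck; apply: (@continuous_comp _ _ _ (fun z : R * R => (z.1, - z.2)) k).
split.
- by apply/is_derive_exE; move/is_derive_exE : a1.
- apply/is_derive_eyE; move/is_derive_eyE : a2 => /= a2.
  have dN : is_derive z.2 (1 : R) (fun s : R => - s) (- 1) by exact: is_deriveNid.
  by have /is_derive_eq := is_derive1_comp (f := fun y => h (z.1, y)) a2 dN; apply; rewrite mulrN1.
- exact: comp.
- exact: comp.
- by apply: cvgN; exact: comp.
Qed.

(** The two halves of the chord are mapped to the upper one, so that the integral over the whole
    chord becomes prim of the even part of f on the major axis, with its C^1 estimates. *)
Lemma chord_integral (f g : R * R -> R) x : `|x| < A ->
  {within closure E, continuous g} -> (forall z, closure E z -> g z = f z) ->
  \int[lebesgue_measure]_(s in `[- C x, C x]) f (x, s) =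
  prim (A := A) (B := B) (D0 := fun z => g z + g (z.1, - z.2)) (x, 0).
Proof.
move=> xA cg gf; have C0 := Cu_gt0 A0 B0 xA.
pose k s := g (x, s).
have xs s : - C x <= s <= C x -> closure E (x, s).
  by move=> sC; apply: chord_closure; rewrite ?(ltW xA) // ler_norml.
have CC : - C x < C x by lra.
have ck : {within `[- C x, C x], continuous k}.
  exact: (within_comp_path cg xs (@continuous_vertical R x)).
have [F [cF dF F0 FC]] := segment_primitive CC ck.
have -> : \int[lebesgue_measure]_(s in `[- C x, C x]) f (x, s) = F (C x).
  rewrite FC; apply: eq_Rintegral => s; rewrite inE /= in_itv /= => /xs /gf.
  by rewrite /k => ->.
have lin (c : R) : continuous (fun t : R => t * c).
  by move=> t; apply: cvgM => //; exact: cvg_cst.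
have dlin (c t : R) : is_derive t (1 : R) (fun t : R => t * c) c.
  by apply: is_derive_eq; rewrite /GRing.scale /=; ring.
have tC t : 0 <= t <= 1 -> - C x <= t * C x <= C x /\ - C x <= t * (- C x) <= C x.
  move=> /andP[t0 t1]; have a1 : 0 <= t * C x by rewrite mulr_ge0 // ltW.
  have a2 : t * C x <= 1 * C x by rewrite ler_wpM2r // ltW.
  by split; apply/andP; split; lra.
have tC' t : 0 < t < 1 -> - C x < t * C x < C x /\ - C x < t * (- C x) < C x.
  move=> /andP[t0 t1]; have a1 : 0 < t * C x by rewrite mulr_gt0.
  have a2 : t * C x < 1 * C x by rewrite ltr_pM2r.
  by split; apply/andP; split; lra.
pose G t := F (t * C x) - F (t * (- C x)).
have cG : {within `[0, 1], continuous G}.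
  move=> t; apply: cvgB.
    apply: (within_comp_path cF _ (lin (C x))) => {}t /tC [H _].
    by rewrite /= in_itv.
  apply: (within_comp_path cF _ (lin (- C x))) => {}t /tC [_ H].
  by rewrite /= in_itv.
have dG (t : R) : 0 < t < 1 -> is_derive t (1 : R) G (C x * (k (t * C x) + k (t * (- C x)))).
  move=> /tC' [/dF d1 /dF d2].
  have e1 := is_derive1_comp (f := F) (g := fun t => t * C x) d1 (dlin (C x) t).
  have e2 := is_derive1_comp (f := F) (g := fun t => t * (- C x)) d2 (dlin (- C x) t).
  have /is_derive_eq := is_deriveB e1 e2; apply; ring.
have ckk : {within `[0, 1], continuous (fun t => k (t * C x) + k (t * (- C x)))}.
  move=> t; apply: cvgD.
    apply: (within_comp_path ck _ (lin (C x))) => {}t /tC [H _].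
    by rewrite /= in_itv.
  apply: (within_comp_path ck _ (lin (- C x))) => {}t /tC [_ H].
  by rewrite /= in_itv.
have cG' : {within `[0, 1], continuous (fun t => C x * (k (t * C x) + k (t * (- C x))))}.
  by move=> t; apply: cvgM; [exact: cvg_cst|exact: ckk].
have := FTC_open01 cG dG cG'.
rewrite /G !mul1r F0 !mul0r subrr !subr0 => <-.
rewrite /prim /upmean /= RintegralZl //.
  rewrite subr0; congr (_ * _); apply: eq_Rintegral => t _.
  by rewrite /upward /= subr0 add0r /k mulrN.
have ikk : lebesgue_measure.-integrable `[0, 1]
    (EFin \o ((fun t => k (t * C x) + k (t * (- C x))) : R -> R^o)).
  by apply: continuous_compact_integrable => //; exact: segment_compact.
by apply: integrableS ikk => //; exact: subset_itv_oo_cc.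
Qed.

End closed_ellipse.

(** * Elliptic coordinates on the lower half plane *)

Section hyperbolic.
Context {R : realType}.
Implicit Types (x y P : R).

Lemma coshR_sinhR x : coshR x ^+ 2 - sinhR x ^+ 2 = 1.
Proof.
rewrite /coshR /sinhR expRN; have := expR_gt0 x => e0.
by field; rewrite gt_eqF.
Qed.

(** Convexity of cosh, in the form e^t >= 1 + t for t = y - x and t = x - y. *)
Lemma coshR_tangent x y : coshR x + sinhR x * (y - x) <= coshR y.
Proof.
have e1 := expR_ge1Dx (y - x); have e2 := expR_ge1Dx (- (y - x)).
have E1 : expR y = expR x * expR (y - x) by rewrite -expRD addrC subrK.
have E2 : expR (- y) = expR (- x) * expR (- (y - x)).
  by rewrite -expRD; congr expR; ring.
have p1 := expR_gt0 x; have p2 := expR_gt0 (- x).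
have f1 : expR x * (1 + (y - x)) <= expR y by rewrite E1 ler_wpM2l // ltW.
have f2 : expR (- x) * (1 - (y - x)) <= expR (- y) by rewrite E2 ler_wpM2l // ltW.
by rewrite /coshR /sinhR; lra.
Qed.

Lemma sinhR_le x y : x <= y -> sinhR x <= sinhR y.
Proof.
move=> xy; have : expR x <= expR y by rewrite ler_expR.
have : expR (- y) <= expR (- x) by rewrite ler_expR lerN2.
by rewrite /sinhR; lra.
Qed.

Lemma sinhR_gt0 x : 0 < x -> 0 < sinhR x.
Proof.
move=> x0; have : expR (- x) < expR x by rewrite ltr_expR; lra.
by rewrite /sinhR; lra.
Qed.

Definition arcosh P := ln (P + Num.sqrt (P ^+ 2 - 1)).

Lemma arcosh_arg P : 1 <= P ->
  (P + Num.sqrt (P ^+ 2 - 1)) * (P - Num.sqrt (P ^+ 2 - 1)) = 1 /\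
  1 <= P + Num.sqrt (P ^+ 2 - 1).
Proof.
move=> P1; have s0 := sqrtr_ge0 (P ^+ 2 - 1); split; last by lra.
rewrite mulrC -subr_sqr sqr_sqrtr; first ring.
by rewrite subr_ge0 -[leLHS](expr1n _ 2) ler_sqr ?nnegrE //; lra.
Qed.

Lemma coshR_arcosh P : 1 <= P -> coshR (arcosh P) = P.
Proof.
move=> P1; have [v1 v0] := arcosh_arg P1.
have vp : 0 < P + Num.sqrt (P ^+ 2 - 1) by lra.
rewrite /coshR /arcosh expRN lnK ?posrE //.
have -> : (P + Num.sqrt (P ^+ 2 - 1))^-1 = P - Num.sqrt (P ^+ 2 - 1).
  apply: (@mulfI _ (P + Num.sqrt (P ^+ 2 - 1))); first by rewrite gt_eqF.
  by rewrite v1 mulfV // gt_eqF.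
by field.
Qed.

Lemma sinhR_arcosh P : 1 <= P -> sinhR (arcosh P) = Num.sqrt (P ^+ 2 - 1).
Proof.
move=> P1; have [v1 v0] := arcosh_arg P1.
have vp : 0 < P + Num.sqrt (P ^+ 2 - 1) by lra.
rewrite /sinhR /arcosh expRN lnK ?posrE //.
have -> : (P + Num.sqrt (P ^+ 2 - 1))^-1 = P - Num.sqrt (P ^+ 2 - 1).
  apply: (@mulfI _ (P + Num.sqrt (P ^+ 2 - 1))); first by rewrite gt_eqF.
  by rewrite v1 mulfV // gt_eqF.
by field.
Qed.

Lemma arcosh_coshR (x : R) : 0 <= x -> arcosh (coshR x) = x.
Proof.
move=> x0; rewrite /arcosh.
have -> : coshR x ^+ 2 - 1 = sinhR x ^+ 2 by rewrite -(coshR_sinhR x); ring.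
rewrite sqrtr_sqr ger0_norm.
  by rewrite (_ : coshR x + sinhR x = expR x) ?expRK // /coshR /sinhR; field.
by have := sinhR_le x0; rewrite {1}/sinhR oppr0 subrr mul0r.
Qed.

Lemma arcosh_ge0 P : 1 <= P -> 0 <= arcosh P.
Proof. by move=> P1; have [_ v0] := arcosh_arg P1; exact: ln_ge0. Qed.

Lemma sqrm1_gt0 P : 1 < P -> 0 < P ^+ 2 - 1.
Proof. by move=> P1; rewrite subr_gt0 expr_gt1 //; lra. Qed.

Lemma arcosh_gt0 P : 1 < P -> 0 < arcosh P.
Proof.
move=> P1; apply: ln_gt0.
have : 0 < Num.sqrt (P ^+ 2 - 1) by rewrite sqrtr_gt0 sqrm1_gt0.
lra.
Qed.

Lemma is_derive_arcosh P : 1 < P ->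
  is_derive P (1 : R) arcosh (Num.sqrt (P ^+ 2 - 1))^-1.
Proof.
move=> P1; have p0 := sqrm1_gt0 P1.
have s0 : 0 < Num.sqrt (P ^+ 2 - 1) by rewrite sqrtr_gt0.
have v0 : 0 < P + Num.sqrt (P ^+ 2 - 1) by lra.
have d1 : is_derive P (1 : R) (fun P : R => P ^+ 2 - 1) (2 * P).
  by apply: is_derive_eq; rewrite /GRing.scale /=; ring.
have d2 := is_derive1_comp (g := fun P : R => P ^+ 2 - 1) (is_derive1_sqrt p0) d1.
have d3 := is_deriveD (is_derive_id P (1 : R)) d2.
have d4 := is_derive1_comp (f := @ln R) (g := fun P : R => P + Num.sqrt (P ^+ 2 - 1))
  (is_derive1_ln v0) d3.
have /is_derive_eq := d4; apply.
by field; rewrite !gt_eqF.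
Qed.

Lemma continuous_arcosh' P : 1 < P ->
  {for P, continuous (fun P => (Num.sqrt (P ^+ 2 - 1))^-1)}.
Proof.
move=> P1; have s0 : Num.sqrt (P ^+ 2 - 1) != 0.
  by rewrite gt_eqF // sqrtr_gt0 sqrm1_gt0.
apply: (@continuous_comp _ _ _ (fun P => Num.sqrt (P ^+ 2 - 1)) GRing.inv).
  apply: (@continuous_comp _ _ _ (fun P : R => P ^+ 2 - 1) Num.sqrt).
    by apply: cvgB; [exact: exprn_continuous|exact: cvg_cst].
  exact: sqrt_continuous.
exact: inv_continuous.
Qed.

End hyperbolic.

Section elliptic_coordinates.
Context {R : realType} {a : R} (a0 : 0 < a).
Implicit Types (z : R * R).

Lemma C1on_V (U : set (R * R)) (h h1 h2 : R * R -> R) : C1on U h h1 h2 ->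
  (forall z, U z -> h z != 0) ->
  C1on U (fun z => (h z)^-1) (fun z => - (h z) ^- 2 * h1 z) (fun z => - (h z) ^- 2 * h2 z).
Proof.
move=> Ch h0; apply: (@C1on_comp _ U h h1 h2 GRing.inv (fun t => - t ^- 2) Ch) => z Uz.
have hz := h0 z Uz; split.
  have := is_deriveV hz (is_derive_id (h z) (1 : R)).
  by move/is_derive_eq; apply; rewrite /GRing.scale /= mulr1.
apply: cvgN; apply: (@continuous_comp _ _ _ (fun t : R => t ^+ 2) GRing.inv).
  exact: exprn_continuous.
by apply: inv_continuous; rewrite expf_neq0.
Qed.

Lemma C1on_sqrt (U : set (R * R)) (h h1 h2 : R * R -> R) : C1on U h h1 h2 ->
  (forall z, U z -> 0 < h z) ->
  C1on U (fun z => Num.sqrt (h z)) (fun z => (2 * Num.sqrt (h z))^-1 * h1 z)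
   (fun z => (2 * Num.sqrt (h z))^-1 * h2 z).
Proof.
move=> Ch h0; apply: (@C1on_comp _ U h h1 h2 Num.sqrt (fun t => (2 * Num.sqrt t)^-1) Ch) => z Uz.
have hz := h0 z Uz; split; first exact: is_derive1_sqrt.
apply: (@continuous_comp _ _ _ (fun t : R => 2 * Num.sqrt t) GRing.inv).
  by apply: cvgM; [exact: cvg_cst|exact: sqrt_continuous].
by apply: inv_continuous; rewrite mulf_neq0 // gt_eqF // sqrtr_gt0.
Qed.

Definition focal c z := Num.sqrt ((z.1 - c) ^+ 2 + z.2 ^+ 2).

(** cosh r and cos tau are half the sum and half the difference of the distances to the foci,
    divided by a. With these formulas no inverse of the coordinate map has to be constructed or
    differentiated. *)
Definition ell_p z := (focal (- a) z + focal a z) / (2 * a).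
Definition ell_q z := (focal (- a) z - focal a z) / (2 * a).
(** On the lower half plane this is - sin tau, and ell_h is sinh r. *)
Definition ell_s z := Num.sqrt (1 - ell_q z ^+ 2).
Definition ell_h z := Num.sqrt (ell_p z ^+ 2 - 1).
Definition ell_r z := arcosh (ell_p z).

Lemma focal_sqr c z : focal c z ^+ 2 = (z.1 - c) ^+ 2 + z.2 ^+ 2.
Proof. by rewrite sqr_sqrtr // addr_ge0 ?sqr_ge0. Qed.

Lemma focal_ge c z : `|z.1 - c| <= focal c z.
Proof. by rewrite -sqrtr_sqr ler_wsqrtr // lerDl sqr_ge0. Qed.

Lemma focal_pq z : focal (- a) z = a * (ell_p z + ell_q z) /\
  focal a z = a * (ell_p z - ell_q z).
Proof. by rewrite /ell_p /ell_q; split; field; rewrite gt_eqF. Qed.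

Lemma ell_x z : z.1 = a * ell_p z * ell_q z.
Proof.
have := focal_sqr (- a) z; have := focal_sqr a z; rewrite opprK => e1 e2.
rewrite /ell_p /ell_q.
rewrite (_ : a * _ * _ = (focal (- a) z ^+ 2 - focal a z ^+ 2) / (4 * a)).
  by rewrite e1 e2; field; rewrite gt_eqF.
by field; rewrite gt_eqF.
Qed.

Lemma ell_y z : z.2 ^+ 2 = a ^+ 2 * (ell_p z ^+ 2 - 1) * (1 - ell_q z ^+ 2).
Proof.
have := focal_sqr (- a) z; have [-> _] := focal_pq z; rewrite opprK [in X in X -> _]ell_x.
lra.
Qed.

Lemma ell_p_ge1 z : 1 <= ell_p z.
Proof.
rewrite /ell_p ler_pdivlMr ?mulr_gt0 // mul1r.
have f1 := focal_ge (- a) z; have f2 := focal_ge a z; rewrite opprK in f1.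
have := ler_norm (z.1 + a); have := ler_norm (- (z.1 - a)); rewrite normrN; lra.
Qed.

Lemma ell_q_sqr_le1 z : ell_q z ^+ 2 <= 1.
Proof.
have := ell_p_ge1 z; rewrite le_eqVlt => /predU1P[p1|p1]; last first.
  have p0 := sqrm1_gt0 p1.
  have : 0 <= a ^+ 2 * (ell_p z ^+ 2 - 1) * (1 - ell_q z ^+ 2) by rewrite -ell_y sqr_ge0.
  by rewrite pmulr_rge0 ?subr_ge0 // mulr_gt0 // exprn_gt0.
have [e1 e2] := focal_pq z.
have f1 : 0 <= focal (- a) z by rewrite sqrtr_ge0.
have f2 : 0 <= focal a z by rewrite sqrtr_ge0.
rewrite e1 -p1 pmulr_rge0 // in f1; rewrite e2 -p1 pmulr_rge0 // in f2.
by rewrite -subr_ge0 (_ : 1 - _ = (1 + ell_q z) * (1 - ell_q z)); [rewrite mulr_ge0|ring].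
Qed.

Lemma focal_ge_snd c z : `|z.2| <= focal c z.
Proof. by rewrite -sqrtr_sqr ler_wsqrtr // lerDr sqr_ge0. Qed.

Lemma continuous_focal c : continuous (focal c).
Proof.
move=> z; apply: (@continuous_comp _ _ _ (fun z : R * R => (z.1 - c) ^+ 2 + z.2 ^+ 2) Num.sqrt).
  apply: cvgD; last exact: continuous_sqr_snd.
  apply: (@continuous_comp _ _ _ (fun z : R * R => z.1 - c) (fun x => x ^+ 2)).
    by apply: cvgB; [exact: cvg_fst|exact: cvg_cst].
  exact: exprn_continuous.
exact: sqrt_continuous.
Qed.

Lemma continuous_ell_p : continuous ell_p.
Proof. by move=> z; apply: cvgM; [apply: cvgD; exact: continuous_focal|exact: cvg_cst]. Qed.

Lemma continuous_ell_q : continuous ell_q.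
Proof. by move=> z; apply: cvgM; [apply: cvgB; exact: continuous_focal|exact: cvg_cst]. Qed.

Lemma continuous_ell_r z : 1 < ell_p z -> {for z, continuous ell_r}.
Proof.
move=> p1; apply: (@continuous_comp _ _ _ ell_p (@arcosh R)); first exact: continuous_ell_p.
apply: differentiable_continuous; apply/derivable1_diffP.
by case: (is_derive_arcosh p1).
Qed.

Definition lower : set (R * R) := [set z | z.2 < 0].

Lemma open_lower : open lower.
Proof.
rewrite openE => z Lz; apply: (@near_lt_at _ _ (fun z : R * R => z.2)) Lz.
exact: cvg_snd.
Qed.

Lemma ell_s_sqr z : ell_s z ^+ 2 = 1 - ell_q z ^+ 2.
Proof. by rewrite sqr_sqrtr // subr_ge0 ell_q_sqr_le1. Qed.

Lemma ell_h_sqr z : ell_h z ^+ 2 = ell_p z ^+ 2 - 1.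
Proof.
rewrite sqr_sqrtr // subr_ge0 -[leLHS](expr1n _ 2) ler_sqr ?nnegrE //.
  exact: ell_p_ge1.
by rewrite (le_trans _ (ell_p_ge1 z)).
Qed.

Lemma lower_facts z : lower z ->
  [/\ 1 < ell_p z, ell_q z ^+ 2 < 1, 0 < ell_h z, 0 < ell_s z &
      z.2 = - (a * ell_h z * ell_s z)].
Proof.
move=> Lz; have y0 : 0 < z.2 ^+ 2 by rewrite exprn_even_gt0 //= lt_eqF.
have P1 := ell_p_ge1 z; have Q1 := ell_q_sqr_le1 z.
have a2 : 0 < a ^+ 2 by rewrite exprn_gt0.
have p1 : 1 < ell_p z.
  rewrite lt_neqAle P1 andbT; apply/eqP => p1.
  by move: y0; rewrite ell_y -p1 expr1n subrr mulr0 mul0r ltxx.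
have q1 : ell_q z ^+ 2 < 1.
  rewrite lt_neqAle Q1 andbT; apply/eqP => q1.
  by move: y0; rewrite ell_y q1 subrr mulr0 ltxx.
have h0 : 0 < ell_h z by rewrite sqrtr_gt0 sqrm1_gt0.
have s0 : 0 < ell_s z by rewrite sqrtr_gt0 subr_gt0.
split => //; apply: oppr_inj; rewrite opprK; apply/eqP.
have y1 : 0 <= - z.2 by rewrite oppr_ge0 ltW.
have y2 : 0 <= a * ell_h z * ell_s z by rewrite !mulr_ge0 // ltW.
rewrite -(eqrXn2 (_ : 0 < 2)%N y1 y2) // sqrrN ell_y -ell_h_sqr -ell_s_sqr.
by apply/eqP; ring.
Qed.

Definition focal_x c z := (z.1 - c) / focal c z.
Definition focal_y c z := z.2 / focal c z.
Definition focal_xy c z := - ((z.1 - c) * z.2) / focal c z ^+ 3.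
Definition focal_xx c z := z.2 ^+ 2 / focal c z ^+ 3.
Definition focal_yy c z := (z.1 - c) ^+ 2 / focal c z ^+ 3.

Lemma focal_gt0 c z : lower z -> 0 < focal c z.
Proof.
move=> Lz; rewrite sqrtr_gt0 ltr_wpDl ?sqr_ge0 // exprn_even_gt0 //= lt_eqF //.
Qed.

Lemma focal_grad_le1 c z : lower z -> `|focal_x c z| <= 1 /\ `|focal_y c z| <= 1.
Proof.
move=> /(focal_gt0 c) f0.
by split; rewrite normrM normfV (gtr0_norm f0) ler_pdivrMr // mul1r ?focal_ge ?focal_ge_snd.
Qed.

Lemma C1on_shift (U : set (R * R)) c : C1on U (fun z => z.1 - c) (fun=> 1 - 0) (fun=> 0 - 0).
Proof. exact: (C1on_D (@C1on_fst R U) (C1on_N (@C1on_cst R U c))). Qed.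

Lemma C1on_focal c : C1on lower (focal c) (focal_x c) (focal_y c).
Proof.
have Cs := @C1on_shift lower c.
have C2 := C1on_D (C1on_M Cs Cs) (C1on_M (@C1on_snd R lower) (@C1on_snd R lower)).
have pos z : lower z -> 0 < (z.1 - c) * (z.1 - c) + z.2 * z.2.
  by move=> Lz; have := focal_gt0 c Lz; rewrite sqrtr_gt0 !expr2.
apply: (C1on_eq open_lower (C1on_sqrt C2 pos)) => z Lz.
- by rewrite /focal !expr2.
- have f0 := focal_gt0 c Lz; move: f0; rewrite /focal_x /focal !expr2 => f0.
  by field; rewrite gt_eqF.
- have f0 := focal_gt0 c Lz; move: f0; rewrite /focal_y /focal !expr2 => f0.
  by field; rewrite gt_eqF.
Qed.

Lemma C1on_focal_x c : C1on lower (focal_x c) (focal_xx c) (focal_xy c).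
Proof.
have f0 z : lower z -> focal c z != 0 by move=> Lz; rewrite gt_eqF // focal_gt0.
apply: (C1on_eq open_lower (C1on_M (@C1on_shift lower c) (C1on_V (C1on_focal c) f0))) => z Lz.
- by [].
- rewrite /focal_xx (_ : z.2 ^+ 2 = focal c z ^+ 2 - (z.1 - c) ^+ 2).
    by rewrite /focal_x; field; exact: f0.
  by rewrite focal_sqr; ring.
- by rewrite /focal_xy /focal_y; field; exact: f0.
Qed.

Lemma C1on_focal_y c : C1on lower (focal_y c) (focal_xy c) (focal_yy c).
Proof.
have f0 z : lower z -> focal c z != 0 by move=> Lz; rewrite gt_eqF // focal_gt0.
apply: (C1on_eq open_lower (C1on_M (@C1on_snd R lower) (C1on_V (C1on_focal c) f0))) => z Lz.
- by [].
- by rewrite /focal_xy /focal_x; field; exact: f0.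
- rewrite /focal_yy (_ : (z.1 - c) ^+ 2 = focal c z ^+ 2 - z.2 ^+ 2).
    by rewrite /focal_y; field; exact: f0.
  by rewrite focal_sqr; ring.
Qed.

Definition ell_px z := (focal_x (- a) z + focal_x a z) / (2 * a).
Definition ell_py z := (focal_y (- a) z + focal_y a z) / (2 * a).
Definition ell_qx z := (focal_x (- a) z - focal_x a z) / (2 * a).
Definition ell_qy z := (focal_y (- a) z - focal_y a z) / (2 * a).
Definition ell_qxx z := (focal_xx (- a) z - focal_xx a z) / (2 * a).
Definition ell_qxy z := (focal_xy (- a) z - focal_xy a z) / (2 * a).
Definition ell_qyy z := (focal_yy (- a) z - focal_yy a z) / (2 * a).
Definition ell_rx z := ell_px z / ell_h z.
Definition ell_ry z := ell_py z / ell_h z.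
Definition ell_sx z := - (ell_q z / ell_s z) * ell_qx z.
Definition ell_sy z := - (ell_q z / ell_s z) * ell_qy z.

Lemma C1on_scale (U : set (R * R)) (h h1 h2 : R * R -> R) c : C1on U h h1 h2 ->
  C1on U (fun z => h z / c) (fun z => h1 z / c) (fun z => h2 z / c).
Proof.
move=> Ch z Uz; have [] := C1on_M Ch (@C1on_cst R U c^-1) Uz.
have E (k : R * R -> R) : (fun z => k z / c + h z * 0) = (fun z => k z / c).
  by apply/funext => w; rewrite mulr0 addr0.
by rewrite !E !mulr0 !addr0; split.
Qed.

Lemma C1on_ell_p : C1on lower ell_p ell_px ell_py.
Proof. by apply: C1on_scale; apply: C1on_D; exact: C1on_focal. Qed.

Lemma C1on_ell_q : C1on lower ell_q ell_qx ell_qy.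
Proof. by apply: C1on_scale; apply: C1on_D; [|apply: C1on_N]; exact: C1on_focal. Qed.

Lemma C1on_ell_qx : C1on lower ell_qx ell_qxx ell_qxy.
Proof. by apply: C1on_scale; apply: C1on_D; [|apply: C1on_N]; exact: C1on_focal_x. Qed.

Lemma C1on_ell_qy : C1on lower ell_qy ell_qxy ell_qyy.
Proof. by apply: C1on_scale; apply: C1on_D; [|apply: C1on_N]; exact: C1on_focal_y. Qed.

Lemma C1on_ell_r : C1on lower ell_r ell_rx ell_ry.
Proof.
have H z : lower z -> is_derive (ell_p z) (1 : R) (@arcosh R) (Num.sqrt (ell_p z ^+ 2 - 1))^-1 /\
    {for ell_p z, continuous (fun P : R => (Num.sqrt (P ^+ 2 - 1))^-1)}.
  move=> /lower_facts [p1 _ _ _ _]; split; first exact: is_derive_arcosh.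
  exact: continuous_arcosh'.
apply: (C1on_eq open_lower (@C1on_comp _ _ _ _ _ (@arcosh R) (fun P : R => (Num.sqrt (P ^+ 2 - 1))^-1) C1on_ell_p H)) => z Lz //.
- by rewrite mulrC.
- by rewrite mulrC.
Qed.

Lemma C1on_ell_s : C1on lower ell_s ell_sx ell_sy.
Proof.
have C2 := C1on_D (@C1on_cst R lower 1) (C1on_N (C1on_M C1on_ell_q C1on_ell_q)).
have pos z : lower z -> 0 < 1 - ell_q z * ell_q z.
  by move=> /lower_facts [_ q1 _ _ _]; rewrite -expr2 subr_gt0.
apply: (C1on_eq open_lower (C1on_sqrt C2 pos)) => z Lz.
- by rewrite /ell_s expr2.
- have [_ _ _ s0 _] := lower_facts Lz; move: s0; rewrite /ell_sx /ell_s expr2 => s0.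
  by field; rewrite gt_eqF.
- have [_ _ _ s0 _] := lower_facts Lz; move: s0; rewrite /ell_sy /ell_s expr2 => s0.
  by field; rewrite gt_eqF.
Qed.

(** r and tau are conjugate harmonic functions: on the lower half plane s grad r is the gradient
    of q turned by a right angle. The last identity comes from differentiating x = a p q. *)
Lemma ell_conjugate z : lower z ->
  [/\ ell_s z * ell_rx z = ell_qy z, ell_s z * ell_ry z = - ell_qx z &
      ell_ry z = - (a * ell_p z * ell_s z * (ell_rx z ^+ 2 + ell_ry z ^+ 2))].
Proof.
move=> Lz; have [p1 q1 h0 s0 yE] := lower_facts Lz.
have dm0 := focal_gt0 (- a) Lz; have dp0 := focal_gt0 a Lz.
have [em ep] := focal_pq z.
set m := focal (- a) z in dm0 em *; set d := focal a z in dp0 ep *.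
have pE : ell_p z = (m + d) / (2 * a) by [].
have qE : ell_q z = (m - d) / (2 * a) by [].
have xE : z.1 = (m ^+ 2 - d ^+ 2) / (4 * a).
  by rewrite ell_x pE qE; field; rewrite gt_eqF.
have hE := ell_h_sqr z.
have nz : (a != 0) && (m != 0) && (d != 0) && (ell_h z != 0) by rewrite !gt_eqF.
move/andP : nz => [/andP[/andP[na nm] nd] nh].
have pxE : ell_px z = ((z.1 + a) / m + (z.1 - a) / d) / (2 * a).
  by rewrite /ell_px /focal_x opprK.
have qxE : ell_qx z = ((z.1 + a) / m - (z.1 - a) / d) / (2 * a).
  by rewrite /ell_qx /focal_x opprK.
have pyE : ell_py z = (z.2 / m + z.2 / d) / (2 * a) by [].
have qyE : ell_qy z = (z.2 / m - z.2 / d) / (2 * a) by [].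
have yN : - z.2 = a * ell_h z * ell_s z by rewrite yE opprK.
have I1 : ell_s z * ell_rx z = ell_qy z.
  have : ell_qy z * (a * ell_h z ^+ 2) = - z.2 * ell_px z.
    by rewrite hE pxE qyE pE xE; field; rewrite na nm nd.
  rewrite /ell_rx yN => H.
  apply: (mulIf (_ : a * ell_h z ^+ 2 != 0)).
    by rewrite mulf_neq0 // expf_neq0.
  by rewrite H; field.
have I2 : ell_s z * ell_ry z = - ell_qx z.
  have : - ell_qx z * (a * ell_h z ^+ 2) = - z.2 * ell_py z.
    have -> : - z.2 * ell_py z = - (z.2 ^+ 2) * ((m^-1 + d^-1) / (2 * a)).
      by rewrite pyE; ring.
    by rewrite ell_y hE qxE pE qE xE; field; rewrite na nm nd.
  rewrite /ell_ry yN => H.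
  apply: (mulIf (_ : a * ell_h z ^+ 2 != 0)).
    by rewrite mulf_neq0 // expf_neq0.
  by rewrite H; field.
split => //.
have J1 : ell_px z * ell_q z + ell_p z * ell_qx z = a^-1.
  by rewrite pxE qxE pE qE; field; rewrite na nm nd.
have J2 : ell_py z * ell_q z + ell_p z * ell_qy z = 0.
  by rewrite pyE qyE pE qE; field; rewrite na nm nd.
have K1 : ell_px z = ell_h z * ell_rx z by rewrite /ell_rx; field.
have K2 : ell_py z = ell_h z * ell_ry z by rewrite /ell_ry; field.
rewrite K1 (_ : ell_qx z = - (ell_s z * ell_ry z)) in J1; last by rewrite I2 opprK.
rewrite K2 -I1 in J2.
have := congr1 (fun t => a * (ell_ry z * t)) J1.
have := congr1 (fun t => a * (ell_rx z * t)) J2.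
rewrite (_ : a * (ell_ry z * a^-1) = ell_ry z); last by field.
by move=> e1 e2; rewrite -[LHS]e2; lra.
Qed.

(** grad p is bounded by 1 / a since distances have slope at most one; dividing by h gives grad r,
    and the conjugacy relations then give the extra factor s for grad q. *)
Lemma ell_grad_bounds z : lower z ->
  [/\ `|ell_rx z| <= (a * ell_h z)^-1, `|ell_ry z| <= (a * ell_h z)^-1,
      `|ell_qx z| <= ell_s z * (a * ell_h z)^-1 & `|ell_qy z| <= ell_s z * (a * ell_h z)^-1].
Proof.
move=> Lz; have [p1 q1 h0 s0 yE] := lower_facts Lz.
have [I1 I2 _] := ell_conjugate Lz.
have fx c := (focal_grad_le1 c Lz).1; have fy c := (focal_grad_le1 c Lz).2.
have sum (u v : R) : `|u| <= 1 -> `|v| <= 1 -> `|(u + v) / (2 * a) / ell_h z| <= (a * ell_h z)^-1.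
  move=> u1 v1; rewrite !normrM !normfV (gtr0_norm h0) (gtr0_norm (_ : 0 < 2 * a)) ?mulr_gt0 //.
  rewrite [leRHS]invfM ler_wpM2r ?invr_ge0 ?(ltW h0) // ler_pdivrMr ?mulr_gt0 //.
  rewrite (_ : a^-1 * (2 * a) = 2); last by field; rewrite gt_eqF.
  by rewrite (le_trans (ler_normD _ _)) //; lra.
have r1 : `|ell_rx z| <= (a * ell_h z)^-1 by exact: sum.
have r2 : `|ell_ry z| <= (a * ell_h z)^-1 by exact: sum.
split => //.
  by rewrite -normrN -I2 normrM (gtr0_norm s0) ler_wpM2l // ltW.
by rewrite -I1 normrM (gtr0_norm s0) ler_wpM2l // ltW.
Qed.

Lemma ell_q_grad_le z : lower z -> `|ell_qx z| <= a^-1 /\ `|ell_qy z| <= a^-1.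
Proof.
move=> Lz.
have fx c := (focal_grad_le1 c Lz).1; have fy c := (focal_grad_le1 c Lz).2.
have dif (u v : R) : `|u| <= 1 -> `|v| <= 1 -> `|(u - v) / (2 * a)| <= a^-1.
  move=> u1 v1; rewrite normrM normfV (gtr0_norm (_ : 0 < 2 * a)) ?mulr_gt0 //.
  rewrite ler_pdivrMr ?mulr_gt0 // (_ : a^-1 * (2 * a) = 2); last by field; rewrite gt_eqF.
  by rewrite (le_trans (ler_normB _ _)) //; lra.
by split; exact: dif.
Qed.

(** Second derivatives of a distance are bounded by its inverse. *)
Lemma ell_q2_bound z : lower z ->
  `|ell_qxx z| <= (focal (- a) z)^-1 / a + (focal a z)^-1 / a /\
  `|ell_qxy z| <= (focal (- a) z)^-1 / a + (focal a z)^-1 / a /\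
  `|ell_qyy z| <= (focal (- a) z)^-1 / a + (focal a z)^-1 / a.
Proof.
move=> Lz.
have key c (u v : R) : `|u| <= focal c z -> `|v| <= focal c z ->
    `|u * v / focal c z ^+ 3| <= (focal c z)^-1.
  move=> hu hv; have f0 := focal_gt0 c Lz.
  rewrite normrM normfV (gtr0_norm (exprn_gt0 3 f0)) ler_pdivrMr ?exprn_gt0 //.
  rewrite (_ : (focal c z)^-1 * focal c z ^+ 3 = focal c z * focal c z); last by field; rewrite gt_eqF.
  by rewrite normrM ler_pM.
have fx c := focal_ge c z.
have fy c := focal_ge_snd c z.
have comb (u v m d : R) : `|u| <= m -> `|v| <= d -> `|(u - v) / (2 * a)| <= m / a + d / a.
  move=> um vd; rewrite normrM normfV (gtr0_norm (_ : 0 < 2 * a)) ?mulr_gt0 //.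
  rewrite ler_pdivrMr ?mulr_gt0 // (_ : (m / a + d / a) * (2 * a) = 2 * m + 2 * d); last by field; rewrite gt_eqF.
  have := ler_normB u v; have := normr_ge0 u; have := normr_ge0 v; lra.
have xx c : `|focal_xx c z| <= (focal c z)^-1 by rewrite /focal_xx expr2; exact: key.
have yy c : `|focal_yy c z| <= (focal c z)^-1 by rewrite /focal_yy expr2; exact: key.
have xy c : `|focal_xy c z| <= (focal c z)^-1.
  by rewrite /focal_xy mulNr normrN; exact: key.
by split; [|split]; exact: comb.
Qed.

End elliptic_coordinates.

(** * Extension across the major axis, the cut-off function, the layer profile *)

Section glue.
Context {R : realType}.
Implicit Types (z : R * R) (U : set (R * R)).

Lemma continuous_at0_le (f : R * R -> R) z (K : R) : f z = 0 ->
  (\forall x \near z, `|f x| <= K * `|x.2 - z.2|) -> {for z, continuous f}.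
Proof.
move=> fz fK; apply/cvgrPdist_le => e e0; rewrite fz.
pose L := `|K| + 1; have L0 : 0 < L by rewrite ltr_wpDl.
have n2 : \forall x \near z, `|x.2 - z.2| < e / L.
  by apply/ball_planeP; exists (e / L) => //; rewrite divr_gt0.
apply: filterS2 fK n2 => x h1 h2; rewrite sub0r normrN (le_trans h1) //.
have h3 : `|x.2 - z.2| * L <= e by rewrite -ler_pdivlMr // ltW.
apply: le_trans h3; rewrite mulrC ler_wpM2l // /L.
by rewrite (le_trans (ler_norm _)) // lerDl.
Qed.

(** A function of order y^2 with gradient of order y joins the zero function in a C^1 way. *)
Lemma C1on_glue U (f f1 f2 : R * R -> R) (K : R) : open U ->
  C1on (U `&` lower) f f1 f2 ->
  (forall z, U z -> lower z -> [/\ `|f z| <= K * z.2 ^+ 2,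
     `|f1 z| <= K * `|z.2| & `|f2 z| <= K * `|z.2|]) ->
  (forall z, ~ lower z -> [/\ f z = 0, f1 z = 0 & f2 z = 0]) ->
  C1on U f f1 f2.
Proof.
move=> oU Cf fK f0 z Uz.
have [Lz|nLz] := pselect (lower z); first exact: Cf.
have : 0 <= z.2 by move/negP : nLz; rewrite -leNgt.
rewrite le_eqVlt => /predU1P[z2|z2]; last first.
  have oP : open [set z : R * R | 0 < z.2].
    rewrite openE => x Px; apply: (@near_gt_at _ _ (fun z : R * R => z.2)) Px.
    exact: cvg_snd.
  apply: (C1on_eq oP (@C1on_cst R _ 0)) z2 => x /= x2;
    have [] := f0 x _ => //; by rewrite /lower /= => /lt_trans /(_ x2); rewrite ltxx.
have [fz f1z f2z] := f0 z nLz.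
have nU : \forall x \near z, U x by exact: open_nbhs_nbhs.
have n1 : \forall x \near z, `|x.2 - z.2| < 1.
  by apply/ball_planeP; exists 1.
have bnd x : U x -> [/\ `|f x| <= `|K| * x.2 ^+ 2, `|f1 x| <= `|K| * `|x.2 - z.2| &
    `|f2 x| <= `|K| * `|x.2 - z.2|].
  move=> Ux; rewrite -z2 subr0.
  have [Lx|nLx] := pselect (lower x); last first.
    have [-> -> ->] := f0 x nLx; by rewrite normr0; split; rewrite mulr_ge0 ?sqr_ge0.
  have [k1 k2 k3] := fK x Ux Lx.
  split; [apply: le_trans k1 _|apply: le_trans k2 _|apply: le_trans k3 _];
    by rewrite ler_wpM2r ?sqr_ge0 ?ler_norm.
split.
- apply/is_derive_exE; rewrite f1z.
  have -> : (fun t => f (t, z.2)) = (fun=> 0 : R).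
    have nL t : ~ lower (t, z.2) by rewrite /lower /= -z2 ltxx.
    by apply/funext => t; have [] := f0 (t, z.2) (nL t).
  exact: is_derive_cst.
- apply/is_derive_eyE; rewrite f2z; apply/derive1_lim.
  rewrite -surjective_pairing fz.
  have nUy : \forall t \near z.2, U (z.1, t).
    by apply: (@continuous_vertical R z.1 z.2); rewrite -surjective_pairing.
  have nU0 : \forall k \near (0 : R), U (z.1, z.2 + k).
    have c0 : (fun k : R => z.2 + k) @ (0 : R) --> z.2.
      by rewrite -{2}[z.2]addr0; apply: cvgD => //; exact: cvg_cst.
    exact: (c0 _ nUy).
  apply/cvgrPdist_le => e e0.
  pose L := `|K| + 1; have L0 : 0 < L by rewrite ltr_wpDl.
  near=> k.
  have k0 : k != 0 by near: k; exact: nbhs_dnbhs_neq.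
  have ke : `|k| < e / L by near: k; apply: dnbhs0_lt; rewrite divr_gt0.
  have Uk : U (z.1, z.2 + k) by near: k; exact: (@cvg_within _ _ (nbhs_filter (0 : R)) _ _ nU0).
  have [h1 _ _] := bnd _ Uk; rewrite /= -z2 add0r in h1.
  rewrite sub0r normrN -z2 add0r subr0 normrM normfV.
  rewrite ler_pdivrMl ?normr_gt0 // (le_trans h1) //.
  have nk : 0 <= `|k| by [].
  have h3 : `|k| * L <= e by rewrite -ler_pdivlMr // ltW.
  rewrite -(real_normK (num_real k)) expr2 mulrCA ler_wpM2l //.
  by apply: le_trans h3; rewrite mulrC ler_wpM2l // lerDl.
- apply: (@continuous_at0_le _ _ `|K|) fz _; apply: filterS2 nU n1 => x /bnd [h1 _ _] x1.
  apply: le_trans h1 _; rewrite ler_wpM2l //.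
  rewrite -z2 subr0 in x1 *.
  by rewrite -(real_normK (num_real x.2)) expr2 ler_piMl // ltW.
- by apply: (@continuous_at0_le _ _ `|K|) f1z _; apply: filterS nU => x /bnd [].
- by apply: (@continuous_at0_le _ _ `|K|) f2z _; apply: filterS nU => x /bnd [].
Unshelve. all: by end_near. Qed.

End glue.

Section cutoff_facts.
Context {R : realType}.

(** The cut-off function is constant near both ends of its interval, hence bounded with its
    derivative although nothing is assumed at the end points. *)
Lemma cutoff_facts (rho : R) (delta : R -> R) : 0 < rho -> cutoff rho delta ->
  exists (delta' : R -> R) (K : R), [/\ 0 <= K,
   forall x, 0 < x < rho -> is_derive x (1 : R) delta (delta' x) /\ {for x, continuous delta'},
   forall x, 0 < x < rho -> `|delta x| <= K /\ `|delta' x| <= K &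
   forall x, 3 * rho / 4 < x < rho -> delta x = 0 /\ delta' x = 0].
Proof.
move=> r0 [dd d1 d0].
pose delta' := derive1 delta.
have der x : 0 < x < rho -> is_derive x (1 : R) delta (delta' x).
  move=> xr; have := dd 0%N x xr; rewrite derive1n0 => H.
  by apply: DeriveDef => //; rewrite /delta' derive1E.
have cont x : 0 < x < rho -> {for x, continuous delta'}.
  move=> xr; have := dd 1%N x xr; rewrite derive1n1 => H.
  by apply: differentiable_continuous; apply/derivable1_diffP.
have contd x : 0 < x < rho -> {for x, continuous delta}.
  move=> /der [H _].
  by apply: differentiable_continuous; apply/derivable1_diffP.
have cst_der (b c l x : R) : 0 < x < rho -> b < x < c ->
    (forall y, b < y < c -> delta y = l) -> delta' x = 0.
  move=> xr /andP[bx xc] H.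
  have D0 : is_derive x (1 : R) delta 0.
    apply: (near_eq_is_derive _ (is_derive_cst l x (1 : R))).
    near=> y; apply/esym/H; apply/andP; split; near: y.
      exact: (near_gt_at (f := id)).
    exact: (near_lt_at (f := id)).
  by have [_ <-] := der x xr; have [_ ->] := D0.
have in01 x : rho / 4 <= x <= 7 * rho / 8 -> 0 < x < rho.
  by move=> /andP[x1 x2]; apply/andP; split; lra.
have bnd (g : R -> R) : (forall x, 0 < x < rho -> {for x, continuous g}) ->
    exists M : R, forall x, rho / 4 <= x <= 7 * rho / 8 -> `|g x| <= M.
  move=> cg.
  have cgw : {within `[rho / 4, 7 * rho / 8], continuous g}.
    apply: continuous_in_subspaceT => x; rewrite inE /= in_itv /= => /in01; exact: cg.
  have := compact_bounded (continuous_compact cgw (@segment_compact _ (rho / 4) (7 * rho / 8))).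
  move=> [M [Mr /(_ (`|M| + 1)) HM]].
  exists (`|M| + 1) => x x1; apply: HM; first by rewrite (le_lt_trans (ler_norm _))// ltrDl.
  by exists x => //=; rewrite in_itv.
have [M1 HM1] := bnd _ contd; have [M2 HM2] := bnd _ cont.
exists delta', (1 + `|M1| + `|M2|).
have n1 := normr_ge0 M1; have n2 := normr_ge0 M2.
have l1 := ler_norm M1; have l2 := ler_norm M2.
split; first lra.
- by move=> x xr; split; [exact: der|exact: cont].
- move=> x xr; have /andP[x0 x1] := xr.
  have [h1|h1] := leP (rho / 4) x; last first.
    rewrite d1; last by apply/andP; split; lra.
    rewrite (@cst_der 0 (rho / 2) 1 x) // ?normr1 ?normr0; first by split; lra.
      by apply/andP; split; lra.
    by move=> y /andP[y1 y2]; apply: d1; rewrite !ltW.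
  have [h2|h2] := leP x (7 * rho / 8).
    have h12 : rho / 4 <= x <= 7 * rho / 8 by rewrite h1.
    by split; [have := HM1 x h12|have := HM2 x h12]; lra.
  rewrite d0; last by apply/andP; split; lra.
  rewrite (@cst_der (3 * rho / 4) rho 0 x) // ?normr0; first by split; lra.
    by apply/andP; split; lra.
  by move=> y /andP[y1 y2]; apply: d0; rewrite !ltW.
- move=> x xr; have /andP[x0 x1] := xr; split.
    by apply: d0; rewrite !ltW.
  apply: (@cst_der (3 * rho / 4) rho 0 x) => //; first by apply/andP; split; lra.
  by move=> y /andP[y1 y2]; apply: d0; rewrite !ltW.
Unshelve. all: by end_near. Qed.

End cutoff_facts.

Section layer.
Context {R : realType}.

(** Up to the factor eps, the derivative of atan(c^2 t / eps) in t. Its integral over the line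
    does not depend on c, which makes the bound insensitive to the width eps / c^2 of the layer. *)
Definition layer (eps t c : R) := c ^+ 2 / (1 + (c ^+ 2 * t / eps) ^+ 2) : R.

(** With m = s c t / eps, the product of the left side with the denominator of the profile is a
    multiple of s^2 + c^2 m^2. Here s is at most c / B and m at most 2 A B s H / eps, so only
    powers of 1 + s H / eps are left, and the exponential absorbs them. *)
Lemma layer_bound (A B eps s H c t : R) : 0 < A -> 0 < B -> 0 < eps ->
  0 <= s -> 0 <= H -> 0 <= t -> B * s <= c -> c * t <= 2 * A * B * H ->
  (s * expR (- (A * s / eps * H)) * (1 + s * H / eps)) ^+ 2 <=
  (B ^- 2 + 1) * (1 + 2 * A * B) ^+ 2 * (1 + 2 / A) ^+ 4 * layer eps t c.
Proof.
move=> A0 B0 e0 s0 H0 t0 Bs ct.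
set Ex := expR _; set th := s * H / eps.
have th0 : 0 <= th by rewrite !mulr_ge0 // invr_ge0 ltW.
have AV : 0 < 2 / A by rewrite divr_gt0.
have c0 : 0 <= c by rewrite (le_trans _ Bs) // mulr_ge0 // ltW.
have AB0 : 0 <= 2 * A * B by rewrite !mulr_ge0 // ltW.
have E2 : 0 <= Ex * (1 + th) ^+ 2 <= (1 + 2 / A) ^+ 2.
  rewrite mulr_ge0 ?expR_ge0 ?sqr_ge0 //=.
  (* half of the exponent pays for each factor 1 + theta *)
  pose F := expR (A * th / 2).
  have F0 : 0 < F by exact: expR_gt0.
  have EF : Ex * F ^+ 2 = 1.
    by rewrite /Ex /F expr2 -!expRD (_ : _ + _ = 0) ?expR0 // /th; field; rewrite gt_eqF.
  have h1 : 1 + th <= (1 + 2 / A) * F.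
    have h2 : 1 + A * th / 2 <= F by exact: expR_ge1Dx.
    have h3 : (1 + 2 / A) * (1 + A * th / 2) <= (1 + 2 / A) * F by rewrite ler_wpM2l // addr_ge0 // ltW.
    apply: le_trans h3.
    have -> : (1 + 2 / A) * (1 + A * th / 2) = 1 + 2 / A + A * th / 2 + th.
      by field; rewrite gt_eqF.
    have : 0 <= A * th by rewrite mulr_ge0 // ltW.
    lra.
  have h4 : (1 + th) ^+ 2 <= ((1 + 2 / A) * F) ^+ 2.
    by rewrite ler_sqr // nnegrE; [lra|rewrite mulr_ge0 ?ltW // addr_gt0].
  have := ler_wpM2l (expR_ge0 (- (A * s / eps * H))) h4.
  by rewrite -/Ex [in leRHS]exprMn [in leRHS]mulrCA EF mulr1.
have m0 : 0 <= s * c * t / eps by rewrite !mulr_ge0 // invr_ge0 ltW.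
have mth : s * c * t / eps <= 2 * A * B * th.
  have -> : s * c * t / eps = s / eps * (c * t) by ring.
  have -> : 2 * A * B * th = s / eps * (2 * A * B * H) by rewrite /th; ring.
  by rewrite ler_wpM2l // divr_ge0 // ltW.
have m1 : s * c * t / eps <= (1 + 2 * A * B) * (1 + th).
  apply: le_trans mth _; lra.
have s2 : s ^+ 2 <= B ^- 2 * c ^+ 2.
  rewrite ler_pdivlMl ?exprn_gt0 // -exprMn ler_sqr ?nnegrE //.
  by rewrite mulr_ge0 // ltW.
have k1 : 1 <= (1 + 2 * A * B) * (1 + th).
  have : 0 <= 2 * A * B * th by rewrite mulr_ge0.
  lra.
rewrite /layer mulrA ler_pdivlMr; last by rewrite ltr_pwDl ?sqr_ge0.
set k := (1 + 2 * A * B) * (1 + th) in k1 m1.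
have S1 : s ^+ 2 * (1 + (c ^+ 2 * t / eps) ^+ 2) <= (B ^- 2 + 1) * c ^+ 2 * k ^+ 2.
  have -> : s ^+ 2 * (1 + (c ^+ 2 * t / eps) ^+ 2) = s ^+ 2 + c ^+ 2 * (s * c * t / eps) ^+ 2.
    by field; rewrite gt_eqF.
  have h5 : (s * c * t / eps) ^+ 2 <= k ^+ 2 by rewrite ler_sqr // nnegrE; lra.
  have h6 : 1 <= k ^+ 2 by rewrite exprn_ege1.
  have h7 : c ^+ 2 * (s * c * t / eps) ^+ 2 <= c ^+ 2 * k ^+ 2 by rewrite ler_wpM2l ?sqr_ge0.
  have h8 : B ^- 2 * c ^+ 2 * 1 <= B ^- 2 * c ^+ 2 * k ^+ 2.
    by rewrite ler_wpM2l // mulr_ge0 ?invr_ge0 ?sqr_ge0.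
  lra.
move/andP : E2 => [E20 E2].
have E4 : (Ex * (1 + th) ^+ 2) ^+ 2 <= (1 + 2 / A) ^+ 4.
  by rewrite (_ : _ ^+ 4 = ((1 + 2 / A) ^+ 2) ^+ 2) ?ler_sqr ?nnegrE ?sqr_ge0 // -exprM.
have -> : (s * Ex * (1 + th)) ^+ 2 * (1 + (c ^+ 2 * t / eps) ^+ 2) =
   (Ex * (1 + th)) ^+ 2 * (s ^+ 2 * (1 + (c ^+ 2 * t / eps) ^+ 2)) by ring.
apply: le_trans (ler_wpM2l (sqr_ge0 _) S1) _.
have -> : (Ex * (1 + th)) ^+ 2 * ((B ^- 2 + 1) * c ^+ 2 * k ^+ 2) =
   (B ^- 2 + 1) * (1 + 2 * A * B) ^+ 2 * c ^+ 2 * (Ex * (1 + th) ^+ 2) ^+ 2 by rewrite /k; ring.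
rewrite [leRHS]mulrAC ler_wpM2l //.
by rewrite !mulr_ge0 ?sqr_ge0 // addr_ge0 // invr_ge0 sqr_ge0.
Qed.

End layer.

(** * Boundary values of the limit solution and the lower half of the ellipse *)

Section traces.
Context {R : realType} {A B : R} (A0 : 0 < A) (B0 : 0 < B) (BA : B <= A).
Local Notation E := (ellipse A B).
Local Notation C := (Cu A B).
Context {N : nat} {f : R * R -> R} {D : nat -> nat -> R * R -> R}.
Context (N0 : (0 < N)%N) (fD : partials N E (closure E) f D).
Context (fA : D 0%N 0%N (A, 0) = 0) (fNA : D 0%N 0%N (- A, 0) = 0).

(** The trace of u0 on the lower boundary at the point with first coordinate A q. *)
Definition chord_total q :=
  \int[lebesgue_measure]_(s in `[- C (A * q), C (A * q)]) f (A * q, s).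

(** The values of f at a point and at its mirror image add up to a function which is again of order
    C, so its chord integral is of order C^2 = B^2 (1 - q^2) and has a bounded derivative. *)
Lemma chord_total_C1 : exists (V' : R -> R) (K : R), 0 <= K /\
  forall q : R, `|q| < 1 ->
    [/\ is_derive q (1 : R) chord_total (V' q), {for q, continuous V'},
        `|chord_total q| <= K * (1 - q ^+ 2) & `|V' q| <= K].
Proof.
have [M [K [M0 K0 b0 b1 b2]]] := data_le_Cu A0 B0 BA N0 fD fA fNA.
have Cd := data_C1 N0 fD.
have Cr := C1on_reflect Cd.
have Ce := C1on_D Cd Cr.
have Er z : E z -> E (z.1, - z.2) by rewrite /ellipse /= sqrrN.
have e0 z : E z -> `|D 0%N 0%N z + D 0%N 0%N (z.1, - z.2)| <= (2 * K) * C z.1.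
  move=> Ez; have h1 := b0 _ Ez; have h2 := b0 _ (Er _ Ez); rewrite /= in h2.
  by rewrite (le_trans (ler_normD _ _)) //; lra.
have e1 z : E z -> `|D 1%N 0%N z + D 1%N 0%N (z.1, - z.2)| <= 2 * M.
  move=> Ez; have h1 := b1 _ Ez; have h2 := b1 _ (Er _ Ez).
  by rewrite (le_trans (ler_normD _ _)) //; lra.
have e2 z : E z -> `|D 0%N 1%N z + - D 0%N 1%N (z.1, - z.2)| <= 2 * M.
  move=> Ez; have h1 := b2 _ Ez; have h2 := b2 _ (Er _ Ez).
  by rewrite (le_trans (ler_normB _ _)) //; lra.
have K20 : 0 <= 2 * K by rewrite mulr_ge0.
have M20 : 0 <= 2 * M by rewrite mulr_ge0.
pose P := prim (A := A) (B := B) (D0 := fun z => D 0%N 0%N z + D 0%N 0%N (z.1, - z.2)).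
pose P' := dprim (A := A) (B := B) (D0 := fun z => D 0%N 0%N z + D 0%N 0%N (z.1, - z.2))
  (D1 := fun z => D 1%N 0%N z + D 1%N 0%N (z.1, - z.2))
  (D2 := fun z => D 0%N 1%N z + - D 0%N 1%N (z.1, - z.2)).
have qA q : `|q| < 1 -> `|A * q| < A.
  by move=> q1; rewrite normrM gtr0_norm // gtr_pMr.
have VP q : `|q| < 1 -> chord_total q = P (A * q, 0).
  move=> /qA q1; rewrite /chord_total.
  have [fD0 cD _] := fD.
  by apply: chord_integral => //; exact: cD.
have E0 q : `|q| < 1 -> E (A * q, 0).
  by move=> /qA q1; apply/ellipseE => //=; rewrite normr0; split=> //; exact: Cu_gt0.
have cq (q : R) : {for q, continuous (fun q : R => (A * q, 0 : R))}.
  apply: continuous_at_pair; last by move=> ?; exact: cvg_cst.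
  by apply: cvgM => //; exact: cvg_cst.
exists (fun q => A * P' (A * q, 0)).
exists (2 * (2 * K) * B ^+ 2 + A * ((2 * K + 2 * (2 * M)) * (B ^+ 2 / A) + 2 * B * (2 * M))).
have S1 : 0 <= 2 * (2 * K) * B ^+ 2 by rewrite mulr_ge0 ?sqr_ge0 // mulr_ge0.
have S2 : 0 <= A * ((2 * K + 2 * (2 * M)) * (B ^+ 2 / A) + 2 * B * (2 * M)).
  rewrite mulr_ge0 ?(ltW A0) // addr_ge0 //; last by rewrite mulr_ge0 // mulr_ge0 // ltW.
  by rewrite mulr_ge0 ?divr_ge0 ?sqr_ge0 ?(ltW A0) //; lra.
split; first by rewrite addr_ge0.
move=> q q1; have Eq := E0 q q1.
have [d1 c1] := prim_C1 A0 B0 M20 K20 Ce e0 e1 e2 Eq.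
split.
- have dA : is_derive q (1 : R) (fun q : R => A * q) A.
    by apply: is_derive_eq; rewrite /GRing.scale /=; ring.
  move/is_derive_exE : d1 => /= d1.
  have d2 := is_derive1_comp (f := fun x => P (x, 0)) (g := fun q : R => A * q) d1 dA.
  have d3 : is_derive q (1 : R) (fun q => P (A * q, 0)) (A * P' (A * q, 0)).
    by have /is_derive_eq := d2; apply; rewrite mulrC.
  apply: near_eq_is_derive d3.
  have : \forall x \near q, `|x| < 1.
    by apply: (near_lt_at (f := fun x : R => `|x|)) => //; exact: norm_continuous.
  by apply: filterS => x /VP ->.
- apply: cvgM; first exact: cvg_cst.
  exact: (@continuous_comp _ _ _ (fun q : R => (A * q, 0 : R)) P').
- rewrite VP //; have := prim_le A0 B0 K20 Ce e0 Eq => h.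
  apply: le_trans h _; rewrite /= Cu_sqr ?(ltW (qA _ q1)) //.
  have q2 : 0 <= 1 - q ^+ 2.
    by rewrite subr_ge0 -(real_normK (num_real q)) expr_le1 // ltW.
  have -> : (A * q) ^+ 2 / A ^+ 2 = q ^+ 2 by field; rewrite gt_eqF.
  rewrite mulrA ler_wpM2r //; lra.
- rewrite normrM gtr0_norm //.
  apply: (@le_trans _ _ (A * ((2 * K + 2 * (2 * M)) * (B ^+ 2 / A) + 2 * B * (2 * M)))); last lra.
  by rewrite ler_pM2l //; have := dprim_le A0 B0 M20 K20 Ce e0 e1 e2 Eq.
Qed.

(** u0 plus the primitive of f along the chord is constant above z; below z the primitive is
    Lipschitz. *)
Lemma limit_solution_lower_trace u0 z (M : R) : limit_solution A B f u0 -> E z ->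
  (forall w, E w -> `|f w| <= M) ->
  `|u0 z - \int[lebesgue_measure]_(s in `[- C z.1, C z.1]) f (z.1, s)| <= M * (z.2 + C z.1).
Proof.
move=> [cu0 du0 u0G _] Ez fM; have [z1 z2] := (ellipseE A0 B0 z).1 Ez.
have C0 := Cu_gt0 A0 B0 z1.
move: (z2); rewrite ltr_norml => /andP[z3 z4].
have [fD0 /(_ 0%N 0%N (leq0n _)) cD _] := fD.
have xs s : - C z.1 <= s <= C z.1 -> closure E (z.1, s).
  by move=> sC; apply: chord_closure; rewrite ?(ltW z1) // ler_norml.
have cy := @continuous_vertical R z.1.
have ck : {within `[- C z.1, C z.1], continuous (fun s => D 0%N 0%N (z.1, s))}.
  exact: (within_comp_path cD xs).
have CC : - C z.1 < C z.1 by lra.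
have [F [cF dF F0 FC]] := segment_primitive CC ck.
have -> : \int[lebesgue_measure]_(s in `[- C z.1, C z.1]) f (z.1, s) = F (C z.1).
  rewrite FC; apply: eq_Rintegral => s; rewrite inE /= in_itv /= => sC.
  by rewrite fD0 //; exact: xs.
have Es s : - C z.1 < s < C z.1 -> E (z.1, s).
  by move=> sC; apply/ellipseE => //=; split=> //; rewrite ltr_norml.
have Gtop : Gamma_plus A B (z.1, C z.1).
  split => //; rewrite /ellipse_bd /= (Cu_sqr A0 (ltW z1)).
  by field; rewrite !gt_eqF.
have cu : {within `[z.2, C z.1], continuous (fun s => u0 (z.1, s) + F s)}.
  move=> t; apply: cvgD.
    apply: (within_comp_path cu0 _ cy) => {}t /andP[t0].
    rewrite le_eqVlt => /predU1P[->|t1]; first by right.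
    by left; apply: Es; rewrite t1 andbT (lt_le_trans z3).
  by apply: (continuous_subspaceW _ cF) => s; rewrite /= !in_itv /= => /andP[s1 ->]; rewrite andbT (le_trans (ltW z3)).
have du (t : R) : z.2 < t < C z.1 -> is_derive t (1 : R) (fun s => u0 (z.1, s) + F s) 0 /\ `|0 : R| <= 0.
  move=> /andP[t0 t1]; rewrite normr0; split=> //.
  have t2 : - C z.1 < t < C z.1 by rewrite t1 andbT (lt_trans z3).
  have /is_derive_eyE /= d1 := du0 _ (Es t t2).
  have /is_derive_eq := is_deriveD d1 (dF t t2); apply.
  by rewrite fD0 ?addNr //; apply: sub_closure_ellipse; exact: Es.
have := lipschitz_segment (ltW z4) du cu.
rewrite mul0r normr_le0 subr_eq0 (u0G _ Gtop) add0r -surjective_pairing => /eqP ->.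
rewrite opprD addrA subrr sub0r normrN -[X in `|X|]subr0 -F0 -[X in _ * (_ + X)]opprK.
apply: lipschitz_segment; first exact: ltW.
  move=> t /andP[t0 t1]; have t2 : - C z.1 < t < C z.1 by rewrite t0 (lt_trans t1).
  split; first exact: dF.
  by rewrite /= fD0; [apply: fM; exact: Es|apply: sub_closure_ellipse; exact: Es].
by apply: (continuous_subspaceW _ cF) => s; rewrite /= !in_itv /= => /andP[-> s1] /=; rewrite (le_trans s1) // ltW.
Qed.

Lemma limit_solution_upper_trace u0 z (M : R) : limit_solution A B f u0 -> E z ->
  (forall w, E w -> `|f w| <= M) -> `|u0 z| <= M * (C z.1 - z.2).
Proof.
move=> [cu0 du0 u0G _] Ez fM; have [z1 z2] := (ellipseE A0 B0 z).1 Ez.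
have C0 := Cu_gt0 A0 B0 z1.
move: (z2); rewrite ltr_norml => /andP[z3 z4].
have cy := @continuous_vertical R z.1.
have Es s : - C z.1 < s < C z.1 -> E (z.1, s).
  by move=> sC; apply/ellipseE => //=; split=> //; rewrite ltr_norml.
have Gtop : Gamma_plus A B (z.1, C z.1).
  split => //; rewrite /ellipse_bd /= (Cu_sqr A0 (ltW z1)).
  by field; rewrite !gt_eqF.
have cu : {within `[z.2, C z.1], continuous (fun s => u0 (z.1, s))}.
  apply: (within_comp_path cu0 _ cy) => t /andP[t0].
  rewrite le_eqVlt => /predU1P[->|t1]; first by right.
  by left; apply: Es; rewrite t1 andbT (lt_le_trans z3).
have du (t : R) : z.2 < t < C z.1 ->
    is_derive t (1 : R) (fun s => u0 (z.1, s)) (- f (z.1, t)) /\ `|- f (z.1, t)| <= M.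
  move=> /andP[t0 t1]; have Et : E (z.1, t) by apply: Es; rewrite t1 andbT (lt_trans z3).
  by split; [have /is_derive_eyE := du0 _ Et|rewrite normrN fM].
have := lipschitz_segment (ltW z4) du cu.
by rewrite (u0G _ Gtop) sub0r normrN -surjective_pairing.
Qed.

End traces.

Section lower_half.
Context {R : realType} {A B a rho : R} (B0 : 0 < B) (BA : B < A) (a0 : 0 < a)
  (rho0 : 0 < rho) (aA : a * coshR rho = A) (aB : a * sinhR rho = B).
Local Notation E := (ellipse A B).
Local Notation C := (Cu A B).
Local Notation p := (ell_p (a := a)).
Local Notation q := (ell_q (a := a)).
Local Notation s := (ell_s (a := a)).
Local Notation h := (ell_h (a := a)).
Local Notation r := (ell_r (a := a)).

Lemma axes_focal : A ^+ 2 - B ^+ 2 = a ^+ 2.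
Proof. rewrite -aA -aB -[RHS]mulr1 -(coshR_sinhR rho); ring. Qed.

(** The defect of the gauge of the ellipse vanishes to first order in A - a p; the factorization
    rests on A^2 - B^2 = a^2. *)
Lemma ell_defect z : B ^+ 2 * (1 - (z.1 ^+ 2 / A ^+ 2 + z.2 ^+ 2 / B ^+ 2)) =
  (A ^+ 2 - (a * p z) ^+ 2) * (B ^+ 2 / A ^+ 2 * q z ^+ 2 + (1 - q z ^+ 2)).
Proof.
have A0 : 0 < A by exact: lt_trans BA.
move: (ell_x a0 z) (ell_y a0 z); move: (p z) (q z) => P Q -> ->.
by rewrite !exprMn -axes_focal; field; rewrite !gt_eqF.
Qed.

Lemma coshR_le_inv (x y : R) : 0 < y -> coshR x < coshR y -> x < y.
Proof.
move=> y0 xy; rewrite ltNge; apply/negP => yx.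
have := coshR_tangent y x; have : 0 <= sinhR y * (x - y).
  by rewrite mulr_ge0 ?subr_ge0 // ltW // sinhR_gt0.
lra.
Qed.

Lemma ell_p_lt z : E z -> a * p z < A.
Proof.
have A0 : 0 < A by exact: lt_trans BA.
move=> Ez; have p1 := ell_p_ge1 a0 z.
have D0 : 0 < B ^+ 2 * (1 - (z.1 ^+ 2 / A ^+ 2 + z.2 ^+ 2 / B ^+ 2)).
  by rewrite mulr_gt0 ?exprn_gt0 // subr_gt0.
have q1 := ell_q_sqr_le1 a0 z.
have F0 : 0 <= B ^+ 2 / A ^+ 2 * q z ^+ 2 + (1 - q z ^+ 2).
  by rewrite addr_ge0 ?subr_ge0 // mulr_ge0 ?divr_ge0 ?sqr_ge0.
have : 0 < A ^+ 2 - (a * p z) ^+ 2.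
  rewrite ltNge; apply/negP => N0; move: D0; rewrite ell_defect ltNge => /negP; apply.
  by rewrite mulr_le0_ge0.
by rewrite subr_gt0 ltr_sqr // nnegrE; [rewrite mulr_ge0 ?(ltW a0) //; lra|exact: ltW].
Qed.

Lemma ell_r_lt z : E z -> 0 <= r z < rho.
Proof.
move=> Ez; have p1 := ell_p_ge1 a0 z; rewrite arcosh_ge0 //=.
apply: coshR_le_inv => //; rewrite coshR_arcosh // -(ltr_pM2l a0) aA; exact: ell_p_lt.
Qed.

(** Convexity of cosh from both sides. *)
Lemma ell_p_gap z : 0 <= r z -> r z <= rho -> 0 <= A - a * p z <= B * (rho - r z).
Proof.
move=> r0 rr; have p1 := ell_p_ge1 a0 z.
have pE : p z = coshR (r z) by rewrite coshR_arcosh.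
rewrite -{1 2}aA -aB pE -mulrBr -mulrA; apply/andP; split.
  rewrite mulr_ge0 ?(ltW a0) // subr_ge0.
  have := coshR_tangent (r z) rho; have := sinhR_le r0.
  rewrite {1}/sinhR oppr0 subrr mul0r => s0.
  have : 0 <= sinhR (r z) * (rho - r z) by rewrite mulr_ge0 // subr_ge0.
  lra.
rewrite ler_pM2l //; have := coshR_tangent rho (r z); lra.
Qed.

(** C^2 - y^2 is the defect of the gauge times B^2, hence at most A^2 - (a p)^2, which is at most of
    the order of the coordinate distance rho - r. This links the vertical distance to the lower
    boundary with the elliptic one. *)
Lemma lower_geometry z : E z -> lower z ->
  [/\ 0 < r z < rho, B * s z <= C z.1 &
      C z.1 * (z.2 + C z.1) <= 2 * A * B * (rho - r z)].
Proof.
have A0 : 0 < A by exact: lt_trans BA.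
move=> Ez Lz; have [p1 q1 h0 s0 yE] := lower_facts a0 Lz.
have /andP[_ rr] := ell_r_lt Ez.
have r0 : 0 < r z by exact: arcosh_gt0.
have [xA yC] := (ellipseE A0 B0 z).1 Ez.
have C0 := Cu_gt0 A0 B0 xA.
have C2 := Cu_sqr (B := B) A0 (ltW xA).
have pA := ell_p_lt Ez.
have ap0 : 0 < a * p z by rewrite mulr_gt0 //; lra.
split; first by rewrite r0.
- rewrite -ler_sqr ?nnegrE ?(ltW C0) //; last by rewrite mulr_ge0 // ltW.
  rewrite C2 exprMn ler_pM2l ?exprn_gt0 // ell_s_sqr // lerD2l lerN2 ler_pdivrMr ?exprn_gt0 //.
  rewrite (ell_x a0) exprMn mulrC ler_wpM2l ?sqr_ge0 // ler_sqr ?nnegrE //; exact: ltW.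
- have /andP[_ gap] := ell_p_gap (ltW r0) (ltW rr).
  have y0 : z.2 < 0 by [].
  move: yC; rewrite ltr_norml => /andP[y1 y2].
  have e1 : C z.1 * (z.2 + C z.1) <= (C z.1 - z.2) * (z.2 + C z.1).
    by rewrite ler_wpM2r //; lra.
  apply: le_trans e1 _.
  have -> : (C z.1 - z.2) * (z.2 + C z.1) = C z.1 ^+ 2 - z.2 ^+ 2 by ring.
  have -> : C z.1 ^+ 2 - z.2 ^+ 2 = B ^+ 2 * (1 - (z.1 ^+ 2 / A ^+ 2 + z.2 ^+ 2 / B ^+ 2)).
    by rewrite C2; field; rewrite !gt_eqF.
  rewrite ell_defect.
  have P0 : 0 <= A ^+ 2 - (a * p z) ^+ 2.
    by rewrite subr_ge0 ler_sqr ?nnegrE ltW.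
  have F1 : B ^+ 2 / A ^+ 2 * q z ^+ 2 + (1 - q z ^+ 2) <= 1.
    have : B ^+ 2 / A ^+ 2 * q z ^+ 2 <= 1 * q z ^+ 2.
      rewrite ler_wpM2r ?sqr_ge0 // ler_pdivrMr ?exprn_gt0 // mul1r ler_sqr ?nnegrE ltW //.
    lra.
  apply: le_trans (ler_wpM2l P0 F1) _; rewrite mulr1 subr_sqr.
  have h1 : (A - a * p z) * (A + a * p z) <= (A - a * p z) * (2 * A).
    by rewrite ler_wpM2l //; lra.
  have h2 : (A - a * p z) * (2 * A) <= (B * (rho - r z)) * (2 * A).
    by rewrite ler_wpM2r // mulr_ge0 // ltW.
  lra.
Qed.

End lower_half.

(** * The layer profile has integral of order eps *)

Section layer_integral.
Context {R : realType} {A B : R} (A0 : 0 < A).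
Local Notation plane := (measurableTypeR R * measurableTypeR R)%type.
Local Notation C := (Cu A B).

Definition layer_at eps (z : R * R) := layer eps (z.2 + C z.1) (C z.1).

Lemma layer_ge0 (eps t c : R) : 0 <= layer eps t c.
Proof. by rewrite divr_ge0 ?sqr_ge0 // addr_ge0 // sqr_ge0. Qed.

Lemma continuous_layer_at eps : continuous (layer_at eps).
Proof.
move=> z; have cC : {for z, continuous (fun z : R * R => C z.1 ^+ 2)}.
  apply: (@continuous_comp _ _ _ (fun z : R * R => C z.1) (fun x => x ^+ 2)).
    apply: (@continuous_comp _ _ _ (fun z : R * R => z.1) C); first exact: cvg_fst.
    exact: continuous_Cu.
  exact: exprn_continuous.
have cD : {for z, continuous (fun z : R * R => C z.1)}.
  apply: (@continuous_comp _ _ _ (fun z : R * R => z.1) C); first exact: cvg_fst.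
  exact: continuous_Cu.
apply: cvgM => //.
apply: (@continuous_comp _ _ _ (fun z : R * R => 1 + (C z.1 ^+ 2 * (z.2 + C z.1) / eps) ^+ 2) GRing.inv).
  apply: cvgD; first exact: cvg_cst.
  apply: (@continuous_comp _ _ _ (fun z : R * R => C z.1 ^+ 2 * (z.2 + C z.1) / eps) (fun x => x ^+ 2)).
    apply: cvgM; last exact: cvg_cst.
    by apply: cvgM => //; apply: cvgD => //; exact: cvg_snd.
  exact: exprn_continuous.
by apply: inv_continuous; rewrite gt_eqF // ltr_pwDl // sqr_ge0.
Qed.

Lemma layer_line_integral (eps c : R) : 0 < eps ->
  (\int[lebesgue_measure]_(y in `[(- A)%R, A%R]) (layer eps (y + c) c)%:E <= (eps * pi)%:E)%E.
Proof.
move=> e0.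
pose F y := eps * atan (c ^+ 2 * (y + c) / eps).
have dF (y : R) : is_derive y (1 : R) F (layer eps (y + c) c).
  have dg : is_derive y (1 : R) (fun y : R => c ^+ 2 * (y + c) / eps) (c ^+ 2 / eps).
    by apply: is_derive_eq; rewrite /GRing.scale /=; ring.
  have d2 := is_derive1_comp (f := @atan R) (g := fun y : R => c ^+ 2 * (y + c) / eps)
    (is_derive1_atan _) dg.
  have /is_derive_eq := is_deriveZ eps d2; apply.
  rewrite /layer /GRing.scale /=; field.
  by rewrite !gt_eqF // ltr_pwDl ?sqr_ge0 // exprn_gt0.
have cl : continuous (fun y : R => layer eps (y + c) c).
  move=> y; apply: cvgM; first exact: cvg_cst.
  apply: (@continuous_comp _ _ _ (fun y : R => 1 + (c ^+ 2 * (y + c) / eps) ^+ 2) GRing.inv).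
    apply: cvgD; first exact: cvg_cst.
    apply: (@continuous_comp _ _ _ (fun y : R => c ^+ 2 * (y + c) / eps) (fun x => x ^+ 2)).
      apply: cvgM; last exact: cvg_cst.
      apply: cvgM; first exact: cvg_cst.
      by apply: cvgD => //; exact: cvg_cst.
    exact: exprn_continuous.
  by apply: inv_continuous; rewrite gt_eqF // ltr_pwDl // sqr_ge0.
have dFy y : derivable F y 1 by case: (dF y).
have cF : continuous F.
  by move=> y; apply: differentiable_continuous; apply/derivable1_diffP.
rewrite (@continuous_FTC2 _ (fun y => layer eps (y + c) c) F).
- rewrite -EFinB lee_fin /F -mulrBr ler_pM2l //.
  have := atan_ltpi2 (c ^+ 2 * (A + c) / eps).
  have := atan_gtNpi2 (c ^+ 2 * (- A + c) / eps).
  lra.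
- by rewrite gtrN.
- exact: continuous_subspaceT.
- by split => //; [apply: cvg_at_right_filter|apply: cvg_at_left_filter]; exact: cF.
- by move=> y _; rewrite derive1E; case: (dF y).
Qed.

Lemma layer_integral (eps : R) : 0 < eps ->
  (\int[lebesgue2]_(z in box A) (layer_at eps z)%:E <= (2 * A * pi * eps)%:E)%E.
Proof.
move=> e0; have mB : measurable (box A : set plane) by exact: measurable_box.
have ml := continuous_measurable_plane (@continuous_layer_at eps).
pose g : plane -> \bar R := (EFin \o layer_at eps) \_ (box A).
have mg : measurable_fun setT g.
  apply/(measurable_restrictT _ mB)/measurable_EFinP.
  exact: measurable_funS ml.
have g0 z : (0 <= g z)%E.
  by rewrite /g patchE; case: ifPn => // _; rewrite /= lee_fin layer_ge0.
rewrite integral_mkcond /= -/g /lebesgue2 (fubini_tonelli1 _ mg g0).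
have mI : measurable (`[- A, A]%classic : set (measurableTypeR R)) by exact: measurable_itv.
have gE x : (fubini_F lebesgue_measure g x <= ((fun=> (eps * pi)%:E) \_ `[(- A)%R, A%R]) x)%E.
  rewrite /fubini_F patchE; case: ifPn => [/set_mem xA|/negP xA].
    have -> : (fun y => g (x, y)) = (fun y => (layer eps (y + C x) (C x))%:E) \_ `[(- A)%R, A%R].
      apply/funext => y; rewrite /g !patchE /layer_at /=.
      congr (if _ then _ else _); apply/idP/idP => /set_mem H; apply/mem_set => //.
      by case: H.
    rewrite -integral_mkcond; exact: layer_line_integral.
  rewrite integral0_eq // => y _; rewrite /g patchE; case: ifPn => // /set_mem [H _].
  by case: xA; apply/mem_set.
apply: (@le_trans _ _ (\int[lebesgue_measure]_x ((fun=> (eps * pi)%:E) \_ `[(- A)%R, A%R]) x)%E).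
  apply: ge0_le_integral => //.
  - by move=> x _; apply: integral_ge0 => y _.
  - exact: measurable_fun_fubini_tonelli_F.
  - apply/(measurable_restrictT _ mI); exact: measurable_cst.
have mA : @lebesgue_measure R `[(- A)%R, A%R]%classic = (2 * A)%:E.
  rewrite lebesgue_measure_itv /= lte_fin gtrN // -EFinB opprK.
  by congr EFin; ring.
have IA : (\int[lebesgue_measure]_(x in `[(- A)%R, A%R]) (eps * pi)%:E =
    (eps * pi)%:E * @lebesgue_measure R `[(- A)%R, A%R]%classic)%E.
  exact: integral_cst.
rewrite -integral_mkcond IA mA -EFinM lee_fin.
by have -> : eps * pi * (2 * A) = 2 * A * pi * eps :> R by ring.
Qed.

End layer_integral.

(** * Extension by zero outside the ellipse *)

Section zero_off_ellipse.
Context {R : realType} {A B : R}.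
Local Notation E := (ellipse A B).

Definition off_ellipse0 (v : R * R -> R) (z : R * R) : R :=
  if z.1 ^+ 2 / A ^+ 2 + z.2 ^+ 2 / B ^+ 2 < 1 then v z else 0.

Lemma off_ellipse0_in v z : E z -> off_ellipse0 v z = v z.
Proof. by rewrite /off_ellipse0 /ellipse /= => ->. Qed.

Lemma off_ellipse0_out v z : ~ E z -> off_ellipse0 v z = 0.
Proof. by rewrite /off_ellipse0 /ellipse /= => /negP/negbTE ->. Qed.

Lemma continuous_off_ellipse0 v : (forall z, E z -> {for z, continuous v}) ->
  (forall z, ellipse_bd A B z -> forall e : R, 0 < e ->
     \forall x \near z, E x -> `|v x| <= e) -> continuous (off_ellipse0 v).
Proof.
move=> cv bv z.
have cg : {for z, continuous (fun z : R * R => z.1 ^+ 2 / A ^+ 2 + z.2 ^+ 2 / B ^+ 2)}.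
  exact: continuous_gauge.
have [z1|z1|z1] := ltgtP (z.1 ^+ 2 / A ^+ 2 + z.2 ^+ 2 / B ^+ 2) 1.
- apply: near_eq_continuous_at (cv z z1).
  have nE : \forall x \near z, E x by exact: (near_lt_at cg z1).
  by apply: filterS nE => x Ex; rewrite off_ellipse0_in.
- have c0 : {for z, continuous (fun=> 0 : R)} by move=> ?; exact: cvg_cst.
  apply: near_eq_continuous_at c0.
  have nE := near_gt_at cg z1.
  apply: filterS nE => x x1; rewrite off_ellipse0_out // /ellipse /= => x2.
  by have := lt_trans x1 x2; rewrite ltxx.
- apply/cvgrPdist_le => e e0; have z0 : off_ellipse0 v z = 0.
    by rewrite off_ellipse0_out // /ellipse /= z1 ltxx.
  apply: filterS (bv z z1 e e0) => x bx; rewrite z0 sub0r normrN.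
  have [Ex|nEx] := pselect (E x); first by rewrite off_ellipse0_in //; exact: bx.
  by rewrite off_ellipse0_out // normr0 ltW.
Qed.

End zero_off_ellipse.

(** * The corrector and the remainder *)

Section boundary_layer.
Context {R : realType} {A B a rho : R} (B0 : 0 < B) (BA : B < A) (a0 : 0 < a)
  (rho0 : 0 < rho) (aA : a * coshR rho = A) (aB : a * sinhR rho = B).
Context {V V' delta delta' : R -> R} {K : R} (K0 : 0 <= K).
Context (HV : forall q : R, `|q| < 1 ->
    [/\ is_derive q (1 : R) V (V' q), {for q, continuous V'},
        `|V q| <= K * (1 - q ^+ 2) & `|V' q| <= K]).
Context (Hd : forall x : R, 0 < x < rho ->
    [/\ is_derive x (1 : R) delta (delta' x), {for x, continuous delta'},
        `|delta x| <= K & `|delta' x| <= K]).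
Context (Hd0 : forall x : R, 3 * rho / 4 < x < rho -> delta x = 0 /\ delta' x = 0).
Context (Hd1 : forall x : R, 0 <= x <= rho / 2 -> delta x = 1).
Local Notation E := (ellipse A B).
Local Notation C := (Cu A B).
Local Notation p := (ell_p (a := a)).
Local Notation q := (ell_q (a := a)).
Local Notation s := (ell_s (a := a)).
Local Notation h := (ell_h (a := a)).
Local Notation r := (ell_r (a := a)).
Local Notation qx := (ell_qx (a := a)).
Local Notation qy := (ell_qy (a := a)).
Local Notation rx := (ell_rx (a := a)).
Local Notation ry := (ell_ry (a := a)).

(** A bound for |grad r| on the support of the cut-off function, which stays away from the
    segment between the foci. *)
Definition kap := (a * sinhR (rho / 4))^-1.

Lemma kap_gt0 : 0 < kap.
Proof. by rewrite invr_gt0 mulr_gt0 // sinhR_gt0 // divr_gt0. Qed.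

Lemma layer_support z : E z -> lower z -> rho - r z <= 3 * rho / 4 ->
  [/\ (a * h z)^-1 <= kap & s z <= kap * `|z.2|].
Proof.
move=> Ez Lz Hz; have [p1 q1 h0 s0 yE] := lower_facts a0 Lz.
have sh : sinhR (rho / 4) <= h z.
  have <- : sinhR (r z) = h z by rewrite sinhR_arcosh // ltW.
  by apply: sinhR_le; lra.
have s4 : 0 < sinhR (rho / 4) by rewrite sinhR_gt0 // divr_gt0.
have ah : (a * h z)^-1 <= kap.
  have ah0 : 0 < a * h z by exact: mulr_gt0.
  have as0 : 0 < a * sinhR (rho / 4) by exact: mulr_gt0.
  by rewrite /kap lef_pV2 ?posrE // ler_pM2l.
split=> //; have -> : s z = (a * h z)^-1 * `|z.2|.
  rewrite yE normrN gtr0_norm ?mulr_gt0 //.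
  by rewrite mulrA mulVf ?mul1r // gt_eqF // mulr_gt0.
by rewrite ler_wpM2r.
Qed.

Lemma ell_q_norm_lt1 z : lower z -> `|q z| < 1.
Proof.
move=> Lz; have [_ q1 _ _ _] := lower_facts a0 Lz.
by rewrite -(expr_lt1 (n := 2)) // real_normK ?num_real.
Qed.

Context {eps : R} (e0 : 0 < eps).

Definition lay_E z := expR (- (A * s z / eps * (rho - r z))).
(** The corrector on the lower half of the ellipse in the variables q and r. The function V is the
    trace of u0 on the lower boundary. *)
Definition lay z := - (V (q z) * lay_E z * delta (rho - r z)).
(** The partial derivative of lay in q. *)
Definition lay_q z := - (V' (q z) * lay_E z * delta (rho - r z) +
  V (q z) * lay_E z * (A / eps * (q z / s z) * (rho - r z)) * delta (rho - r z)).
(** The part of the partial derivative lay_r in which the cut-off function is differentiated; the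
    other part is A s / eps times lay and is carried by the divergence-free field A s grad r. *)
Definition lay_d z := V (q z) * lay_E z * delta' (rho - r z).
Definition lay_r z := A * s z / eps * lay z + lay_d z.
Definition lay_x z := lay_q z * qx z + lay_r z * rx z.
Definition lay_y z := lay_q z * qy z + lay_r z * ry z.

Lemma C1on_lay : C1on (E `&` lower) lay lay_x lay_y.
Proof.
have oU : open (E `&` lower) by apply: openI; [exact: open_ellipse|exact: open_lower].
have Hr z : (E `&` lower) z -> 0 < rho - r z < rho.
  by move=> [Ez Lz]; have [/andP[r1 r2] _ _] := lower_geometry B0 BA a0 rho0 aA aB Ez Lz;
    apply/andP; split; lra.
have Cq : C1on (E `&` lower) q qx qy by move=> z [_ Lz]; exact: C1on_ell_q.
have Cr : C1on (E `&` lower) r rx ry by move=> z [_ Lz]; exact: C1on_ell_r.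
have Cs : C1on (E `&` lower) s (ell_sx (a := a)) (ell_sy (a := a)).
  by move=> z [_ Lz]; exact: C1on_ell_s.
have CH := C1on_D (@C1on_cst R (E `&` lower) rho) (C1on_N Cr).
have CV : C1on (E `&` lower) (fun z => V (q z)) (fun z => V' (q z) * qx z) (fun z => V' (q z) * qy z).
  apply: (C1on_comp (g := V) (g' := V') Cq) => z [_ /ell_q_norm_lt1 q1].
  by have [] := HV q1.
have Cd : C1on (E `&` lower) (fun z => delta (rho - r z))
    (fun z => delta' (rho - r z) * (0 - rx z)) (fun z => delta' (rho - r z) * (0 - ry z)).
  apply: (C1on_comp (g := delta) (g' := delta') CH) => z /Hr Hz.
  by have [] := Hd Hz.
have Ci := C1on_N (C1on_M (C1on_scale eps (C1on_M (@C1on_cst R (E `&` lower) A) Cs)) CH).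
have CE := @C1on_comp _ _ _ _ _ expR expR Ci (fun z _ =>
   conj (is_derive_expR _) (@continuous_expR R _)).
apply: (C1on_eq oU (C1on_N (C1on_M (C1on_M CV CE) Cd))) => z Uz.
- by [].
- have [_ _ _ s0 _] := lower_facts a0 Uz.2.
  rewrite /lay_x /lay_q /lay_r /lay_d /lay /lay_E /ell_sx.
  by field; rewrite !gt_eqF.
- have [_ _ _ s0 _] := lower_facts a0 Uz.2.
  rewrite /lay_y /lay_q /lay_r /lay_d /lay /lay_E /ell_sy.
  by field; rewrite !gt_eqF.
Qed.

Lemma lay_factors z : E z -> lower z ->
  [/\ 0 < s z <= 1, 0 < lay_E z <= 1, 0 < rho - r z < rho & `|q z| <= 1].
Proof.
move=> Ez Lz; have [_ q1 _ s0 _] := lower_facts a0 Lz.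
have [/andP[r1 r2] _ _] := lower_geometry B0 BA a0 rho0 aA aB Ez Lz.
have A0 : 0 < A by exact: lt_trans BA.
rewrite s0 expR_gt0 (ltW (ell_q_norm_lt1 Lz)); split => //.
- rewrite -[leRHS]sqrtr1 ler_wsqrtr // gerBl sqr_ge0 //.
- by rewrite -[leRHS]expR0 ler_expR oppr_le0 mulr_ge0 ?divr_ge0 ?mulr_ge0 ?ltW // subr_gt0.
- by apply/andP; split; lra.
Qed.

Lemma lay_le z : E z -> lower z ->
  [/\ `|lay z| <= K ^+ 2 * s z ^+ 2 * lay_E z,
      `|lay_d z| <= K ^+ 2 * s z ^+ 2 * lay_E z &
      `|lay_q z| <= K ^+ 2 * lay_E z * (1 + A * (s z * (rho - r z) / eps))].
Proof.
move=> Ez Lz; have [/andP[s0 s1] /andP[E0 E1] Hz q1] := lay_factors Ez Lz.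
have A0 : 0 < A by exact: lt_trans BA.
have [_ _ vb vb'] := HV (ell_q_norm_lt1 Lz); have [_ _ db db'] := Hd Hz.
rewrite -(ell_s_sqr a0) in vb.
have /andP[H0 _] := Hz.
have key (x y : R) : `|x| <= K -> `|V (q z) * lay_E z * x| <= K ^+ 2 * s z ^+ 2 * lay_E z.
  move=> xK; rewrite !normrM (gtr0_norm E0).
  have -> : K ^+ 2 * s z ^+ 2 * lay_E z = K * s z ^+ 2 * lay_E z * K by ring.
  by apply: ler_pM => //; rewrite ?mulr_ge0 ?(ltW E0) // ler_wpM2r // ltW.
split; first by rewrite normrN; exact: key.
  exact: key.
rewrite normrN (le_trans (ler_normD _ _)) //.
have t1 : `|V' (q z) * lay_E z * delta (rho - r z)| <= K ^+ 2 * lay_E z.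
  rewrite !normrM (gtr0_norm E0).
  have -> : K ^+ 2 * lay_E z = K * lay_E z * K by ring.
  by apply: ler_pM => //; rewrite ?mulr_ge0 ?(ltW E0) // ler_wpM2r // ltW.
have t2 : `|V (q z) * lay_E z * (A / eps * (q z / s z) * (rho - r z)) * delta (rho - r z)| <=
    K ^+ 2 * lay_E z * (A * (s z * (rho - r z) / eps)).
  have -> : V (q z) * lay_E z * (A / eps * (q z / s z) * (rho - r z)) * delta (rho - r z) =
    (V (q z) * lay_E z * delta (rho - r z)) * ((A / eps * (rho - r z) / s z) * q z).
    by field; rewrite !gt_eqF.
  have -> : K ^+ 2 * lay_E z * (A * (s z * (rho - r z) / eps)) =
    (K ^+ 2 * s z ^+ 2 * lay_E z) * (A / eps * (rho - r z) / s z).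
    by field; rewrite !gt_eqF.
  rewrite normrM ler_pM //; first exact: key.
  have c0 : 0 < A / eps * (rho - r z) / s z by rewrite !mulr_gt0 ?invr_gt0.
  by rewrite normrM (gtr0_norm c0) ler_piMr // ltW.
by rewrite [leRHS]mulrDr mulr1 lerD.
Qed.

Lemma lay_off z : E z -> lower z -> 3 * rho / 4 < rho - r z ->
  [/\ lay z = 0, lay_d z = 0 & lay_q z = 0].
Proof.
move=> Ez Lz Hz; have [_ _ /andP[_ H1] _] := lay_factors Ez Lz.
have [|d0 d1] := Hd0 (x := rho - r z); first by rewrite Hz.
by rewrite /lay /lay_d /lay_q d0 d1 !mulr0 addr0 oppr0.
Qed.

(** The gradient of q is orthogonal to s grad r, so the q-derivative enters only through q_y. In
    the r-derivative, r_y and A s |grad r|^2 combine to s (A - a p) |grad r|^2, and A - a p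
    vanishes on the boundary: this cancellation is what the exponent in the corrector is made for. *)
Lemma lay_conjugate z : E z -> lower z ->
  lay_y z + A * (lay_x z * qy z - lay_y z * qx z) =
  lay_q z * qy z + lay_r z * s z * (A - a * p z) * (rx z ^+ 2 + ry z ^+ 2).
Proof.
move=> Ez Lz; have [I1 I2 I3] := ell_conjugate a0 Lz.
rewrite /lay_x /lay_y -I1 (_ : qx z = - (s z * ry z)); last by rewrite I2 opprK.
transitivity (lay_q z * (s z * rx z) + lay_r z * (ry z + A * s z * (rx z ^+ 2 + ry z ^+ 2))).
  ring.
by rewrite {1}I3; ring.
Qed.

Definition lay_error_cst : R := K ^+ 2 * (1 + A) * kap + K ^+ 2 * kap +
  K ^+ 2 * B * (A + rho) * (2 * kap ^+ 2).

(** All three quantities carry a factor s. In the first two it comes from grad q or from V; in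
    the last one the factor 1 / eps of the r-derivative is compensated by A - a p, which is of
    order rho - r. *)
Lemma lay_error z :
  E z -> lower z ->
  let T := s z * lay_E z * (1 + s z * (rho - r z) / eps) in
  [/\ `|lay_q z * qx z + lay_d z * rx z| <= lay_error_cst * T,
      `|lay_q z * qy z + lay_d z * ry z| <= lay_error_cst * T &
      `|lay_y z + A * (lay_x z * qy z - lay_y z * qx z)| <= lay_error_cst * T].
Proof.
move=> Ez Lz T; rewrite lay_conjugate //; set L := lay_error_cst.
have [/andP[s0 s1] /andP[E0 E1] Hz q1] := lay_factors Ez Lz.
have A0 : 0 < A by exact: lt_trans BA.
have k0 := kap_gt0; have /andP[H0 H1] := Hz.
set th := s z * (rho - r z) / eps in T *.
have th0 : 0 <= th by rewrite !mulr_ge0 ?invr_ge0 // ltW.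
have T0 : 0 <= T by rewrite !mulr_ge0 ?(ltW s0) ?(ltW E0) //; lra.
have K2 : 0 <= K ^+ 2 by rewrite sqr_ge0.
have L1 : 0 <= K ^+ 2 * (1 + A) * kap by rewrite !mulr_ge0 // ?(ltW k0) //; lra.
have L2 : 0 <= K ^+ 2 * kap by rewrite mulr_ge0 // ltW.
have L3 : 0 <= K ^+ 2 * B * (A + rho) * (2 * kap ^+ 2).
  by rewrite !mulr_ge0 ?sqr_ge0 // ?(ltW B0) //; lra.
have L0 : 0 <= L by rewrite /L /lay_error_cst; lra.
have [Hs|Hs] := ltP (3 * rho / 4) (rho - r z).
  have [l0 ld lq] := lay_off Ez Lz Hs.
  by rewrite /lay_r l0 ld lq !mul0r !mulr0 !addr0 !mul0r !addr0 normr0; split; rewrite mulr_ge0.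
have [ah _] := layer_support Ez Lz Hs.
have [lb ldb lqb] := lay_le Ez Lz.
have [rxb ryb qxb qyb] := ell_grad_bounds a0 Lz.
have [_ _ h0 _ _] := lower_facts a0 Lz.
have rxk : `|rx z| <= kap by exact: le_trans ah.
have ryk : `|ry z| <= kap by exact: le_trans ah.
have qxk : `|qx z| <= s z * kap by rewrite (le_trans qxb) // ler_pM2l.
have qyk : `|qy z| <= s z * kap by rewrite (le_trans qyb) // ler_pM2l.
have KE : 0 <= K ^+ 2 * lay_E z by rewrite mulr_ge0 // ltW.
have Tq (g : R) : `|g| <= s z * kap -> `|lay_q z * g| <= K ^+ 2 * (1 + A) * kap * T.
  move=> gb; rewrite normrM.
  have e1 : `|lay_q z| <= K ^+ 2 * lay_E z * ((1 + A) * (1 + th)).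
    rewrite (le_trans lqb) // ler_wpM2l //.
    rewrite -/th; lra.
  apply: le_trans (ler_pM _ _ e1 gb) _ => //.
  rewrite /T; lra.
have Td (g : R) : `|g| <= kap -> `|lay_d z * g| <= K ^+ 2 * kap * T.
  move=> gb; rewrite normrM.
  have e1 : `|lay_d z| <= K ^+ 2 * T.
    apply: le_trans ldb _.
    have -> : K ^+ 2 * s z ^+ 2 * lay_E z = K ^+ 2 * (s z * lay_E z) * s z by ring.
    have -> : K ^+ 2 * T = K ^+ 2 * (s z * lay_E z) * (1 + th) by rewrite /T; ring.
    rewrite ler_wpM2l //; last lra.
    by rewrite mulr_ge0 // mulr_ge0 // ltW.
  apply: le_trans (ler_pM _ _ e1 gb) _ => //.
  by lra.
have step1 (g1 g2 : R) : `|g1| <= s z * kap -> `|g2| <= kap -> `|lay_q z * g1 + lay_d z * g2| <= L * T.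
  move=> b1 b2; rewrite (le_trans (ler_normD _ _)) //.
  by apply: le_trans (lerD (Tq _ b1) (Td _ b2)) _; rewrite -mulrDl ler_wpM2r // /L /lay_error_cst; lra.
split; [exact: step1|exact: step1|].
have /andP[r1 r2] : 0 <= r z <= rho by apply/andP; split; lra.
have /andP[g0 g1] := ell_p_gap a0 aA aB r1 r2.
(* the factor A s / eps of lay_r meets A - a p <= B (rho - r) *)
have lr : `|lay_r z * s z * (A - a * p z)| <= K ^+ 2 * B * (A + rho) * T.
  rewrite !normrM (gtr0_norm s0) (ger0_norm g0).
  have e1 : `|lay_r z| <= K ^+ 2 * s z ^+ 2 * lay_E z * (A * s z / eps + 1).
    rewrite /lay_r (le_trans (ler_normD _ _)) // mulrDr mulr1 lerD //.
    rewrite normrM gtr0_norm; last by rewrite !mulr_gt0 ?invr_gt0.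
    by rewrite mulrC ler_wpM2r // ltW // !mulr_gt0 ?invr_gt0.
  have e2 : `|lay_r z| * s z * (A - a * p z) <=
     K ^+ 2 * s z ^+ 2 * lay_E z * (A * s z / eps + 1) * s z * (B * (rho - r z)).
    apply: ler_pM => //; first by rewrite mulr_ge0 // ltW.
    by rewrite ler_wpM2r // ltW.
  apply: le_trans e2 _.
  have -> : K ^+ 2 * s z ^+ 2 * lay_E z * (A * s z / eps + 1) * s z * (B * (rho - r z)) =
    K ^+ 2 * B * (s z * lay_E z) * (s z ^+ 2 * (A * th + (rho - r z))).
    by rewrite /th; ring.
  have -> : K ^+ 2 * B * (A + rho) * T = K ^+ 2 * B * (s z * lay_E z) * ((A + rho) * (1 + th)).
    by rewrite /T; ring.
  rewrite ler_wpM2l //; first by rewrite !mulr_ge0 // ltW.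
  have X0 : 0 <= A * th + (rho - r z) by have := mulr_ge0 (ltW A0) th0; lra.
  have X1 : s z ^+ 2 * (A * th + (rho - r z)) <= 1 * (A * th + (rho - r z)).
    by rewrite ler_wpM2r // expr2 mulr_ile1 // ltW.
  have Y1 : 0 <= rho * th by rewrite mulr_ge0 // ltW.
  lra.
have sq : `|rx z ^+ 2 + ry z ^+ 2| <= 2 * kap ^+ 2.
  rewrite ger0_norm ?addr_ge0 ?sqr_ge0 //.
  have sqb (g : R) : `|g| <= kap -> g ^+ 2 <= kap ^+ 2.
    by move=> gk; rewrite -(real_normK (num_real g)) ler_sqr ?nnegrE // ltW.
  have := sqb _ rxk; have := sqb _ ryk; lra.
rewrite (le_trans (ler_normD _ _)) //.
have e3 : `|lay_r z * s z * (A - a * p z) * (rx z ^+ 2 + ry z ^+ 2)| <=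
    K ^+ 2 * B * (A + rho) * T * (2 * kap ^+ 2).
  by rewrite normrM ler_pM.
apply: le_trans (lerD (Tq _ qyk) e3) _.
have -> : K ^+ 2 * (1 + A) * kap * T + K ^+ 2 * B * (A + rho) * T * (2 * kap ^+ 2) =
  (K ^+ 2 * (1 + A) * kap + K ^+ 2 * B * (A + rho) * (2 * kap ^+ 2)) * T by ring.
rewrite ler_wpM2r // /L /lay_error_cst; lra.
Qed.

(** The constant depends on eps and serves for gluing alone. On the support of the cut-off
    function s is of order |y|, which also controls the second derivatives of q, singular at the
    foci like the inverse distance. *)
Lemma lay_small : exists L : R, forall z, E z -> lower z ->
  [/\ `|lay z| <= L * z.2 ^+ 2, `|lay_x z| <= L * `|z.2|, `|lay_y z| <= L * `|z.2| &
      `|lay z| * (focal (- a) z)^-1 <= L * `|z.2| /\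
      `|lay z| * (focal a z)^-1 <= L * `|z.2|].
Proof.
have A0 : 0 < A by exact: lt_trans BA.
have k0 := kap_gt0.
have K2 : 0 <= K ^+ 2 by rewrite sqr_ge0.
pose M := K ^+ 2 * (1 + A * (rho / eps)).
have re : 0 <= rho / eps by rewrite divr_ge0 // ltW.
have Are : 0 <= A * (rho / eps) by rewrite mulr_ge0 // ltW.
have M0 : 0 <= M by rewrite mulr_ge0 // addr_ge0.
pose M1 := K ^+ 2 * (A / eps + 1).
have M10 : 0 <= M1 by rewrite mulr_ge0 // addr_ge0 // divr_ge0 // ltW.
pose L := (M + M1 + K ^+ 2) * kap ^+ 2.
have kk : 0 <= kap ^+ 2 by rewrite sqr_ge0.
have L0 : 0 <= L by rewrite mulr_ge0 //; lra.
exists L => z Ez Lz.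
have [/andP[s0 s1] /andP[E0 E1] Hz q1] := lay_factors Ez Lz.
have y0 : 0 < `|z.2| by rewrite normr_gt0 lt_eqF.
have [Hs|Hs] := ltP (3 * rho / 4) (rho - r z).
  have [l0 ld lq] := lay_off Ez Lz Hs.
  rewrite /lay_x /lay_y /lay_r l0 ld lq !mul0r !mulr0 !addr0 !mul0r !addr0 normr0 !mul0r.
  have Ly2 : 0 <= L * z.2 ^+ 2 by rewrite mulr_ge0 // sqr_ge0.
  have Ly : 0 <= L * `|z.2| by rewrite mulr_ge0.
  by split.
have [ah sy] := layer_support Ez Lz Hs.
have [lb ldb lqb] := lay_le Ez Lz.
have [rxb ryb qxb qyb] := ell_grad_bounds a0 Lz.
have /andP[H0 H1] := Hz.
have ls : `|lay z| <= K ^+ 2 * s z ^+ 2.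
  by rewrite (le_trans lb) // ler_piMr // mulr_ge0 // sqr_ge0.
have lds : `|lay_d z| <= K ^+ 2 * s z ^+ 2.
  by rewrite (le_trans ldb) // ler_piMr // mulr_ge0 // sqr_ge0.
have s2 : s z ^+ 2 <= kap ^+ 2 * z.2 ^+ 2.
  rewrite -exprMn -(real_normK (num_real (kap * z.2))) normrM (gtr0_norm k0).
  by rewrite ler_sqr ?nnegrE ?mulr_ge0 // ltW.
have shr : s z * (rho - r z) / eps <= rho / eps.
  rewrite ler_pM2r ?invr_gt0 // -[leRHS]mul1r ler_pM //; lra.
have lqs : `|lay_q z| <= M.
  apply: le_trans lqb _; rewrite /M -mulrA ler_wpM2l //.
  have h1 : 1 + A * (s z * (rho - r z) / eps) <= 1 + A * (rho / eps).
    by rewrite lerD2l ler_pM2l.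
  have h0 : 0 <= 1 + A * (s z * (rho - r z) / eps).
    by rewrite addr_ge0 // mulr_ge0 ?(ltW A0) // !mulr_ge0 ?invr_ge0 // ltW.
  by apply: le_trans h1; rewrite ler_piMl.
have lrs : `|lay_r z| <= M1 * s z.
  rewrite /lay_r (le_trans (ler_normD _ _)) //.
  have As : 0 < A * s z / eps by rewrite !mulr_gt0 ?invr_gt0.
  have b1 : `|A * s z / eps * lay z| <= K ^+ 2 * (A / eps) * s z.
    rewrite normrM (gtr0_norm As).
    have -> : K ^+ 2 * (A / eps) * s z = A * s z / eps * K ^+ 2 by ring.
    by rewrite ler_pM2l // (le_trans ls) // ler_piMr // expr2 mulr_ile1 // ltW.
  have b2 : `|lay_d z| <= K ^+ 2 * s z.
    by rewrite (le_trans lds) // ler_wpM2l // expr2 ler_piMl // ltW.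
  rewrite /M1 mulrDr mulr1 mulrDl; exact: lerD.
have Kk : 0 <= K ^+ 2 * kap ^+ 2 by rewrite mulr_ge0.
have rxk : `|rx z| <= kap by exact: le_trans ah.
have ryk : `|ry z| <= kap by exact: le_trans ah.
have qxk : `|qx z| <= s z * kap by rewrite (le_trans qxb) // ler_pM2l.
have qyk : `|qy z| <= s z * kap by rewrite (le_trans qyb) // ler_pM2l.
have dd (g1 g2 : R) : `|g1| <= s z * kap -> `|g2| <= kap ->
    `|lay_q z * g1 + lay_r z * g2| <= L * `|z.2|.
  move=> b1 b2; rewrite (le_trans (ler_normD _ _)) // !normrM.
  have c1 : `|lay_q z| * `|g1| <= M * (s z * kap) by rewrite ler_pM.
  have c2 : `|lay_r z| * `|g2| <= M1 * s z * kap by rewrite ler_pM.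
  have c3 : (M + M1) * kap * s z <= (M + M1) * kap * (kap * `|z.2|).
    by rewrite ler_wpM2l // mulr_ge0 ?(ltW k0) //; lra.
  have c4 : 0 <= K ^+ 2 * kap ^+ 2 * `|z.2| by rewrite mulr_ge0.
  by rewrite /L; lra.
have lf (m : R) : `|z.2| <= m -> `|lay z| * m^-1 <= L * `|z.2|.
  move=> ym; have m0 : 0 < m by exact: lt_le_trans ym.
  rewrite ler_pdivrMr // (le_trans ls) //.
  have c1 : K ^+ 2 * s z ^+ 2 <= K ^+ 2 * (kap ^+ 2 * z.2 ^+ 2) by rewrite ler_wpM2l.
  have c2 : K ^+ 2 * kap ^+ 2 * `|z.2| * `|z.2| <= K ^+ 2 * kap ^+ 2 * `|z.2| * m.
    by rewrite ler_wpM2l // mulr_ge0.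
  have c3 : 0 <= (M + M1) * kap ^+ 2 * (`|z.2| * m).
    by rewrite mulr_ge0 ?mulr_ge0 ?(ltW m0) //; lra.
  rewrite -(real_normK (num_real z.2)) in c1.
  by rewrite /L; lra.
have fy c := @focal_ge_snd R c z.
split; [|exact: dd|exact: dd|by split; apply: lf].
have c1 : K ^+ 2 * s z ^+ 2 <= K ^+ 2 * (kap ^+ 2 * z.2 ^+ 2) by rewrite ler_wpM2l.
have c2 : 0 <= (M + M1) * kap ^+ 2 * z.2 ^+ 2.
  by rewrite mulr_ge0 ?sqr_ge0 // mulr_ge0 //; lra.
by rewrite /L; lra.
Qed.

(** Extension by zero to the upper half plane, where the corrector vanishes. *)
Definition low (g : R * R -> R) z := if z.2 < 0 then g z else 0 : R.

Lemma lowE g z : lower z -> low g z = g z.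
Proof. by rewrite /lower /low /= => ->. Qed.

Lemma low0 g z : ~ lower z -> low g z = 0.
Proof. by rewrite /lower /low /= => /negP/negbTE ->. Qed.

Lemma C1on_low (f f1 f2 : R * R -> R) (M : R) : C1on (E `&` lower) f f1 f2 ->
  (forall z, E z -> lower z -> [/\ `|f z| <= M * z.2 ^+ 2,
     `|f1 z| <= M * `|z.2| & `|f2 z| <= M * `|z.2|]) ->
  C1on E (low f) (low f1) (low f2).
Proof.
move=> Cf fM; apply: (@C1on_glue _ _ _ _ _ M); first exact: open_ellipse.
- have oU : open (E `&` lower) by apply: openI; [exact: open_ellipse|exact: open_lower].
  by apply: (C1on_eq oU Cf) => z [_ Lz]; rewrite lowE.
- by move=> z Ez Lz; rewrite !lowE //; exact: fM.
- by move=> z Lz; rewrite !low0.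
Qed.

Lemma C1on_low_lay : C1on E (low lay) (low lay_x) (low lay_y).
Proof.
have [M HM] := lay_small.
apply: (C1on_low (M := M) (C1on_lay)) => z Ez Lz.
by have [] := HM z Ez Lz.
Qed.

(** The components of the field lay times A s grad r, written with the derivatives of q so that no
    second derivative of r is needed. *)
Lemma C1on_low_flux (g g1 g2 : R * R -> R) : C1on lower g g1 g2 ->
  (forall z, lower z -> `|g z| <= a^-1) ->
  (forall z, lower z -> `|g1 z| <= (focal (- a) z)^-1 / a + (focal a z)^-1 / a /\
     `|g2 z| <= (focal (- a) z)^-1 / a + (focal a z)^-1 / a) ->
  C1on E (low (fun z => lay z * (A * g z)))
    (low (fun z => lay_x z * (A * g z) + lay z * (A * g1 z)))
    (low (fun z => lay_y z * (A * g z) + lay z * (A * g2 z))).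
Proof.
move=> Cg g0b g12.
have A0 : 0 < A by exact: lt_trans BA.
have [M HM] := lay_small.
have oU : open (E `&` lower) by apply: openI; [exact: open_ellipse|exact: open_lower].
have Cg' : C1on (E `&` lower) g g1 g2 by move=> z [_ Lz]; exact: Cg.
have CA := C1on_M (@C1on_cst R (E `&` lower) A) Cg'.
have CL := C1on_M (C1on_lay) CA.
have a'0 : 0 < a^-1 by rewrite invr_gt0.
apply: (C1on_low (M := 3 * (M * (A * a^-1)))).
  by apply: (C1on_eq oU CL) => z Uz //; rewrite mul0r add0r.
move=> z Ez Lz; have [l0 l1 l2 [l3 l4]] := HM z Ez Lz.
have gb := g0b z Lz; have [gb1 gb2] := g12 z Lz.
have Ag (u l : R) : `|u| <= l -> `|u * (A * g z)| <= l * (A * a^-1).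
  move=> ul; rewrite normrM ler_pM // normrM (gtr0_norm A0).
  by rewrite ler_pM2l.
have Ah (k : R) : `|k| <= (focal (- a) z)^-1 / a + (focal a z)^-1 / a ->
    `|lay z * (A * k)| <= 2 * (M * (A * a^-1)) * `|z.2|.
  move=> kb; rewrite !normrM (gtr0_norm A0).
  have n0 := normr_ge0 (lay z).
  have e1 : `|lay z| * (A * `|k|) <= `|lay z| * (A * ((focal (- a) z)^-1 / a + (focal a z)^-1 / a)).
    by rewrite ler_wpM2l // ler_pM2l.
  apply: le_trans e1 _.
  have -> : `|lay z| * (A * ((focal (- a) z)^-1 / a + (focal a z)^-1 / a)) =
    (A * a^-1) * (`|lay z| / focal (- a) z + `|lay z| / focal a z) by ring.
  have -> : 2 * (M * (A * a^-1)) * `|z.2| = (A * a^-1) * (M * `|z.2| + M * `|z.2|) by ring.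
  by rewrite ler_pM2l ?mulr_gt0 // lerD.
split.
- have h1 := Ag _ _ l0; have : 0 <= M * z.2 ^+ 2 * (A * a^-1).
    by rewrite (le_trans _ h1).
  lra.
- rewrite (le_trans (ler_normD _ _)) //; have h1 := Ag _ _ l1; have h2 := Ah _ gb1; lra.
- rewrite (le_trans (ler_normD _ _)) //; have h1 := Ag _ _ l2; have h2 := Ah _ gb2; lra.
Qed.

(** For y < 0 take tau = 2 pi - acos q, for y >= 0 take tau = acos q. In the second case the
    characteristic function only sees tau = pi, where the factor u0 (- A, 0) is zero. *)
Lemma corrector_low u0 phi z : corrector A a rho eps u0 delta phi ->
  (forall k : R, `|k| < 1 -> u0 (A * k, - (B * Num.sqrt (1 - k ^+ 2))) = V k) ->
  u0 (- A, 0) = 0 -> E z -> phi z = low lay z.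
Proof.
move=> Hphi u0V u0A Ez.
have p1 := ell_p_ge1 a0 z.
have /andP[r0 r1] := ell_r_lt B0 BA a0 rho0 aA aB Ez.
have Q1 := ell_q_sqr_le1 a0 z.
have Qi : -1 <= q z <= 1.
  by rewrite -ler_norml -(expr_le1 (n := 2)) // real_normK ?num_real.
have [/andP[t0 t1] ct] := acos_def Qi.
have st := sin_acos Qi.
have Hr : a * coshR (r z) = a * p z by rewrite coshR_arcosh.
have Hh : a * sinhR (r z) = a * h z by rewrite sinhR_arcosh.
have eta : 0 <= rho - r z <= rho by apply/andP; split; lra.
have pp := pi_gt0 R.
have tp : 2 * pi = pi *+ 2 :> R by rewrite mulrC mulr_natr.
have [Lz|nLz] := pselect (lower z).
  have [_ q1 h0 s0 yE] := lower_facts a0 Lz.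
  have tau : 0 <= 2 * pi - acos (q z) <= 2 * pi by apply/andP; split; lra.
  have c2 : cos (2 * pi - acos (q z)) = q z.
    by rewrite tp cosB cos2pi sin2pi mul1r mul0r addr0.
  have s2 : sin (2 * pi - acos (q z)) = - s z.
    by rewrite tp sinB cos2pi sin2pi mul0r sub0r mul1r st.
  have := Hphi _ _ eta tau.
  rewrite lowE // /elliptic c2 s2 subKr Hr Hh aA aB.
  have -> : (a * p z * q z, a * h z * - s z) = z.
    by rewrite -(ell_x a0) mulrN -yE -surjective_pairing.
  rewrite mulrN u0V; last by exact: ell_q_norm_lt1.
  rewrite indicE mem_set /=; last by rewrite in_itv /=; apply/andP; split; lra.
  rewrite mulr1 /lay /lay_E => ->.
  by rewrite mulrN !mulNr.
have y0 : 0 <= z.2 by rewrite leNgt; exact/negP.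
rewrite low0 //.
have tau : 0 <= acos (q z) <= 2 * pi by apply/andP; split; lra.
have := Hphi _ _ eta tau.
rewrite /elliptic ct st subKr Hr Hh aA aB.
have -> : (a * p z * q z, a * h z * Num.sqrt (1 - q z ^+ 2)) = z.
  rewrite -(ell_x a0) [RHS]surjective_pairing; congr pair.
  have h0 : 0 <= h z by exact: sqrtr_ge0.
  have s0 : 0 <= s z by exact: sqrtr_ge0.
  have y1 : 0 <= a * h z * s z by rewrite mulr_ge0 // mulr_ge0 // ltW.
  apply/eqP; rewrite -(eqrXn2 (_ : 0 < 2)%N y1 y0) // (ell_y a0) -ell_h_sqr // -ell_s_sqr //.
  by apply/eqP; ring.
move=> ->.
rewrite indicE; case: (boolP (acos (q z) \in _)) => [/set_mem|_]; last by rewrite mulr0 mul0r.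
rewrite /= in_itv /= => /andP[t2 _].
have qN : q z = -1 by rewrite -ct (_ : acos _ = pi) ?cospi //; apply/eqP; rewrite eq_le t1.
by rewrite qN mulrN1 sqrrN expr1n subrr sqrtr0 mulr0 u0A oppr0 !mul0r.
Qed.

Lemma boundary_coordinates z : ellipse_bd A B z ->
  [/\ p z = coshR rho, r z = rho, z.1 = A * q z & C z.1 = `|z.2|].
Proof.
move=> bz; have A0 : 0 < A by exact: lt_trans BA.
have p1 := ell_p_ge1 a0 z; have Q1 := ell_q_sqr_le1 a0 z.
have := @ell_defect R A B a rho B0 BA a0 aA aB z.
rewrite (_ : z.1 ^+ 2 / A ^+ 2 + z.2 ^+ 2 / B ^+ 2 = 1); last exact: bz.
rewrite subrr mulr0 => /esym/eqP; rewrite mulf_eq0 => /orP[/eqP D0|/eqP F0]; last first.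
  have k0 : 0 < B ^+ 2 / A ^+ 2 by rewrite divr_gt0 ?exprn_gt0.
  have k1 : 0 <= B ^+ 2 / A ^+ 2 * q z ^+ 2 by rewrite mulr_ge0 ?sqr_ge0 // ltW.
  have q1 : q z ^+ 2 = 1 by lra.
  by move: F0; rewrite q1; lra.
have ap : a * p z = A.
  have a1 : 0 <= a * p z by rewrite mulr_ge0 ?(ltW a0) //; lra.
  apply/eqP; rewrite -(eqrXn2 (_ : 0 < 2)%N a1 (ltW A0)) //; apply/eqP; lra.
have pE : p z = coshR rho by apply: (mulfI (lt0r_neq0 a0)); rewrite ap.
split=> //; first by rewrite /ell_r pE arcosh_coshR // ltW.
  by rewrite {1}(ell_x a0) ap.
have xA : `|z.1| <= A.
  rewrite -ler_sqr ?nnegrE ?(ltW A0) // real_normK ?num_real //.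
  by rewrite (ell_x a0) ap exprMn ler_piMr // sqr_ge0.
have Cz0 : 0 <= C z.1 by exact: Cu_ge0.
apply/eqP; rewrite -(eqrXn2 (_ : 0 < 2)%N Cz0 (normr_ge0 _)) // real_normK ?num_real //.
rewrite Cu_sqr //; apply/eqP.
have := bz; rewrite /ellipse_bd /= => <-; field.
by rewrite !gt_eqF.
Qed.

Lemma profile_lipschitz (x y : R) : `|x| < 1 -> `|y| < 1 -> `|V x - V y| <= K * `|x - y|.
Proof.
wlog yx : x y / y <= x => [H x1 y1|x1 y1].
  have [yx|/ltW xy] := leP y x; first exact: H.
  by rewrite distrC (distrC x); exact: H.
rewrite (ger0_norm (_ : 0 <= x - y)) ?subr_ge0 //.
have in1 t : y <= t <= x -> `|t| < 1.
  move: x1 y1; rewrite !ltr_norml => /andP[? ?] /andP[? ?] /andP[? ?].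
  by apply/andP; split; lra.
apply: (@lipschitz_segment _ V V') => //.
  by move=> t /andP[t1 t2]; have [|dV _ _ bV] := HV (q := t); first by apply: in1; rewrite !ltW.
apply: continuous_in_subspaceT => t; rewrite inE /= in_itv /= => /in1 /HV [dV _ _ _].
by apply: differentiable_continuous; apply/derivable1_diffP; case: dV.
Qed.

Lemma continuous_fstE (z : R * R) : {for z, continuous (fun x : R * R => C x.1)}.
Proof.
apply: (@continuous_comp _ _ _ (fun z : R * R => z.1) C); first exact: cvg_fst.
exact: continuous_Cu.
Qed.

Context {u0 : R * R -> R} {M : R}.
Context (HU : forall z, E z -> `|u0 z| <= M * (C z.1 - z.2)).
Context (HT : forall z, E z -> `|u0 z - V (z.1 / A)| <= M * (z.2 + C z.1)).

(** On the upper boundary and at the two end points u0 and the corrector are small separately. On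
    the lower boundary u0 (x, y) tends to V (x / A), and the corrector to the opposite value because
    q and x / A agree there and the exponent is zero. *)
Lemma sum_decay z : ellipse_bd A B z -> exists g : R * R -> R,
  [/\ {for z, continuous g}, g z = 0 &
      \forall x \near z, E x -> `|u0 x + low lay x| <= g x].
Proof.
move=> bz; have [pz rz xz Cz] := boundary_coordinates bz.
have A0 : 0 < A by exact: lt_trans BA.
have cC := @continuous_fstE z.
have cy : {for z, continuous (fun x : R * R => x.2)} by exact: cvg_snd.
have [y0|y0|y0] := ltgtP z.2 0.
- have cr : {for z, continuous r}.
    apply: continuous_ell_r => //; rewrite lt_neqAle (ell_p_ge1 a0) andbT.
    apply/eqP => p1; have := coshR_sinhR rho; rewrite -pz -p1.
    have := exprn_gt0 2 (sinhR_gt0 rho0); lra.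
  have cH : {for z, continuous (fun x => rho - r x)}.
    by apply: cvgB => //; exact: cvg_cst.
  have cs : {for z, continuous s}.
    apply: (@continuous_comp _ _ _ (fun x => 1 - q x ^+ 2) Num.sqrt).
      apply: cvgB; first exact: cvg_cst.
      apply: (@continuous_comp _ _ _ q (fun x => x ^+ 2)); first exact: continuous_ell_q.
      exact: exprn_continuous.
    exact: sqrt_continuous.
  have cE : {for z, continuous lay_E}.
    apply: (@continuous_comp _ _ _ (fun x => - (A * s x / eps * (rho - r x))) expR).
      apply: cvgN; apply: cvgM => //.
      by apply: cvgM; [apply: cvgM => //; exact: cvg_cst|exact: cvg_cst].
    exact: continuous_expR.
  exists (fun x => M * (x.2 + C x.1) + K * `|x.1 / A - q x| + K * (1 - lay_E x)); split.
  + apply: cvgD; first apply: cvgD.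
    * by apply: cvgM; [exact: cvg_cst|exact: cvgD].
    * apply: cvgM; first exact: cvg_cst.
      apply: (@continuous_comp _ _ _ (fun x : R * R => x.1 / A - q x) (fun x => `|x|)).
        apply: cvgB; last exact: continuous_ell_q.
        by apply: cvgM; [exact: cvg_fst|exact: cvg_cst].
      exact: norm_continuous.
    * by apply: cvgM; [exact: cvg_cst|apply: cvgB => //; exact: cvg_cst].
  + rewrite Cz (ltr0_norm y0) subrr mulr0 add0r /lay_E rz subrr mulr0 oppr0 expR0.
    by rewrite subrr mulr0 addr0 {1}xz mulrAC divff ?gt_eqF // mul1r subrr normr0 mulr0.
  + have nL : \forall x \near z, lower x by apply: (near_lt_at cy).
    have nH : \forall x \near z, rho - r x < rho / 2.
      by apply: (near_lt_at cH); rewrite rz subrr divr_gt0.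
    apply: filterS2 nL nH => x Lx Hx Ex.
    have q1 := ell_q_norm_lt1 Lx.
    have [xA _] := (ellipseE A0 B0 x).1 Ex.
    have xA1 : `|x.1 / A| < 1.
      by rewrite normrM normfV (gtr0_norm A0) ltr_pdivrMr // mul1r.
    have [_ /andP[E0 E1] /andP[H0 H1] _] := lay_factors Ex Lx.
    rewrite lowE // /lay Hd1 ?mulr1; last by rewrite !ltW.
    (* near the boundary the cut-off function is 1 *)
    have -> : u0 x + - (V (q x) * lay_E x) =
      (u0 x - V (x.1 / A)) + (V (x.1 / A) - V (q x)) + V (q x) * (1 - lay_E x) by ring.
    rewrite (le_trans (ler_normD _ _)) // lerD //.
      by rewrite (le_trans (ler_normD _ _)) // lerD //; [exact: HT|exact: profile_lipschitz].
    rewrite normrM (ger0_norm (_ : 0 <= 1 - lay_E x)) ?subr_ge0 //.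
    rewrite ler_wpM2r ?subr_ge0 //.
    have [_ _ Vb _] := HV q1; rewrite (le_trans Vb) // ler_piMr //.
    by rewrite gerBl sqr_ge0.
- exists (fun x => M * (C x.1 - x.2)); split.
  + by apply: cvgM; [exact: cvg_cst|exact: cvgB].
  + by rewrite Cz gtr0_norm // subrr mulr0.
  + have nL : \forall x \near z, 0 < x.2 by apply: (near_gt_at cy).
    apply: filterS nL => x x0 Ex; rewrite low0 ?addr0; first exact: HU.
    by rewrite /lower /= => /lt_trans /(_ x0); rewrite ltxx.
- exists (fun x => M * (C x.1 - x.2) + K ^+ 2 / B ^+ 2 * C x.1 ^+ 2); split.
  + apply: cvgD; first by apply: cvgM; [exact: cvg_cst|exact: cvgB].
    apply: cvgM; first exact: cvg_cst.
    apply: (@continuous_comp _ _ _ (fun x : R * R => C x.1) (fun x => x ^+ 2)) => //.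
    exact: exprn_continuous.
  + by rewrite Cz y0 normr0 subrr expr0n /= !mulr0 addr0.
  + near=> x => Ex; rewrite (le_trans (ler_normD _ _)) // lerD //; first exact: HU.
    have [Lx|nLx] := pselect (lower x); last first.
      by rewrite low0 // normr0 mulr_ge0 ?divr_ge0 ?sqr_ge0.
    have [lb _ _] := lay_le Ex Lx.
    have [/andP[s0 s1] /andP[E0 E1] _ _] := lay_factors Ex Lx.
    have [_ Bs _] := lower_geometry B0 BA a0 rho0 aA aB Ex Lx.
    rewrite lowE // (le_trans lb) //.
    have e1 : K ^+ 2 * s x ^+ 2 * lay_E x <= K ^+ 2 * s x ^+ 2.
      by rewrite ler_piMr // mulr_ge0 // sqr_ge0.
    rewrite (le_trans e1) // -mulrA ler_wpM2l ?sqr_ge0 // ler_pdivlMl ?exprn_gt0 //.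
    by rewrite -exprMn ler_sqr ?nnegrE ?(le_trans _ Bs) // mulr_ge0 // ltW.
Unshelve. all: by end_near. Qed.

Context {u01 f : R * R -> R}.
Context (Cu0 : C1on E u0 u01 (fun z => - f z)).
Context (u01M : forall z, E z -> `|u01 z| <= M) (fM : forall z, E z -> `|f z| <= M).
Context {u d10 d01 d20 d11 d02 : R * R -> R}.
Context (Cu : C1on E u d10 d01) (Cd10 : C1on E d10 d20 d11) (Cd01 : C1on E d01 d11 d02).
Context (uE : forall z, E z -> - eps * (d20 z + d02 z) - d01 z = f z).
Context (cu : {within closure E, continuous u}) (ub : forall z, ellipse_bd A B z -> u z = 0).
Context (e8 : eps <= 8^-1).
Local Notation plane := (measurableTypeR R * measurableTypeR R)%type.

Local Notation v := (fun z => u z - u0 z - low lay z).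

Definition layer_constant : R := 6 * (lay_error_cst ^+ 2 *
  ((B ^- 2 + 1) * (1 + 2 * A * B) ^+ 2 * (1 + 2 / A) ^+ 4)).

Lemma C1on_remainder : C1on E v (fun z => d10 z - u01 z - low lay_x z)
  (fun z => d01 z + f z - low lay_y z).
Proof.
have CL := C1on_low_lay.
have oE : open E by exact: open_ellipse.
apply: (C1on_eq oE (C1on_D (C1on_D Cu (C1on_N Cu0)) (C1on_N CL))) => z _ //.
by rewrite opprK.
Qed.

Lemma remainder_decay z : ellipse_bd A B z -> forall e : R, 0 < e ->
  \forall x \near z, E x -> `|v x| <= e.
Proof.
move=> bz e e1.
have A0 : 0 < A by exact: lt_trans BA.
have [g [cg gz ng]] := sum_decay bz.
have clz : closure E z by apply: closure_ellipse => //; rewrite (_ : _ + _ = 1).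
have e2 : 0 < e / 2 by rewrite divr_gt0.
have n1 : \forall x \near z, closure E x -> `|u x| < e / 2.
  have := ((@subspace_continuousP _ _ _ u).1 cu) z clz; rewrite ub // => /cvgrPdist_lt /(_ _ e2).
  by rewrite near_withinE; apply: filterS => x H /H; rewrite sub0r normrN.
have n2 : \forall x \near z, g x < e / 2 by apply: (near_lt_at cg); rewrite gz.
near=> x => Ex.
have h1 : `|u x| < e / 2.
  by apply: (near n1 x) => //; exact: subset_closure.
have h2 : g x < e / 2 by near: x.
have h3 : `|u0 x + low lay x| <= g x by apply: (near ng x).
have -> : v x = u x - (u0 x + low lay x) by rewrite opprD addrA.
rewrite (le_trans (ler_normB _ _)) //; lra.
Unshelve. all: by end_near. Qed.

(** The energy estimate for the flux eps grad u - lay A s grad r. *)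
Lemma layer_energy :
  let w := off_ellipse0 (A := A) (B := B) v in
  continuous w /\
  (\int[lebesgue2]_(z in E) (w z ^+ 2 / 2 +
       eps * (supp_grad w (fun z => d10 z - u01 z - low lay_x z) z ^+ 2 +
              supp_grad w (fun z => d01 z + f z - low lay_y z) z ^+ 2))%:E
   <= (2 * expR A ^+ 2 * (layer_constant * (2 * A * pi) +
        4 * M ^+ 2 * fine (@lebesgue2 R (box A))) * eps)%:E)%E.
Proof.
move=> w.
have A0 : 0 < A by exact: lt_trans BA.
have oE : open E by exact: open_ellipse.
have Cv := C1on_remainder.
have cw : continuous w.
  apply: continuous_off_ellipse0; last exact: remainder_decay.
  by move=> z /Cv [].
split=> //.
have Cw : C1on E w (fun z => d10 z - u01 z - low lay_x z) (fun z => d01 z + f z - low lay_y z).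
  by apply: (C1on_eq oE Cv) => z Ez //; rewrite /w off_ellipse0_in.
have wM : supp_in A w.
  move=> z Hz; apply: off_ellipse0_out => /(ellipse_bounds A0 B0) [x1 y1].
  case/orP : Hz => [/lt_trans /(_ x1)|h1]; first by rewrite ltxx.
  by have := lt_trans (lt_trans BA h1) y1; rewrite ltxx.
have wE z : ~ E z -> w z = 0 by exact: off_ellipse0_out.
have CF1 := C1on_low_flux (C1on_ell_qy (a := a))
  (fun z Lz => (ell_q_grad_le a0 Lz).2)
  (fun z Lz => conj (ell_q2_bound a0 Lz).2.1 (ell_q2_bound a0 Lz).2.2).
have CF2 := C1on_low_flux (C1on_ell_qx (a := a))
  (fun z Lz => (ell_q_grad_le a0 Lz).1)
  (fun z Lz => conj (ell_q2_bound a0 Lz).1 (ell_q2_bound a0 Lz).2.1).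
have scal (g g1 g2 : R * R -> R) : C1on E g g1 g2 ->
    C1on E (fun z => eps * g z) (fun z => eps * g1 z) (fun z => eps * g2 z).
  move=> Cg; apply: (C1on_eq oE (C1on_M (@C1on_cst R E eps) Cg)) => z _ //;
    by rewrite mul0r add0r.
have Cm1 := C1on_D (scal _ _ _ Cd10) (C1on_N CF1).
have Cm2 := C1on_D (scal _ _ _ Cd01) CF2.
(* eps grad lay = lay A s grad r + eps (second summands of b1 and b2) *)
pose b1 z := u01 z + low (fun z => lay_q z * qx z + lay_d z * rx z) z.
pose b2 z := - f z + low (fun z => lay_q z * qy z + lay_d z * ry z) z.
pose G := low (fun z => lay_y z + A * (lay_x z * qy z - lay_y z * qx z)).
pose rr z := layer_constant * layer_at (A := A) (B := B) eps z + 4 * M ^+ 2 * eps.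
have lc0 : 0 <= layer_constant.
  have q1 : 0 <= B ^- 2 + 1 by rewrite addr_ge0 // invr_ge0 sqr_ge0.
  have q2 : 0 <= (1 + 2 / A) ^+ 4 by rewrite exprn_ge0 // addr_ge0 // divr_ge0 // ltW.
  have q3 : 0 <= (B ^- 2 + 1) * (1 + 2 * A * B) ^+ 2 by rewrite mulr_ge0 // sqr_ge0.
  rewrite /layer_constant mulr_ge0 // mulr_ge0 ?sqr_ge0 //; exact: mulr_ge0.
have rr0 z : 0 <= rr z.
  rewrite addr_ge0 // mulr_ge0 ?layer_ge0 //; last exact: ltW.
  by rewrite mulr_ge0 // sqr_ge0.
have cl : continuous (fun z => layer_constant * layer_at (A := A) (B := B) eps z).
  by move=> z; apply: cvgM; [exact: cvg_cst|exact: continuous_layer_at].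
have crr : continuous rr.
  by move=> z; apply: cvgD; [exact: cl|exact: cvg_cst].
have irr := continuous_box_integrable A crr.
have HE := @energy_estimate R E A eps w _ _ _ _ _ _ _ _ b1 b2 G rr oE wM wE cw Cw Cm1 Cm2 e0 e8 _ _ _ _ rr0 irr.
apply: le_trans (HE _ _ _ _) _.
- move=> z Ez; have := uE Ez; rewrite /G.
  have [Lz|nLz] := pselect (lower z); first by rewrite !lowE // => ue; lra.
  by rewrite !low0 // => ue; lra.
- move=> z Ez; rewrite /b1.
  have [Lz|nLz] := pselect (lower z); last by rewrite !low0 //; lra.
  rewrite !lowE //; have [I1 I2 _] := ell_conjugate a0 Lz.
  have -> : qy z = s z * rx z by [].
  rewrite /lay_x /lay_r; field; rewrite gt_eqF //.
- move=> z Ez; rewrite /b2.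
  have [Lz|nLz] := pselect (lower z); last by rewrite !low0 //; lra.
  rewrite !lowE //; have [I1 I2 _] := ell_conjugate a0 Lz.
  have -> : qx z = - (s z * ry z) by rewrite I2 opprK.
  rewrite /lay_y /lay_r; field; rewrite gt_eqF //.
- move=> z Ez.
  have sq (k m : R) : `|k| <= m -> k ^+ 2 <= m ^+ 2.
    move=> km; rewrite -(real_normK (num_real k)) ler_sqr ?nnegrE //.
    exact: le_trans km.
  have u2 := sq _ _ (u01M Ez); have f2 := sq _ _ (fM Ez).
  have M2 : 0 <= M ^+ 2 by exact: sqr_ge0.
  have e1 : eps <= 1 by rewrite (le_trans e8) // invf_le1 ?ler1n ?ltr0n.
  have sum (k m : R) : (k + m) ^+ 2 <= 2 * k ^+ 2 + 2 * m ^+ 2.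
    have := sqr_ge0 (k - m); lra.
  have fin (G2 x2 y2 Q : R) : G2 <= Q -> x2 <= Q -> y2 <= Q -> 0 <= Q ->
      6 * Q <= layer_constant * layer_at (A := A) (B := B) eps z ->
      2 * G2 + eps * ((2 * u01 z ^+ 2 + 2 * x2) + (2 * (- f z) ^+ 2 + 2 * y2)) <= rr z.
    move=> GQ xQ yQ Q0 Ql; rewrite sqrrN.
    have t1 : eps * ((2 * u01 z ^+ 2 + 2 * x2) + (2 * f z ^+ 2 + 2 * y2)) <=
       eps * (4 * M ^+ 2 + 4 * Q) by rewrite ler_pM2l //; lra.
    have t2 : eps * (4 * Q) <= 1 * (4 * Q) by rewrite ler_wpM2r // mulr_ge0.
    rewrite /rr; lra.
  have b12 : eps * (b1 z ^+ 2 + b2 z ^+ 2) <= eps * ((2 * u01 z ^+ 2 +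
      2 * (low (fun z => lay_q z * qx z + lay_d z * rx z) z) ^+ 2) + (2 * (- f z) ^+ 2 +
      2 * (low (fun z => lay_q z * qy z + lay_d z * ry z) z) ^+ 2)).
    by rewrite ler_pM2l // lerD // sum.
  apply: (@le_trans _ _ (2 * G z ^+ 2 + eps * ((2 * u01 z ^+ 2 +
      2 * (low (fun z => lay_q z * qx z + lay_d z * rx z) z) ^+ 2) + (2 * (- f z) ^+ 2 +
      2 * (low (fun z => lay_q z * qy z + lay_d z * ry z) z) ^+ 2)))); first by rewrite lerD2l.
  have [Lz|nLz] := pselect (lower z); last first.
    rewrite /G !low0 // expr0n /=; apply: (fin _ _ _ 0) => //.
    by rewrite mulr0 mulr_ge0 // layer_ge0.
  rewrite /G !lowE //.
  have [l1 l2 l3] := lay_error Ez Lz.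
  have [rr01 Bs ct] := lower_geometry B0 BA a0 rho0 aA aB Ez Lz.
  have [/andP[s0 s1] _ /andP[H0 H1] _] := lay_factors Ez Lz.
  have t0 : 0 <= z.2 + C z.1.
    have [_] := (ellipseE A0 B0 z).1 Ez; rewrite ltr_norml => /andP[h1 _]; lra.
  have lb := layer_bound A0 B0 e0 (ltW s0) (ltW H0) t0 Bs ct.
  apply: (fin _ _ _ _ (sq _ _ l3) (sq _ _ l1) (sq _ _ l2) (sqr_ge0 _)).
  rewrite /layer_constant; set Lc := (X in 6 * (X * _) ^+ 2 <= _).
  have h := ler_wpM2l (sqr_ge0 Lc) lb.
  rewrite exprMn -[leRHS]mulrA ler_pM2l // -[leRHS]mulrA; exact: h.
have mB : measurable (box A : set plane) by exact: measurable_box.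
have ml : measurable_fun (box A) (fun z : plane => (layer_constant * layer_at (A := A) (B := B) eps z)%:E).
  by have /measurable_int := continuous_box_integrable A cl.
have -> : (\int[lebesgue2]_(z in box A) (rr z)%:E =
   \int[lebesgue2]_(z in box A) (layer_constant%:E * (layer_at (A := A) (B := B) eps z)%:E) +
   \int[lebesgue2]_(z in box A) (4 * M ^+ 2 * eps)%:E)%E.
  under eq_integral do rewrite /rr EFinD EFinM.
  rewrite ge0_integralD //.
  - by move=> z _; rewrite lee_fin mulr_ge0 // layer_ge0.
  - by move=> z _; rewrite lee_fin mulr_ge0 ?(ltW e0) // mulr_ge0 // sqr_ge0.
have li := layer_integral (B := B) A0 e0.
have I0 : (0 <= \int[lebesgue2]_(z in box A) (layer_at (A := A) (B := B) eps z)%:E)%E.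
  by apply: integral_ge0 => z _; rewrite lee_fin layer_ge0.
have EM : 0 <= 2 * expR A ^+ 2 by rewrite mulr_ge0 // sqr_ge0.
have fB : (fine (@lebesgue2 R (box A)))%:E = @lebesgue2 R (box A).
  by rewrite fineK // ge0_fin_numE // box_lty.
have ml1 : measurable_fun (box A) (fun z : plane => (layer_at (A := A) (B := B) eps z)%:E).
  by have /measurable_int := continuous_box_integrable A (@continuous_layer_at R A B eps).
rewrite ge0_integralZl_EFin //; last by move=> z _; rewrite lee_fin layer_ge0.
have -> : (\int[lebesgue2]_(z in box A) (4 * M ^+ 2 * eps)%:E =
    (4 * M ^+ 2 * eps)%:E * @lebesgue2 R (box A))%E by exact: integral_cst.
move: fB; set m := fine _ => fB; rewrite -fB.
apply: (@le_trans _ _ ((2 * expR A ^+ 2)%:E * (layer_constant%:E * (2 * A * pi * eps)%:E +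
   (4 * M ^+ 2 * eps)%:E * m%:E))%E).
  by rewrite lee_wpmul2l ?lee_fin // leeD2r // lee_wpmul2l ?lee_fin.
rewrite -(EFinM layer_constant) -(EFinM (4 * M ^+ 2 * eps)) -EFinD -EFinM lee_fin.
by rewrite le_eqVlt; apply/orP; left; apply/eqP; ring.
Qed.

End boundary_layer.

(** * The convergence theorem *)

Section classical_solution.
Context {R : realType} {A B : R}.
Local Notation E := (ellipse A B).

Lemma solution_C1 (eps : R) (f u : R * R -> R) : solution A B eps f u ->
  exists d10 d01 d20 d11 d02 : R * R -> R,
  [/\ C1on E u d10 d01, C1on E d10 d20 d11, C1on E d01 d11 d02 &
      forall z, E z -> - eps * (d20 z + d02 z) - d01 z = f z].
Proof.
move=> [[D HD] _ Heq _]; have oE : open E by exact: open_ellipse.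
have [D0 _ _] := HD.
have C0 : C1on E u (D 1%N 0%N) (D 0%N 1%N).
  apply: (C1on_eq oE (partials_C1on (p := 0) (q := 0) HD oE (@subset_refl _ E) isT)) => //.
have C1 : C1on E (D 1%N 0%N) (D 2%N 0%N) (D 1%N 1%N).
  exact: (partials_C1on (p := 1) (q := 0) HD oE (@subset_refl _ E) isT).
have C2 : C1on E (D 0%N 1%N) (D 1%N 1%N) (D 0%N 2%N).
  exact: (partials_C1on (p := 0) (q := 1) HD oE (@subset_refl _ E) isT).
exists (D 1%N 0%N), (D 0%N 1%N), (D 2%N 0%N), (D 1%N 1%N), (D 0%N 2%N); split=> // z Ez.
have nE : \forall x \near z, E x by exact: open_nbhs_nbhs.
rewrite -(Heq z Ez) /laplacian.
have [_ [_ ->] _ _ _] := C0 z Ez.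
have [x2 _ _ _ _] := C1 z Ez; have [_ y2 _ _ _] := C2 z Ez.
have [_ ->] : is_derive z ex ('D_ex u) (D 2%N 0%N z).
  apply: near_eq_is_derive x2; apply: filterS nE => w Ew.
  by have [[_ ->] _ _ _ _] := C0 w Ew.
have [_ ->] : is_derive z ey ('D_ey u) (D 0%N 2%N z).
  apply: near_eq_is_derive y2; apply: filterS nE => w Ew.
  by have [_ [_ ->] _ _ _] := C0 w Ew.
by [].
Qed.

Lemma lower_boundary_values (A0 : 0 < A) (B0 : 0 < B) (f u0 : R * R -> R) :
  limit_solution A B f u0 ->
  (forall k : R, `|k| < 1 ->
     u0 (A * k, - (B * Num.sqrt (1 - k ^+ 2))) = chord_total (A := A) (B := B) (f := f) k) /\
  u0 (- A, 0) = 0.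
Proof.
move=> [_ _ _ u0b].
have kE (k : R) : 1 - (A * k) ^+ 2 / A ^+ 2 = 1 - k ^+ 2 by field; rewrite gt_eqF.
split=> [k k1|].
  have k2 : 0 <= 1 - k ^+ 2.
    by rewrite subr_ge0 -(real_normK (num_real k)) expr_le1 // ltW.
  rewrite u0b /=.
  - by rewrite /chord_total /Cu kE.
  - rewrite /ellipse_bd /= sqrrN !exprMn sqr_sqrtr //; field.
    by rewrite !gt_eqF.
  - by rewrite oppr_le0 mulr_ge0 ?sqrtr_ge0 // ltW.
rewrite u0b //=; last by rewrite /ellipse_bd /= sqrrN expr0n /= mul0r addr0 divff // gt_eqF ?exprn_gt0.
by rewrite /Cu sqrrN divff ?gt_eqF ?exprn_gt0 // subrr sqrtr0 mulr0 set_itv1 Rintegral_set1.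
Qed.

End classical_solution.

Theorem theorem4p1 (R : realType) :
  exists N : nat, (2 <= N)%N /\
  forall (A B a rho : R) (f : R * R -> R) (Df : nat -> nat -> R * R -> R)
    (u0 : R * R -> R) (delta : R -> R),
    0 < B -> B < A ->
    0 < a -> 0 < rho -> a * coshR rho = A -> a * sinhR rho = B ->
    partials N (ellipse A B) (closure (ellipse A B)) f Df ->
    (forall p1 p2 : nat, (2 * p1 + p2 <= 2)%N ->
       Df p1 p2 (A, 0) = 0 /\ Df p1 p2 (- A, 0) = 0) ->
    limit_solution A B f u0 ->
    cutoff rho delta ->
    exists kappa : R, 0 < kappa /\
      \forall eps \near (0 : R)^'+,
        forall ueps phi : R * R -> R,
          solution A B eps f ueps ->
          corrector A a rho eps u0 delta phi ->
          let w := fun z : R * R => ueps z - u0 z - phi z in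
          (L2norm (ellipse A B) w
             + (Num.sqrt eps)%:E * H1norm (ellipse A B) w
           <= (kappa * Num.sqrt eps)%:E)%E.
Proof.
exists 2%N; split=> // A B a rho f Df u0 delta B0 BA a0 rho0 aA aB fD compat Lu cut.
have A0 : 0 < A by exact: lt_trans BA.
have BA' := ltW BA.
have N0 : (0 < 2)%N by [].
have [fA fNA] := compat 0%N 0%N isT.
have [V' [K1 [K10 HV1]]] := chord_total_C1 A0 B0 BA' N0 fD fA fNA.
have [delta' [K2 [K20 dd db d0]]] := cutoff_facts rho0 cut.
have [_ d1 _] := cut.
have [M [K3 [M0 K30 b0 b1 b2]]] := data_le_Cu A0 B0 BA' N0 fD fA fNA.
have Cd := data_C1 N0 fD.
have Cu0 := limit_solution_C1 A0 B0 BA' N0 fD fA fNA Lu.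
have u01b z : ellipse A B z -> _ := fun Ez => dprim_le A0 B0 M0 K30 Cd b0 b1 b2 Ez.
have [fD0 _ _] := fD.
have fb z : ellipse A B z -> `|f z| <= K3 * B.
  move=> Ez; rewrite -fD0; last exact: sub_closure_ellipse.
  by rewrite (le_trans (b0 _ Ez)) // ler_wpM2l // Cu_leB.
pose K4 := (K3 + 2 * M) * (B ^+ 2 / A) + 2 * B * M.
(* common bounds for the profile and the cut-off function, and for f and grad u0 *)
pose K := K1 + K2; pose M' := K3 * B + `|K4|.
have K0 : 0 <= K by rewrite addr_ge0.
have fM z : ellipse A B z -> `|f z| <= M'.
  by move=> Ez; rewrite (le_trans (fb _ Ez)) // lerDl.
have u01M z : ellipse A B z -> `|dprim (A := A) (B := B) (D0 := Df 0%N 0%N) (D1 := Df 1%N 0%N) (D2 := Df 0%N 1%N) z| <= M'.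
  move=> Ez; rewrite (le_trans (u01b _ Ez)) // (le_trans (ler_norm _)) //.
  by rewrite lerDr mulr_ge0 // ltW.
pose V := chord_total (A := A) (B := B) (f := f).
have HV (q : R) : `|q| < 1 -> [/\ is_derive q (1 : R) V (V' q), {for q, continuous V'},
        `|V q| <= K * (1 - q ^+ 2) & `|V' q| <= K].
  move=> q1; have [v1 v2 v3 v4] := HV1 q q1.
  have q2 : 0 <= 1 - q ^+ 2.
    by rewrite subr_ge0 -(real_normK (num_real q)) expr_le1 // ltW.
  split=> //; last by rewrite (le_trans v4) // lerDl.
  by rewrite (le_trans v3) // ler_wpM2r // lerDl.
have Hd (x : R) : 0 < x < rho -> [/\ is_derive x (1 : R) delta (delta' x),
    {for x, continuous delta'}, `|delta x| <= K & `|delta' x| <= K].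
  move=> xr; have [h1 h2] := dd x xr; have [h3 h4] := db x xr.
  by split=> //; [rewrite (le_trans h3) // lerDr|rewrite (le_trans h4) // lerDr].
have HU z : ellipse A B z -> `|u0 z| <= M' * (Cu A B z.1 - z.2).
  by move=> Ez; exact: (limit_solution_upper_trace A0 B0 Lu Ez fM).
have HT z : ellipse A B z -> `|u0 z - V (z.1 / A)| <= M' * (z.2 + Cu A B z.1).
  move=> Ez; rewrite /V /chord_total (_ : A * (z.1 / A) = z.1).
    exact: (limit_solution_lower_trace A0 B0 fD Lu Ez fM).
  by field; rewrite gt_eqF.
have [u0V u0A] := lower_boundary_values A0 B0 Lu.
pose c := 2 * expR A ^+ 2 * (layer_constant (A := A) (B := B) (a := a) (rho := rho) (K := K) * (2 * A * pi) +
   4 * M' ^+ 2 * fine (@lebesgue2 R (box A))).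
pose c' := `|c|.
exists (1 + (Num.sqrt (2 * c') + Num.sqrt (4 * c'))); split.
  by rewrite ltr_pwDl // addr_ge0 // sqrtr_ge0.
have n0 : \forall eps \near (0 : R)^'+, 0 < eps by exact: nbhs_right_gt.
have n8 : \forall eps \near (0 : R)^'+, eps <= 8^-1.
  by apply: nbhs_right_le; rewrite invr_gt0.
apply: filterS2 n0 n8 => eps e0 e8 u phi Su Hphi /=.
set w := fun z => _.
have e1 : eps <= 1 by rewrite (le_trans e8) // invf_le1 ?ler1n ?ltr0n.
have [d10 [d01 [d20 [d11 [d02 [Cu Cd10 Cd01 uE]]]]]] := solution_C1 Su.
have [_ cu _ ub] := Su.
have [cw HE] := layer_energy B0 BA a0 rho0 aA aB K0 HV Hd d0 d1 e0 HU HT Cu0 u01M fM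
  Cu Cd10 Cd01 uE cu ub e8.
have oE : open (ellipse A B) by exact: open_ellipse.
have Cv := C1on_remainder B0 BA a0 rho0 aA aB HV Hd d0 e0 Cu0 Cu.
have EB : ellipse A B `<=` (box A : set (R * R)) by exact: ellipse_box.
apply: (le_trans (norms_of_energy (u := w) (C := c') oE EB cw _ _ _ e0 e1 _ _)).
- by move=> z; exact: off_ellipse0_out.
- by apply: (C1on_eq oE Cv) => z Ez //; rewrite off_ellipse0_in.
- move=> z Ez; rewrite off_ellipse0_in // /w.
  by rewrite (corrector_low B0 BA a0 rho0 aA aB Hphi u0V u0A Ez).
- exact: normr_ge0.
- apply: (le_trans HE); rewrite lee_fin ler_wpM2r ?(ltW e0) //; apply: ler_norm.
- by rewrite lee_fin ler_wpM2r ?sqrtr_ge0 // lerDr.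
Qed.
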